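(* Let $m\ge 1$ and consider the Berger spheres $(S^{2m+1},g_\mu)$, $\mu\neq 0$, with Hopf unit vector field $V^\mu$. Then: (i) for all $\mu<0$, $V^\mu$ is an unstable critical point of the energy $E$ and an unstable critical point of the volume $F$; (ii) for all $\lambda<0$ and all $\mu\neq 0$, $V^\mu$ is an unstable critical point of the generalized energy $E_{g_\lambda}$.
   Context: Hopf field and Berger metrics. $S^{2m+1}\subset\mathbb{R}^{2m+2}\cong\mathbb{C}^{m+1}$ is the unit sphere, $g$ its usual metric, $N$ the outward unit normal ($N(p)=p$), $J$ the usual complex structure of $\mathbb{R}^{2m+2}$, and $V=JN$ (so $V(p)=ip$). For $\mu\neq0$ the metric $g_\mu$ on $S^{2m+1}$ is defined by $g_\mu|_{V^\perp}=g|_{V^\perp}$, $g_\mu(V,V)=\mu\, g(V,V)$, $g_\mu(V,V^\perp)=0$; it is Riemannian if $\mu>0$ and Lorentzian if $\mu<0$ (Berger metrics). The Hopf vector field is $V^\mu=\frac{1}{\sqrt{|\mu|}}V$; it satisfies $g_\mu(V^\mu,V^\mu)=\varepsilon_\mu:=\mu/|\mu|$. Let $\nabla^\mu$ be the Levi-Civita connection of $g_\mu$. Functionals. For a vector field $X$ on $(S^{2m+1},g_\mu)$ let $X^*g_\mu^S$ be the pull-back of the Sasaki metric, i.e. $(X^*g^S_\mu)(Y,Z)=g_\mu(Y,Z)+g_\mu(\nabla^\mu_YX,\nabla^\mu_ZX)$, and let $L_X$ be the endomorphism with $(X^*g^S_\mu)(Y,Z)=g_\mu(L_X Y,Z)$.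 For $\lambda\ne0$ the generalized energy is $E_{g_\lambda}(X)=\frac12\int_{S^{2m+1}}\operatorname{tr}(L_{(g_\lambda,X)})\,\mathrm{dv}_{g_\lambda}$, where $L_{(g_\lambda,X)}$ is determined by $(X^*g^S_\mu)(Y,Z)=g_\lambda(L_{(g_\lambda,X)}Y,Z)$ and $\mathrm{dv}_{g_\lambda}$ is the (positive) volume measure of $g_\lambda$. The energy is $E=E_{g_\mu}$, i.e. $E(X)=\frac12\int\operatorname{tr}L_X\,\mathrm{dv}_{g_\mu}$. The volume is $F(X)=\int_{S^{2m+1}}\sqrt{\det L_X}\,\mathrm{dv}_{g_\mu}$. The functionals $E$ and $E_{g_\lambda}$ are restricted to the set of smooth vector fields $X$ with $g_\mu(X,X)=\varepsilon_\mu$ (unit vector fields if $\mu>0$, unit timelike if $\mu<0$); for $\mu<0$ the functional $F$ is restricted to those unit timelike $X$ for which $X^*g_\mu^S$ is a Lorentzian metric (an open set containing $V^\mu$). Stability. A critical point is understood with respect to these restricted sets. The Hessian of a functional $\Phi$ at a critical point $X$, acting on a smooth vector field $A$ that is $g_\mu$-orthogonal to $X$, is $(\mathrm{Hess}\,\Phi)_X(A)=\frac{d^2}{dt^2}\big|_{t=0}\Phi(X_t)$ for any smooth variation $X_t$ within the set with $X_0=X$, $\frac{d}{dt}|_{t=0}X_t=A$. The critical point is stable if the Hessian is positive semi-definite, and unstable otherwise, i.e. if $(\mathrm{Hess}\,\Phi)_X(A)<0$ for some $A$. *)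

(* Defs.v *)
From HB Require Import structures.
From mathcomp Require Import all_boot all_order all_algebra.
From mathcomp Require Import all_classical all_reals all_analysis.

Set Implicit Arguments.
Unset Strict Implicit.
Unset Printing Implicit Defensive.

Import Order.TTheory GRing.Theory Num.Theory.
Import numFieldNormedType.Exports.

Local Open Scope classical_set_scope.
Local Open Scope ring_scope.

(* Smooth maps on an open set U: for every k, all iterated directional
   derivatives up to order k exist on U and are continuous there. *)
Fixpoint Ck (R : realType) (V W : normedModType R) (k : nat)
    (U : set V) (f : V -> W) : Prop :=
  match k with
  | 0 => forall x, U x -> {for x, continuous f}
  | k'.+1 => (forall x, U x -> differentiable f x) /\
             (forall v : V, Ck k' U (fun x => 'D_v f x))
  end.

Definition smooth_on (R : realType) (V W : normedModType R)
    (U : set V) (f : V -> W) : Prop := forall k, Ck k U f.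

(* Integral over R^k of a nonnegative Borel function with respect to Lebesgue
   measure (the k-fold product of [lebesgue_measure]), as an iterated
   integral (Tonelli). *)
Fixpoint integral_rV (R : realType) (k : nat) :
    ('rV[R]_k -> \bar R) -> \bar R :=
  match k with
  | 0 => fun f => f 0
  | k'.+1 => fun f =>
      (\int[@lebesgue_measure R]_t
         integral_rV (fun x : 'rV[R]_k' => f (row_mx (const_mx t : 'rV_1) x)))%E
  end.

Section Sphere.
Context {R : realType} {n : nat}.
Local Notation E := 'rV[R]_n.

Definition dot (u v : E) : R := (u *m v^T) 0 0.

(* The norm `|_| of 'rV[R]_n is the sup norm. *)
Definition enorm (u : E) : R := Num.sqrt (dot u u).

Definition sphere : set E := [set p | dot p p = 1].

Definition tangent (p v : E) : Prop := dot p v = 0.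

(* Functions and vector fields on the sphere are represented by functions
   defined on the whole of E, of which only the restriction to the sphere is
   meaningful. Differential notions on the sphere are those of the
   0-homogeneous extension of this restriction to E \ {0}. *)
Definition ext (W : Type) (f : E -> W) : E -> W :=
  fun x => f ((enorm x)^-1 *: x).

Definition smoothS (W : normedModType R) (f : E -> W) : Prop :=
  smooth_on [set x | x != 0] (ext f).

Definition vfield (X : E -> E) : Prop :=
  smoothS X /\ forall p, sphere p -> tangent p (X p).

Definition lie_bracket (X Y : E -> E) (p : E) : E :=
  'D_(X p) (ext Y) p - 'D_(Y p) (ext X) p.

(* A (pseudo-Riemannian) metric on the sphere: [g p] is only meaningful on
   vectors tangent to the sphere at p. *)
Definition metric : Type := E -> E -> E -> R.

(* [nabla X p v] is the covariant derivative of X at p in the direction v. *)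
Record levi_civita (g : metric) (nabla : (E -> E) -> E -> E -> E) : Prop :=
  LeviCivita {
  lc_vfield : forall X Y, vfield X -> vfield Y ->
    vfield (fun p => nabla X p (Y p));
  lc_linear : forall X p a v w, vfield X -> sphere p ->
    tangent p v -> tangent p w ->
    nabla X p (a *: v + w) = a *: nabla X p v + nabla X p w;
  lc_additive : forall X Y p v, vfield X -> vfield Y -> sphere p ->
    tangent p v ->
    nabla (fun q => X q + Y q) p v = nabla X p v + nabla Y p v;
  lc_leibniz : forall (f : E -> R^o) X p v, smoothS f -> vfield X ->
    sphere p -> tangent p v ->
    nabla (fun q => f q *: X q) p v = 'D_v (ext f) p *: X p + f p *: nabla X p v;
  lc_metric : forall X Y p v, vfield X -> vfield Y -> sphere p ->
    tangent p v ->
    'D_v (ext (fun q => g q (X q) (Y q) : R^o)) p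
      = g p (nabla X p v) (Y p) + g p (X p) (nabla Y p v);
  lc_torsion_free : forall X Y p, vfield X -> vfield Y -> sphere p ->
    nabla Y p (X p) - nabla X p (Y p) = lie_bracket X Y p
  }.

Definition gram (k : nat) (h : E -> E -> R) (B : 'M[R]_(k, n)) : 'M[R]_k :=
  \matrix_(i, j) h (row i B) (row j B).

(* Smooth local parametrizations of the (n-1)-dimensional sphere; the rows of
   the Jacobian matrix 'J phi x are the partial derivatives of phi at x. *)
Record parametrization (U : set 'rV[R]_n.-1) (phi : 'rV[R]_n.-1 -> E) : Prop :=
  Parametrization {
  param_open : open U;
  param_smooth : smooth_on U phi;
  param_sphere : forall x, U x -> sphere (phi x);
  param_inj : forall x y, U x -> U y -> phi x = phi y -> x = y;
  param_immersion : forall x, U x -> row_free ('J phi x)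
  }.

Definition borel : Type := g_sigma_algebraType (@open E).

(* nu is the volume measure of g: in any local parametrization it has density
   sqrt |det (g_ij)| with respect to Lebesgue measure. Only the restriction
   of nu to the sphere is meaningful. *)
Definition volume_measure (g : metric) (nu : {measure set borel -> \bar R}) :
    Prop :=
  forall U phi, parametrization U phi ->
  forall B : set borel, measurable B -> B `<=` phi @` U ->
  nu B = integral_rV (fun x =>
    (Num.sqrt `|\det (gram (g (phi x)) ('J phi x))|
     * \1_(U `&` phi @^-1` B) x)%:E).

(* The rows of [tbasis p] form a basis of the tangent space at p. *)
Definition tbasis (p : E) : 'M[R]_(\rank (kermx p^T), n) :=
  row_base (kermx p^T).

(* The matrix, in the basis [tbasis p], of the endomorphism L of the tangent
   space at p determined by h(Y, Z) = g(L Y, Z). *)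
Definition endo_mx (g h : E -> E -> R) (p : E) : 'M[R]_(\rank (kermx p^T)) :=
  gram h (tbasis p) *m invmx (gram g (tbasis p)).

(* h is a symmetric bilinear form; it is Lorentzian when it has matrix
   diag(-1, 1, ..., 1) in some basis of the tangent space. *)
Definition lorentzian_at (h : E -> E -> R) (p : E) : Prop :=
  exists2 P : 'M[R]_(\rank (kermx p^T)), P \in unitmx &
    gram h (P *m tbasis p) =
      diag_mx (\row_i (if (i == 0 :> nat)%N then -1 else 1)).

Definition pullback_sasaki (g : metric) (nabla : (E -> E) -> E -> E -> E)
    (X : E -> E) : metric :=
  fun p Y Z => g p Y Z + g p (nabla X p Y) (nabla X p Z).

(* [g0] is the metric used for the trace and [nu] its volume measure. *)
Definition gen_energy (g : metric) (nabla : (E -> E) -> E -> E -> E)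
    (g0 : metric) (nu : {measure set borel -> \bar R}) (X : E -> E) : R :=
  2^-1 * \int[nu]_(p in (sphere : set borel))
           \tr (endo_mx (g0 p) (pullback_sasaki g nabla X p) p).

Definition energy (g : metric) nabla (nu : {measure set borel -> \bar R}) :
    (E -> E) -> R :=
  gen_energy g nabla g nu.

Definition volume (g : metric) (nabla : (E -> E) -> E -> E -> E)
    (nu : {measure set borel -> \bar R}) (X : E -> E) : R :=
  \int[nu]_(p in (sphere : set borel))
     Num.sqrt (\det (endo_mx (g p) (pullback_sasaki g nabla X p) p)).

(* Smooth variations of X within a set D of vector fields. *)
Definition smooth_variation (D : set (E -> E)) (X : E -> E)
    (Xt : R -> E -> E) : Prop :=
  (forall p, sphere p -> Xt 0 p = X p) /\
  exists2 delta : R, 0 < delta &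
    smooth_on [set tx : R^o * E | `|tx.1| < delta /\ tx.2 != 0]
      (fun tx => ext (Xt tx.1) tx.2) /\
    forall t, `|t| < delta -> D (Xt t).

Definition velocity (Xt : R -> E -> E) (p : E) : E :=
  'D_1 (fun t : R^o => Xt t p) 0.

Definition critical (Phi : (E -> E) -> R) (D : set (E -> E)) (X : E -> E) :
    Prop :=
  D X /\ forall Xt, smooth_variation D X Xt ->
    is_derive (0 : R^o) 1 (fun t => Phi (Xt t) : R^o) 0.

(* [hessian Phi D X A h]: the second derivative of Phi at 0 along every
   variation of X within D with initial velocity A (and there is one) is h. *)
Definition hessian (Phi : (E -> E) -> R) (D : set (E -> E)) (X A : E -> E)
    (h : R) : Prop :=
  (exists2 Xt, smooth_variation D X Xt &
     forall p, sphere p -> velocity Xt p = A p) /\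
  (forall Xt, smooth_variation D X Xt ->
     (forall p, sphere p -> velocity Xt p = A p) ->
     let f := (fun t => Phi (Xt t)) : R^o -> R^o in
     (\forall t \near (0 : R^o), derivable f t 1) /\
     is_derive (0 : R^o) 1 (fun t => 'D_1 f t) h).

Definition unstable_critical (g : metric) (Phi : (E -> E) -> R)
    (D : set (E -> E)) (X : E -> E) : Prop :=
  critical Phi D X /\
  exists A h, [/\ vfield A, forall p, sphere p -> g p (A p) (X p) = 0,
                  hessian Phi D X A h & h < 0].

End Sphere.

Arguments borel : clear implicits.

Section Berger.
Context {R : realType} {m : nat}.

(* R^(2m+2) is identified with C^(m+1) by (x, y) |-> x + i y, where x and y
   are the two halves of the row vector. *)
Local Notation E := 'rV[R]_(m.+1 + m.+1).

Definition Jc (u : E) : E := row_mx (- rsubmx u) (lsubmx u).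

(* Jc applied to the outward unit normal N p = p *)
Definition hopf (p : E) : E := Jc p.

(* Component of v orthogonal to the Hopf direction, which has unit length for
   the usual metric. *)
Definition horizontal (p v : E) : E := v - dot v (hopf p) *: hopf p.

Definition berger (mu : R) : metric := fun p Y Z =>
  dot (horizontal p Y) (horizontal p Z)
  + mu * (dot Y (hopf p) * dot Z (hopf p)).

Definition hopf_unit (mu : R) (p : E) : E :=
  (Num.sqrt `|mu|)^-1 *: hopf p.

(* Vector fields X with g_mu(X, X) = mu / |mu|. *)
Definition unit_vfield (mu : R) : set (E -> E) := [set X |
  vfield X /\ forall p, sphere p -> berger mu p (X p) (X p) = mu / `|mu| ].

(* Domain of the volume functional. *)
Definition volume_dom (mu : R) (nabla : (E -> E) -> E -> E -> E) :
    set (E -> E) := [set X |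
  unit_vfield mu X /\
  (mu < 0 -> forall p, sphere p ->
     lorentzian_at (pullback_sasaki (berger mu) nabla X p) p)].

End Berger.

(* Main.v *)
(** Write V for the Hopf field, c = mu / sqrt |mu|, and g = g_mu. The covariant
    derivative N0 of the Hopf unit field is u |-> c J u on horizontal vectors and
    0 on V. If X is a vector field with g(X, X) = mu / |mu| and N is the deviation
    of its covariant derivative from that of the Hopf field, then the linear term
    of both functionals is the integral of tr (N N0^T). Integration by parts along
    the unitary Killing fields turns it into 2 m mu c times the integral of
    <X - V^mu, V>, which by the normalisation of X is quadratic in X - V^mu.
    Hence the Hopf field is critical, and its Hessian at A is an integral of
    first-order quadratic expressions in A, in which |nabla_V A|^2 appears with a
    negative coefficient when lambda < 0 (energy), and with coefficient
    proportional to 1 / mu + 1 / (1 + |mu|) < 0 when mu < 0 (volume).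
    The test fields A_k = conj(z)^k B, with z a complex linear coordinate and
    B a horizontal field linear in p, satisfy D_V A_k = - (k + 1) J A_k, while
    their horizontal derivatives contribute only O(k) times the L^2 norm of A_k,
    because |z|^(2k) concentrates near the circle |z| = 1. So the Hessian at A_k
    is negative for large k.

    The volume measure enters only through finiteness, positivity and its
    invariance under unitary maps; these are read off local parametrizations
    obtained by projecting affine hyperplanes radially to the sphere. *)
Require Import Defs.
From HB Require Import structures.
From mathcomp Require Import all_boot all_order all_algebra.
From mathcomp Require Import all_classical all_reals all_analysis.
From mathcomp Require Import perm measurable_realfun ring lra.

Set Implicit Arguments.
Unset Strict Implicit.
Unset Printing Implicit Defensive.

Import Order.TTheory GRing.Theory Num.Theory.
Import numFieldNormedType.Exports.

Local Open Scope classical_set_scope.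
Local Open Scope ring_scope.

(** * Calculus of [Ck] maps *)

Section CkTheory.
Context {R : realType} {V : normedModType R}.
Implicit Types (U : set V) (k : nat).

(** [hessian] demands one value for all variations with the same velocity, yet the second
    t-derivative of either density contains the acceleration of the variation, through the linear
    term tr (N N0^T). The integration by parts is therefore used at every t and not only at t = 0:
    it provides a function of zero integral whose subtraction removes, pointwise on the sphere, both
    the first derivative and the acceleration. What remains is quadratic in A.

    The matrices over [tbasis p] depend on p in no controlled way. The densities are therefore
    rewritten as traces and determinants of ambient matrices of size 2m + 2 acting on row vectors,
    which are smooth in p.

    The square root in the volume raises two points of its own when mu < 0. Its argument is positive
    because g_mu and the pulled-back metric are both Lorentzian; and the variation along a test
    field has to stay among the fields with Lorentzian pull-back, which follows from compactness of
    the sphere. *)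

Lemma differentiable_near0 (W : normedModType R) (h : V -> W) (x : V) :
  (\forall y \near x, h y = 0) -> differentiable h x.
Proof.
move=> h0; have hx : h x = 0 by exact: nbhs_singleton h0.
have c0 : continuous (\0 : V -> W) by move=> y; exact: cvg_cst.
have e0 : h \o shift x = cst (h x) + (\0 : V -> W) +o_ (nbhs (0 : V)) id.
  apply/eqaddoP => _/posnumP[e]; near=> y.
  rewrite /= !fctE /cst hx addr0 subr0 /=.
  have -> : h (y + x) = 0; last by rewrite normr0 mulr_ge0.
  near: y; have : (fun y : V => y + x) @ (0 : V) --> x.
    by rewrite -[X in _ --> X]add0r; apply: cvgD; [exact: cvg_id|exact: cvg_cst].
  move=> /(_ _ h0); exact.
have dE := diff_unique c0 e0.
by apply/diff_locallyP; rewrite dE.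
Unshelve. all: by end_near. Qed.

Lemma near_eq_differentiable (W : normedModType R) (f g : V -> W) (x : V) :
  {near x, f =1 g} -> differentiable f x -> differentiable g x.
Proof.
move=> fg df; have -> : g = f + (g - f) by rewrite addrC subrK.
apply: differentiableD => //; apply: differentiable_near0.
by apply: filterS fg => y fgy; rewrite !fctE fgy subrr.
Qed.

(** Openness turns equality on the set into local equality, which passes to every iterated
    derivative. The usual pattern below is to exhibit a formula that is visibly smooth and to
    transfer along it. *)
Lemma eq_Ck (W : normedModType R) k U (f g : V -> W) : open U ->
  (forall x, U x -> f x = g x) -> Ck k U f -> Ck k U g.
Proof.
move=> oU; have nearU (f' g' : V -> W) x :
    (forall x, U x -> f' x = g' x) -> U x -> {near x, f' =1 g'}.
  move=> fg Ux; have := open_nbhs_nbhs (conj oU Ux).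
  by apply: filterS => y /fg.
elim: k f g => [|k IH] f g fg.
  move=> cf x Ux; rewrite /prop_for /continuous_at -(fg x Ux).
  apply: cvg_trans (cf x Ux); apply: near_eq_cvg.
  by apply: (nearU) => // y /fg.
move=> [df Df]; split=> [x Ux|v].
  by apply: near_eq_differentiable (df x Ux); exact: nearU.
apply: IH (Df v) => x Ux; apply: near_eq_derive; exact: nearU.
Qed.

Lemma CkW (W : normedModType R) k U (f : V -> W) : Ck k.+1 U f -> Ck k U f.
Proof.
elim: k f => [|k IH] f [df Df].
  by move=> x Ux; apply: differentiable_continuous; exact: df.
by split=> // v; apply: IH.
Qed.

Lemma Ck_subset (W : normedModType R) k U U' (f : V -> W) :
  U' `<=` U -> Ck k U f -> Ck k U' f.
Proof.
move=> UU; elim: k f => [|k IH] f /=; first by move=> cf x /UU; exact: cf.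
by move=> [df Df]; split=> [x /UU|v]; [exact: df|exact: IH].
Qed.

Lemma Ck_cst (W : normedModType R) k U (c : W) : open U -> Ck k U (fun=> c).
Proof.
move=> oU; elim: k c => [|k IH] c.
  by move=> x _; exact: cvg_cst.
split=> [x _|v]; first exact: differentiable_cst.
by apply: eq_Ck (IH 0) => // x _; rewrite derive_cst.
Qed.

Lemma Ck_add (W : normedModType R) k U (f g : V -> W) : open U ->
  Ck k U f -> Ck k U g -> Ck k U (fun x => f x + g x).
Proof.
move=> oU; elim: k f g => [|k IH] f g.
  by move=> cf cg x Ux; apply: continuousD; [exact: cf|exact: cg].
move=> [df Df] [dg Dg]; split=> [x Ux|v].
  by apply: differentiableD; [exact: df|exact: dg].
apply: eq_Ck (IH _ _ (Df v) (Dg v)) => // x Ux.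
by rewrite deriveD//; apply: diff_derivable; [exact: df|exact: dg].
Qed.

Lemma Ck_lin (W Z : normedModType R) (L : {linear W -> Z}) k U (f : V -> W) :
  open U -> continuous L -> Ck k U f -> Ck k U (L \o f).
Proof.
move=> oU cL; elim: k f => [|k IH] f.
  by move=> cf x Ux; apply: continuous_comp; [exact: cf|exact: cL].
move=> [df Df]; split=> [x Ux|v].
  by apply: differentiable_comp; [exact: df|exact: linear_differentiable].
apply: eq_Ck (IH _ (Df v)) => // x Ux /=.
have dfx := df x Ux.
have dL : differentiable L (f x) by exact: linear_differentiable.
rewrite [RHS]deriveE; last exact: differentiable_comp.
by rewrite diff_comp// diff_lin// deriveE.
Qed.

Lemma Ck_linear (W : normedModType R) (L : {linear V -> W}) k U :
  open U -> continuous L -> Ck k U L.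
Proof.
move=> oU cL; case: k => [|k]; first by move=> x _; exact: cL.
split=> [x _|v]; first exact: linear_differentiable.
apply: eq_Ck (Ck_cst _ (L v) oU) => // x _.
by rewrite deriveE ?diff_lin//; exact: linear_differentiable.
Qed.

Lemma Ck_id k U : open U -> Ck k U (id : V -> V).
Proof. by move=> oU; apply: (@Ck_linear V idfun) => // x; exact: cvg_id. Qed.

Lemma Ck_mul k U (f g : V -> R) : open U ->
  Ck k U f -> Ck k U g -> Ck k U (fun x => f x * g x).
Proof.
move=> oU; elim: k f g => [|k IH] f g.
  by move=> cf cg x Ux; apply: continuousM; [exact: cf|exact: cg].
move=> Cf Cg; have [[df Df] [dg Dg]] := (Cf, Cg); split=> [x Ux|v].
  by apply: differentiableM; [exact: df|exact: dg].
have := Ck_add oU (IH _ _ (CkW Cf) (Dg v)) (IH _ _ (CkW Cg) (Df v)).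
apply: eq_Ck => // x Ux.
by rewrite deriveM//; apply: diff_derivable; [exact: df|exact: dg].
Qed.

Lemma Ck_opp k U (f : V -> R) : open U -> Ck k U f -> Ck k U (fun x => - f x).
Proof.
move=> oU Cf; have := Ck_mul oU (Ck_cst k (-1 : R) oU) Cf.
by apply: eq_Ck => // x _; rewrite mulN1r.
Qed.

Lemma Ck_sub k U (f g : V -> R) : open U ->
  Ck k U f -> Ck k U g -> Ck k U (fun x => f x - g x).
Proof. by move=> oU Cf Cg; apply: Ck_add => //; exact: Ck_opp. Qed.

(** The derivative - f^-2 Df involves the inverse itself only at the previous order, hence the
    induction on k. *)
Lemma Ck_inv k U (f : V -> R) : open U -> (forall x, U x -> f x != 0) ->
  Ck k U f -> Ck k U (fun x => (f x)^-1).
Proof.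
move=> oU f0; elim: k => [|k IH].
  by move=> cf x Ux; apply: (@continuousV _ _ f) => //; [exact: f0|exact: cf].
move=> Cf; have [df Df] := Cf; split=> [x Ux|v].
  by apply: (@differentiableV _ _ f); [exact: df|exact: f0].
have Ci := IH (CkW Cf).
have := Ck_opp oU (Ck_mul oU (Ck_mul oU Ci Ci) (Df v)).
apply: eq_Ck => // x Ux.
rewrite (@deriveV _ _ f) ?f0//; last by apply: diff_derivable; exact: df.
by rewrite /GRing.scale/= mulNr expr2 invfM.
Qed.

Lemma Ck_sqrt k U (f : V -> R) : open U -> (forall x, U x -> 0 < f x) ->
  Ck k U f -> Ck k U (fun x => Num.sqrt (f x)).
Proof.
move=> oU f0; elim: k => [|k IH].
  move=> cf x Ux; apply: (@continuous_comp _ _ _ f Num.sqrt); first exact: cf.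
  exact: sqrt_continuous.
move=> Cf; have [df Df] := Cf.
have dsq x : U x -> differentiable (Num.sqrt : R -> R) (f x).
  move=> Ux; apply/derivable1_diffP.
  by have [] := is_derive1_sqrt (f0 x Ux).
split=> [x Ux|v].
  by apply: (@differentiable_comp _ _ _ _ f Num.sqrt); [exact: df|exact: dsq].
have n0 x : U x -> 2 * Num.sqrt (f x) != 0.
  by move=> Ux; rewrite mulf_neq0// gt_eqF// sqrtr_gt0 f0.
have := Ck_mul oU (Df v)
  (Ck_inv oU n0 (Ck_mul oU (Ck_cst k (2 : R) oU) (IH (CkW Cf)))).
apply: eq_Ck => // x Ux.
rewrite [RHS]deriveE; last first.
  by apply: (@differentiable_comp _ _ _ _ f Num.sqrt); [exact: df|exact: dsq].
rewrite (@diff_comp _ _ _ _ f Num.sqrt); [|exact: df|exact: dsq].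
rewrite /= deriveE; last exact: df.
rewrite diff1E; last exact: dsq.
by rewrite derive1E (derive_sqrt (f0 x Ux)).
Qed.

Lemma Ck_sum (W : normedModType R) k U (I : Type) (r : seq I) (P : pred I)
    (f : I -> V -> W) : open U ->
  (forall i, P i -> Ck k U (f i)) -> Ck k U (fun x => \sum_(i <- r | P i) f i x).
Proof.
move=> oU Cf; elim: r => [|i r IH].
  by apply: eq_Ck oU _ (Ck_cst k (0 : W) oU) => // x _; rewrite big_nil.
case Pi : (P i); last by apply: eq_Ck IH => // x _; rewrite big_cons Pi.
by apply: eq_Ck (Ck_add oU (Cf i Pi) IH) => // x _; rewrite big_cons Pi.
Qed.

Lemma Ck_prod k U (I : Type) (r : seq I) (P : pred I)
    (f : I -> V -> R) : open U ->
  (forall i, P i -> Ck k U (f i)) -> Ck k U (fun x => \prod_(i <- r | P i) f i x).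
Proof.
move=> oU Cf; elim: r => [|i r IH].
  by apply: eq_Ck oU _ (Ck_cst k (1 : R) oU) => // x _; rewrite big_nil.
case Pi : (P i); last by apply: eq_Ck IH => // x _; rewrite big_cons Pi.
by apply: eq_Ck (Ck_mul oU (Cf i Pi) IH) => // x _; rewrite big_cons Pi.
Qed.

Lemma Ck_exp k U (f : V -> R) e : open U ->
  Ck k U f -> Ck k U (fun x => f x ^+ e).
Proof.
move=> oU Cf; elim: e => [|e IH]; first exact: Ck_cst.
by apply: eq_Ck (Ck_mul oU Cf IH) => // x _; rewrite exprS.
Qed.

Lemma Ck_scale (W : normedModType R) k U (f : V -> R) (w : W) : open U ->
  Ck k U f -> Ck k U (fun x => f x *: w).
Proof.
move=> oU; elim: k f => [|k IH] f.
  by move=> cf x Ux; apply: cvgZr_tmp; exact: cf.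
move=> [df Df]; split=> [x Ux|v]; first by apply: differentiableZl; exact: df.
apply: eq_Ck (IH _ (Df v)) => // x Ux; rewrite [RHS]deriveE.
  by rewrite diffZl ?deriveE//; exact: df.
by apply: differentiableZl; exact: df.
Qed.

Lemma Ck_mx (p q k : nat) U (f : V -> 'M[R]_(p, q)) : open U ->
  (forall i j, Ck k U (fun x => f x i j)) -> Ck k U f.
Proof.
move=> oU Cf; have := @Ck_sum _ k U _ (index_enum 'I_p) xpredT
  (fun i x => \sum_j f x i j *: delta_mx i j) oU.
move=> H; apply: eq_Ck (H _) => // [x _|i _]; first by rewrite -matrix_sum_delta.
by apply: Ck_sum => // j _; exact: Ck_scale.
Qed.

Lemma Ck_entry (p q k : nat) U (f : V -> 'M[R]_(p, q)) i j : open U ->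
  Ck k U f -> Ck k U (fun x => f x i j).
Proof.
move=> oU Cf.
pose L : 'M[R]_(p, q) -> R := fun M => M i j.
have lL : linear L by move=> a u v; rewrite /L !mxE.
pose LL : {linear 'M[R]_(p, q) -> R} := HB.pack L (GRing.isLinear.Build _ _ _ _ _ lL).
by apply: (@Ck_lin _ _ LL) => //; exact: coord_continuous.
Qed.

Lemma Ck_mulmx (p q r k : nat) U (f : V -> 'M[R]_(p, q)) (g : V -> 'M[R]_(q, r)) :
  open U -> Ck k U f -> Ck k U g -> Ck k U (fun x => f x *m g x).
Proof.
move=> oU Cf Cg; apply: Ck_mx => // i j.
apply: (@eq_Ck _ _ _ (fun x => \sum_l f x i l * g x l j)) => //.
  by move=> x _; rewrite mxE.
by apply: Ck_sum => // l _; apply: Ck_mul => //; exact: Ck_entry.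
Qed.

Lemma Ck_trmx (p q k : nat) U (f : V -> 'M[R]_(p, q)) :
  open U -> Ck k U f -> Ck k U (fun x => (f x)^T).
Proof.
move=> oU Cf; apply: Ck_mx => // i j.
apply: (@eq_Ck _ _ _ (fun x => f x j i)) => //; last exact: Ck_entry.
by move=> x _; rewrite mxE.
Qed.

Lemma Ck_scalemx (p q k : nat) U (a : V -> R) (f : V -> 'M[R]_(p, q)) :
  open U -> Ck k U a -> Ck k U f -> Ck k U (fun x => a x *: f x).
Proof.
move=> oU Ca Cf; apply: Ck_mx => // i j.
apply: (@eq_Ck _ _ _ (fun x => a x * f x i j)) => //.
  by move=> x _; rewrite mxE.
by apply: Ck_mul => //; exact: Ck_entry.
Qed.

Lemma Ck_subv (p q k : nat) U (f g : V -> 'M[R]_(p, q)) :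
  open U -> Ck k U f -> Ck k U g -> Ck k U (fun x => f x - g x).
Proof.
move=> oU Cf Cg; apply: Ck_mx => // i j.
apply: (@eq_Ck _ _ _ (fun x => f x i j - g x i j)) => //.
  by move=> x _; rewrite !mxE.
by apply: Ck_sub => //; exact: Ck_entry.
Qed.

Lemma Ck_trace (p k : nat) U (f : V -> 'M[R]_p) :
  open U -> Ck k U f -> Ck k U (fun x => \tr (f x)).
Proof. by move=> oU Cf; apply: Ck_sum => // i _; exact: Ck_entry. Qed.

Lemma Ck_det (p k : nat) U (f : V -> 'M[R]_p) :
  open U -> Ck k U f -> Ck k U (fun x => \det (f x)).
Proof.
move=> oU Cf; apply: Ck_sum => // s _; apply: Ck_mul => //; first exact: Ck_cst.
by apply: Ck_prod => // i _; exact: Ck_entry.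
Qed.

Lemma Ck_derive (W : normedModType R) k U (f : V -> W) v :
  Ck k.+1 U f -> Ck k U (fun x => 'D_v f x).
Proof. by move=> [_]; exact. Qed.

End CkTheory.

Lemma differentiable_id (R : realType) (V : normedModType R) (x : V) :
  differentiable (id : V -> V) x.
Proof. exact: ex_diff. Qed.

(** * Symmetry of second derivatives and slices of maps on a product *)

Section Curves.
Context {R : realType} {V : normedModType R}.

Lemma is_derive_curve (W : normedModType R) (f : V -> W) (c : R -> V) (s : R)
    (c' : V) :
  is_derive s 1 c c' -> differentiable f (c s) ->
  is_derive s 1 (f \o c) ('D_c' f (c s)).
Proof.
move=> [dc ec] df; have dcs : differentiable c s by exact/derivable1_diffP.
have dfc : differentiable (f \o c) s by exact: differentiable_comp.
apply: DeriveDef; first exact/derivable1_diffP.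
have ec' : 'd c s 1 = c' by rewrite -deriveE.
by rewrite deriveE// diff_comp//= ec' deriveE.
Qed.

Lemma is_derive_line (W : normedModType R) (f : V -> W) (x u : V) (s : R) :
  differentiable f (x + s *: u) ->
  is_derive s 1 (fun a : R => f (x + a *: u)) ('D_u f (x + s *: u)).
Proof.
move=> df; apply: (@is_derive_curve _ f (fun a => x + a *: u)) => //.
have dZ : differentiable (fun a : R => a *: u) s.
  exact/differentiableZl/(@differentiable_id _ R^o).
have -> : (fun a : R => x + a *: u) = cst x + (fun a : R => a *: u) by [].
rewrite -[u in is_derive _ _ _ u]add0r; apply: is_deriveD.
apply: DeriveDef; first exact: diff_derivable.
rewrite deriveE// diffZl; last exact: (@differentiable_id _ R^o).
by rewrite diff_val scale1r.
Qed.

(** Mean value theorem along u for the increment of f in direction v, then along v for ['D_u f]. The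
    left-hand side is symmetric in u and v, which is what [schwarz] exploits. *)
Lemma mixed_difference (U : set V) (f : V -> R) (x u v : V) (h : R) : 0 < h ->
  (forall a b, 0 <= a <= h -> 0 <= b <= h -> U (x + a *: u + b *: v)) ->
  Ck 2 U f ->
  exists a b, [/\ 0 <= a <= h, 0 <= b <= h &
    f (x + h *: u + h *: v) - f (x + h *: u) - (f (x + h *: v) - f x)
    = h * h * 'D_v (fun y => 'D_u f y) (x + a *: u + b *: v)].
Proof.
move=> h0 HU [df /(_ u)[dDf _]].
have h00 : 0 <= h <= h by rewrite lexx ltW.
have z0 : 0 <= (0 : R) <= h by rewrite lexx ltW.
pose phi a := f (x + h *: v + a *: u) - f (x + a *: u).
have dphi a : 0 <= a <= h -> is_derive a 1 phi
    ('D_u f (x + h *: v + a *: u) - 'D_u f (x + a *: u)).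
  move=> ah; apply: is_deriveB; apply: is_derive_line; apply: df.
    by rewrite addrAC; exact: HU.
  by have := HU a 0 ah z0; rewrite scale0r addr0.
have [a ah] : exists2 a, a \in `]0, h[ & phi h - phi 0 =
    ('D_u f (x + h *: v + a *: u) - 'D_u f (x + a *: u)) * (h - 0).
  apply: (@MVT R phi (fun a => 'D_u f (x + h *: v + a *: u) - 'D_u f (x + a *: u)) _ _ h0).
    by move=> a; rewrite in_itv/= => /andP[? ?]; apply: dphi; rewrite !ltW.
  apply: derivable_within_continuous => a; rewrite in_itv/= => ah.
  by have [] := dphi a ah.
rewrite subr0 => phiE; move: ah; rewrite in_itv/= => /andP[a0 ah].
have {}ah : 0 <= a <= h by rewrite !ltW.
pose psi b := 'D_u f (x + a *: u + b *: v).
have dpsi b : 0 <= b <= h -> is_derive b 1 psi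
    ('D_v (fun y => 'D_u f y) (x + a *: u + b *: v)).
  by move=> bh; apply: is_derive_line; apply: dDf; exact: HU.
have [b bh] : exists2 b, b \in `]0, h[ & psi h - psi 0 =
    'D_v (fun y => 'D_u f y) (x + a *: u + b *: v) * (h - 0).
  apply: (@MVT R psi (fun b => 'D_v (fun y => 'D_u f y) (x + a *: u + b *: v)) _ _ h0).
    by move=> b; rewrite in_itv/= => /andP[? ?]; apply: dpsi; rewrite !ltW.
  apply: derivable_within_continuous => b; rewrite in_itv/= => bh.
  by have [] := dpsi b bh.
rewrite subr0 => psiE; move: bh; rewrite in_itv/= => /andP[b0 bh].
exists a, b; split=> //; first by rewrite !ltW.
move: phiE psiE; rewrite /phi /psi !scale0r !addr0 (addrAC x (a *: u)).
rewrite (addrAC x (h *: v) (h *: u)) => e1 e2.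
by rewrite -mulrA [h * 'D_v _ _]mulrC -e2 mulrC -e1.
Qed.

Lemma continuous2_ball (U : set V) (F G : V -> R) (x : V) (e : R) :
  open U -> U x -> 0 < e -> {for x, continuous F} -> {for x, continuous G} ->
  exists2 r, 0 < r & forall y, ball x r y ->
    [/\ U y, `|F x - F y| < e & `|G x - G y| < e].
Proof.
move=> oU Ux e0 /cvgrPdist_lt/(_ _ e0) c1 /cvgrPdist_lt/(_ _ e0) c2.
have : nbhs x (U `&` ([set y | `|F x - F y| < e] `&` [set y | `|G x - G y| < e])).
  by apply: filterI (open_nbhs_nbhs (conj oU Ux)) _; exact: filterI c1 c2.
move=> /nbhs_ballP[r /= r0 H].
by exists r => // y /H[? []].
Qed.

(** The same second difference is, by [mixed_difference] in both orders, a value of each mixed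
    derivative at a point close to x; continuity of both at x concludes. *)
Lemma schwarz (U : set V) (f : V -> R) (x u v : V) : open U -> U x -> Ck 2 U f ->
  'D_v (fun y => 'D_u f y) x = 'D_u (fun y => 'D_v f y) x.
Proof.
move=> oU Ux Cf; apply/eqP; rewrite -subr_eq0 -normr_le0.
apply/ler_addgt0Pr => e e0; rewrite add0r.
have e20 : 0 < e / 2 by rewrite divr_gt0.
have c1 : {for x, continuous (fun y => 'D_v (fun y => 'D_u f y) y)}.
  by case: Cf => _ /(_ u)[_ /(_ v)]; apply.
have c2 : {for x, continuous (fun y => 'D_u (fun y => 'D_v f y) y)}.
  by case: Cf => _ /(_ v)[_ /(_ u)]; apply.
have [r r0 Br] := continuous2_ball oU Ux e20 c1 c2.
(* All points of the parallelogram are within h (|u| + |v|) <= r / 2 of x; the summand 1 keeps [N]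
   positive when u = v = 0. *)
pose N := `|u| + `|v| + 1.
have N0 : 0 < N by rewrite ltr_wpDl// addr_ge0.
pose h := r / 2 / N.
have h0 : 0 < h by rewrite !divr_gt0.
have inB a b : 0 <= a <= h -> 0 <= b <= h -> ball x r (x + a *: u + b *: v).
  move=> /andP[a0 ah] /andP[b0 bh].
  rewrite -ball_normE /= -addrA opprD addNKr normrN.
  apply: le_lt_trans (ler_normD _ _) _; rewrite !normrZ !ger0_norm//.
  apply: (@le_lt_trans _ _ (h * N)).
    by rewrite !mulrDr mulr1 ler_wpDr ?(ltW h0)// lerD ?ler_wpM2r.
  by rewrite /h divfK ?gt_eqF// ltr_pdivrMr// ltr_pMr// ltr1n.
have CfU : forall a b, 0 <= a <= h -> 0 <= b <= h -> U (x + a *: u + b *: v).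
  by move=> a b ah bh; have [] := Br _ (inB a b ah bh).
have CfU' : forall a b, 0 <= a <= h -> 0 <= b <= h -> U (x + a *: v + b *: u).
  by move=> a b ah bh; rewrite addrAC; apply: CfU.
have [a [b [ah bh E1]]] := mixed_difference h0 CfU Cf.
have [c [d [ch dh E2]]] := mixed_difference h0 CfU' Cf.
have E : 'D_v (fun y => 'D_u f y) (x + a *: u + b *: v) =
         'D_u (fun y => 'D_v f y) (x + c *: v + d *: u).
  move: E1 E2; rewrite (addrAC x (h *: v)); move: ('D_v _ _) ('D_u _ _) => p q.
  move: (f _) (f _) (f _) (f _) => f0 f1 f2 f3 E1 E2.
  have hh : h * h != 0 by rewrite mulf_neq0// gt_eqF.
  by apply: (mulfI hh); rewrite -E1 -E2; ring.
have [_ H1 _] := Br _ (inB a b ah bh).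
have [_ _ H2] := Br _ (inB d c dh ch).
rewrite (addrAC x) in H2.
move: H1 H2; rewrite E; move: ('D_v _ x) ('D_u _ x) ('D_u _ _) => p q w H1 H2.
have -> : p - q = (p - w) - (q - w) by rewrite opprB addrA subrK.
apply: le_trans (ler_normB _ _) _; rewrite (splitr e).
by apply: lerD; [exact: ltW H1|exact: ltW H2].
Qed.

End Curves.

Section ProductSlices.
Context {R : realType} {V W : normedModType R}.
Implicit Type F : R^o * V -> W.

(** Both derivatives are limits of the same difference quotient, whatever the two source spaces.
    This passes from the product of time and space to its slices. *)
Lemma derive_quotient (V1 V2 : normedModType R) (f1 : V1 -> W) (f2 : V2 -> W)
    (a1 v1 : V1) (a2 v2 : V2) :
  (forall h : R, f1 (h *: v1 + a1) - f1 a1 = f2 (h *: v2 + a2) - f2 a2) ->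
  'D_v1 f1 a1 = 'D_v2 f2 a2 /\ (derivable f1 a1 v1 -> derivable f2 a2 v2).
Proof.
move=> H; rewrite /derive /derivable.
suff -> : (fun h : R => h^-1 *: ((f1 \o shift a1) (h *: v1) - f1 a1)) =
          (fun h : R => h^-1 *: ((f2 \o shift a2) (h *: v2) - f2 a2)) by [].
by apply/funext => h /=; rewrite H.
Qed.

Lemma derive_snd F t x v :
  'D_((0, v) : R^o * V) F (t, x) = 'D_v (fun y => F (t, y)) x.
Proof.
apply: (derive_quotient _).1 => h; congr (F _ - _).
by congr (_, _); rewrite /= scaler0 add0r.
Qed.

Lemma derive_fst F t x :
  'D_((1, 0) : R^o * V) F (t, x) = 'D_1 (fun s : R^o => F (s, x)) t.
Proof.
apply: (derive_quotient _).1 => h; congr (F _ - _).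
by congr (_, _); rewrite /= scaler0 add0r.
Qed.

Lemma derivable_fst F t x :
  derivable F (t, x) ((1, 0) : R^o * V) -> derivable (fun s : R^o => F (s, x)) t 1.
Proof.
apply: (derive_quotient _).2 => h; congr (F _ - _).
by congr (_, _); rewrite /= scaler0 add0r.
Qed.

Lemma is_derive_fst F t x : differentiable F (t, x) ->
  is_derive (t : R^o) 1 (fun s : R^o => F (s, x))
    ('D_((1, 0) : R^o * V) F (t, x)).
Proof.
move=> dF; apply: DeriveDef; last by rewrite derive_fst.
exact/derivable_fst/diff_derivable.
Qed.

Lemma differentiable_slice F t x : differentiable F (t, x) ->
  differentiable (fun y => F (t, y)) x.
Proof.
move=> dF; apply: (@differentiable_comp _ _ _ _ (fun y => (t : R^o, y)) F) dF.
exact: ex_diff.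
Qed.

End ProductSlices.

(** * Euclidean algebra and radial extensions *)

Section Dot.
Context {R : realType} {n : nat}.
Local Notation E := 'rV[R]_n.
Implicit Types (u v w p x : E).

Lemma dotE u v : dot u v = \sum_i u 0 i * v 0 i.
Proof. by rewrite /dot mxE; apply: eq_bigr => i _; rewrite mxE. Qed.

Lemma dotC u v : dot u v = dot v u.
Proof. by rewrite !dotE; apply: eq_bigr => i _; rewrite mulrC. Qed.

Lemma dotDl u v w : dot (u + v) w = dot u w + dot v w.
Proof. by rewrite /dot mulmxDl mxE. Qed.

Lemma dotZl a u w : dot (a *: u) w = a * dot u w.
Proof. by rewrite /dot -scalemxAl mxE. Qed.

Lemma dotDr u v w : dot u (v + w) = dot u v + dot u w.
Proof. by rewrite ![dot u _]dotC dotDl. Qed.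

Lemma dotZr a u w : dot u (a *: w) = a * dot u w.
Proof. by rewrite ![dot u _]dotC dotZl. Qed.

Lemma dotNl u w : dot (- u) w = - dot u w.
Proof. by rewrite -scaleN1r dotZl mulN1r. Qed.

Lemma dotNr u w : dot u (- w) = - dot u w.
Proof. by rewrite ![dot u _]dotC dotNl. Qed.

Lemma dotBl u v w : dot (u - v) w = dot u w - dot v w.
Proof. by rewrite dotDl dotNl. Qed.

Lemma dotBr u v w : dot u (v - w) = dot u v - dot u w.
Proof. by rewrite dotDr dotNr. Qed.

Lemma dot0l u : dot 0 u = 0.
Proof. by rewrite -(scale0r 0) dotZl mul0r. Qed.

Lemma dot0r u : dot u 0 = 0.
Proof. by rewrite dotC dot0l. Qed.

Lemma dot_mulmxl u (M : 'M[R]_n) v : dot (u *m M) v = dot u (v *m M^T).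
Proof. by rewrite /dot trmx_mul trmxK mulmxA. Qed.

Lemma dot_sumr u (I : Type) (r : seq I) (P : pred I) (F : I -> E) :
  dot u (\sum_(i <- r | P i) F i) = \sum_(i <- r | P i) dot u (F i).
Proof. exact: (big_morph (dot u) (dotDr u) (dot0r u)). Qed.

Lemma dot_ge0 u : 0 <= dot u u.
Proof. by rewrite dotE sumr_ge0// => i _; rewrite -expr2 sqr_ge0. Qed.

Lemma dot_eq0 u : (dot u u == 0) = (u == 0).
Proof.
apply/idP/eqP => [|->]; last by rewrite dot0l.
rewrite dotE psumr_eq0 => [/allP u0|i _]; last by rewrite -expr2 sqr_ge0.
apply/rowP => i; rewrite mxE; apply/eqP.
by have := u0 i (mem_index_enum _); rewrite /= mulf_eq0 orbb.
Qed.

Lemma dot_gt0 u : (0 < dot u u) = (u != 0).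
Proof. by rewrite lt_neqAle dot_ge0 andbT eq_sym dot_eq0. Qed.

Lemma dot_cauchy u v : dot u v ^+ 2 <= dot u u * dot v v.
Proof.
have [->|v0] := eqVneq v 0; first by rewrite !dot0r expr0n mulr0.
have vv : 0 < dot v v by rewrite dot_gt0.
have := dot_ge0 (dot v v *: u - dot u v *: v).
rewrite dotBl !dotBr !dotZl !dotZr (dotC v u) => H.
have : 0 <= dot v v * (dot u u * dot v v - dot u v ^+ 2) by lra.
by rewrite pmulr_rge0// subr_ge0.
Qed.

Lemma dot_sum_cauchy (I : finType) (f g : I -> E) :
  (\sum_i dot (f i) (g i)) ^+ 2 <=
    (\sum_i dot (f i) (f i)) * (\sum_i dot (g i) (g i)).
Proof.
set a := \sum_i dot (f i) (g i); set b := \sum_i dot (f i) (f i).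
set c := \sum_i dot (g i) (g i).
have c0 : 0 <= c by apply: sumr_ge0 => i _; exact: dot_ge0.
have H (t s : R) : 0 <= t ^+ 2 * b - 2 * t * s * a + s ^+ 2 * c.
  have -> : t ^+ 2 * b - 2 * t * s * a + s ^+ 2 * c =
      \sum_i dot (t *: f i - s *: g i) (t *: f i - s *: g i).
    rewrite /a /b /c !mulr_sumr -sumrB -big_split/=; apply: eq_bigr => i _.
    by rewrite dotBl !dotBr !dotZl !dotZr (dotC (g i) (f i)); ring.
  by apply: sumr_ge0 => i _; exact: dot_ge0.
have [c00|cn0] := eqVneq c 0.
  have {}H : forall s, 0 <= b - 2 * s * a.
    by move=> s; have := H 1 s; rewrite c00; lra.
  have [->|an0] := eqVneq a 0; first by rewrite c00 expr0n mulr0.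
  (* At this value of s the affine lower bound is b - 2 (b + 1), negative since b >= 0. *)
  have := H ((b + 1) / a); rewrite -mulrA divfK// => H1.
  have b0 : 0 <= b by apply: sumr_ge0 => i _; exact: dot_ge0.
  by exfalso; lra.
have cp : 0 < c by rewrite lt_neqAle eq_sym cn0.
have := H c a; rewrite -subr_ge0 => H1.
have : 0 <= c * (b * c - a ^+ 2) by lra.
by rewrite pmulr_rge0// subr_ge0.
Qed.

Lemma enorm_gt0 u : (0 < enorm u) = (u != 0).
Proof. by rewrite /enorm sqrtr_gt0 dot_gt0. Qed.

Lemma enorm_sqr u : enorm u ^+ 2 = dot u u.
Proof. by rewrite /enorm sqr_sqrtr// dot_ge0. Qed.

Lemma enormZ a u : 0 <= a -> enorm (a *: u) = a * enorm u.
Proof.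
move=> a0; rewrite /enorm dotZl dotZr mulrA -expr2 sqrtrM ?sqr_ge0//.
by rewrite sqrtr_sqr ger0_norm.
Qed.

Lemma enorm_sphere p : sphere p -> enorm p = 1.
Proof. by move=> Sp; rewrite /enorm Sp sqrtr1. Qed.

Lemma sphere_neq0 p : sphere p -> p != 0.
Proof. by move=> Sp; rewrite -dot_gt0 Sp. Qed.

Lemma sphere_normalize u : u != 0 -> sphere ((enorm u)^-1 *: u).
Proof.
move=> u0; rewrite /sphere/= dotZl dotZr mulrA -invfM -expr2 enorm_sqr.
by rewrite mulVf// dot_eq0.
Qed.

Lemma ext_sphere (W : Type) (f : E -> W) p : sphere p -> ext f p = f p.
Proof. by move=> Sp; rewrite /ext enorm_sphere// invr1 scale1r. Qed.

Lemma ext_congr (W : Type) (f g : E -> W) x : x != 0 ->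
  (forall p, sphere p -> f p = g p) -> ext f x = ext g x.
Proof. by move=> x0 fg; apply: fg; exact: sphere_normalize. Qed.

Lemma ext_ext (W : Type) (f : E -> W) x : x != 0 -> ext (ext f) x = ext f x.
Proof. by move=> x0; rewrite /ext enorm_sphere ?invr1 ?scale1r//; exact: sphere_normalize. Qed.

Lemma open_neq0 : open [set x : E | x != 0].
Proof.
rewrite (_ : [set x : E | x != 0] = ~` [set 0]); last first.
  by apply/seteqP; split=> x /eqP.
by apply: closed_openC; exact/accessible_closed_set1/hausdorff_accessible/norm_hausdorff.
Qed.

Lemma continuous_mulmxr (p q r : nat) (M : 'M[R]_(q, r)) :
  continuous (fun u : 'M[R]_(p, q) => u *m M).
Proof.
have C : Ck 0 setT (fun u : 'M[R]_(p, q) => u *m M).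
  by apply: Ck_mulmx; [exact: openT|exact: Ck_id openT|exact: Ck_cst openT].
by move=> u; exact: (C u I).
Qed.

End Dot.

Section CkDot.
Context {R : realType} {V : normedModType R} {n : nat}.
Implicit Types (U : set V) (f g : V -> 'rV[R]_n).

Lemma Ck_dot k U f g : open U -> Ck k U f -> Ck k U g ->
  Ck k U (fun x => dot (f x) (g x)).
Proof.
move=> oU Cf Cg; apply: Ck_entry => //; apply: Ck_mulmx => //.
exact: Ck_trmx.
Qed.

Lemma Ck_enorm k U f : open U -> (forall x, U x -> f x != 0) -> Ck k U f ->
  Ck k U (fun x => enorm (f x)).
Proof.
move=> oU f0 Cf; apply: Ck_sqrt => //; last exact: Ck_dot.
by move=> x Ux; rewrite dot_gt0 f0.
Qed.

Lemma Ck_enormV k U f : open U -> (forall x, U x -> f x != 0) -> Ck k U f ->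
  Ck k U (fun x => (enorm (f x))^-1).
Proof.
move=> oU f0 Cf; apply: Ck_inv => //; last exact: Ck_enorm.
by move=> x Ux; rewrite gt_eqF// enorm_gt0 f0.
Qed.

Lemma Ck_normalize k U f : open U -> (forall x, U x -> f x != 0) -> Ck k U f ->
  Ck k U (fun x => (enorm (f x))^-1 *: f x).
Proof. by move=> oU f0 Cf; apply: Ck_scalemx => //; exact: Ck_enormV. Qed.

End CkDot.

Section Ext.
Context {R : realType} {n : nat}.
Local Notation E := 'rV[R]_n.
Local Notation U0 := [set x : E | x != 0].
Implicit Types (u v w p x : E).

Lemma differentiable_normalize x : x != 0 ->
  differentiable (fun x : E => (enorm x)^-1 *: x) x.
Proof.
move=> x0; have [df _] : Ck 1 U0 (fun x : E => (enorm x)^-1 *: x).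
  by apply: Ck_normalize; [exact: open_neq0| |exact: Ck_id open_neq0].
exact: df.
Qed.

Lemma derive_entry (V : normedModType R) (p q : nat) (f : V -> 'M[R]_(p, q))
    (x v : V) i j : derivable f x v -> 'D_v (fun y => f y i j) x = ('D_v f x) i j.
Proof. by move=> df; rewrite derive_mx// mxE. Qed.

Lemma is_derive_mulmx (V : normedModType R) (p q r : nat)
    (f : V -> 'M[R]_(p, q)) (g : V -> 'M[R]_(q, r)) (x v : V) df dg :
  is_derive x v f df -> is_derive x v g dg ->
  is_derive x v (fun y => f y *m g y) (df *m g x + f x *m dg).
Proof.
move=> [Df <-] [Dg <-].
have De i j : is_derive x v (fun y => (f y *m g y) i j)
    (('D_v f x *m g x + f x *m 'D_v g x) i j).
  rewrite (_ : (fun y => _) = \sum_(l < q) ((fun y => f y i l) * (fun y => g y l j))).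
    rewrite !mxE -big_split/=.
    apply: is_derive_eq; first by apply: is_derive_sum => l; apply: is_deriveM;
      apply: derivableP; [exact: (derivable_mxP _ _ _).1|exact: (derivable_mxP _ _ _).1].
    apply: eq_bigr => l _; rewrite !derive_entry// /GRing.scale/= addrC.
    by congr (_ + _); rewrite mulrC.
  by apply/funext => y; rewrite mxE fct_sumE.
have Dv : derivable (fun y => f y *m g y) x v.
  by apply/derivable_mxP => i j; have [] := De i j.
apply: DeriveDef => //; rewrite derive_mx//; apply/matrixP => i j; rewrite mxE.
by have [_ ->] := De i j.
Qed.

Lemma is_derive_trmx (V : normedModType R) (p q : nat)
    (f : V -> 'M[R]_(p, q)) (x v : V) df :
  is_derive x v f df -> is_derive x v (fun y => (f y)^T) df^T.
Proof.
move=> [Df <-].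
have Dv : derivable (fun y => (f y)^T) x v.
  apply/derivable_mxP => i j; rewrite (_ : (fun y => _) = (fun y => f y j i)).
    exact: (derivable_mxP _ _ _).1.
  by apply/funext => y; rewrite mxE.
apply: DeriveDef => //; rewrite derive_mx//; apply/matrixP => i j; rewrite !mxE.
rewrite -derive_entry//; congr ('D_v _ x); apply/funext => y; rewrite mxE//.
Qed.

Lemma is_derive_entry (V : normedModType R) (p q : nat)
    (f : V -> 'M[R]_(p, q)) (x v : V) df i j :
  is_derive x v f df -> is_derive x v (fun y => f y i j) (df i j).
Proof.
move=> [Df <-]; apply: DeriveDef; first exact: (derivable_mxP _ _ _).1.
exact: derive_entry.
Qed.

Lemma is_derive_dot (V : normedModType R) (f g : V -> E) (x v : V) df dg :
  is_derive x v f df -> is_derive x v g dg ->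
  is_derive x v (fun y => dot (f y) (g y)) (dot df (g x) + dot (f x) dg).
Proof.
move=> Df Dg.
have := is_derive_entry 0 0 (is_derive_mulmx Df (is_derive_trmx Dg)).
by rewrite mxE.
Qed.

Lemma derive_normalize p v : sphere p ->
  'D_v (fun x : E => (enorm x)^-1 *: x) p = v - dot p v *: p.
Proof.
move=> Sp; have p0 := sphere_neq0 Sp.
pose a (x : E) := (enorm x)^-1.
have da : is_derive p v a ('D_v a p).
  apply: derivableP; apply: diff_derivable.
  have [da _] : Ck 1 U0 a.
    by apply: Ck_enormV => //; [exact: open_neq0|exact: Ck_id open_neq0].
  exact: da.
have did : is_derive p v (id : E -> E) v by apply: is_derive_id.
(* The derivative of 1 / |x| is found by differentiating the identity |x|^-2 <x, x> = 1. *)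
pose b : E -> R := (a * a) * (fun x => dot x x).
have b1 : {near p, (cst 1 : E -> R) =1 b}.
  have := open_nbhs_nbhs (conj (@open_neq0 R n) p0); apply: filterS => x /= x0.
  by rewrite /b /a !fctE -expr2 exprVn enorm_sqr mulVf// dot_eq0.
have [_] := is_deriveM (is_deriveM da da) (is_derive_dot did did).
rewrite -/b -(near_eq_derive _ b1) derive_cst /GRing.scale/= !fctE Sp (dotC v p).
rewrite /a enorm_sphere// invr1 => E0.
have {}E0 : 'D_v a p = - dot p v by move: ('D_v a p) E0 => z; lra.
pose L := fun x : E => a x *: x.
have Dj j : 'D_v (fun x : E => (a x *: x) 0 j) p = (v - dot p v *: p) 0 j.
  under [X in 'D_v X p]eq_fun do rewrite mxE.
  have [_] := is_deriveM da (is_derive_entry 0 j did).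
  rewrite -[X in 'D_v X p]/(fun x : E => a x * x 0 j) => ->.
  rewrite !mxE E0 /a enorm_sphere// invr1 /GRing.scale/=; ring.
rewrite derive_mx; last exact/diff_derivable/differentiable_normalize.
by apply/rowP => j; rewrite mxE Dj.
Qed.

(** The derivative of x / |x| at a point of the sphere is the orthogonal projection onto the tangent
    space, so only the tangential part of v acts. *)
Lemma derive_ext (W : normedModType R) (f : E -> W) p v : sphere p ->
  differentiable f p -> 'D_v (ext f) p = 'D_(v - dot p v *: p) f p.
Proof.
move=> Sp df; have p0 := sphere_neq0 Sp.
have dn := differentiable_normalize p0.
have np : (enorm p)^-1 *: p = p by rewrite enorm_sphere// invr1 scale1r.
have df' : differentiable f ((enorm p)^-1 *: p) by rewrite np.
rewrite deriveE; last exact: (@differentiable_comp _ _ _ _ _ f).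
rewrite (@diff_comp _ _ _ _ (fun x => (enorm x)^-1 *: x) f)//=.
by rewrite np -!deriveE// derive_normalize.
Qed.

Lemma derive_ext_proj (W : normedModType R) (f : E -> W) p v : sphere p ->
  differentiable (ext f) p -> 'D_v (ext f) p = 'D_(v - dot p v *: p) (ext f) p.
Proof.
move=> Sp df; rewrite -derive_ext//; apply: near_eq_derive.
have := open_nbhs_nbhs (conj (@open_neq0 R n) (sphere_neq0 Sp)).
by apply: filterS => x /= x0; rewrite ext_ext.
Qed.

Lemma smoothS_differentiable (W : normedModType R) (f : E -> W) x :
  smoothS f -> x != 0 -> differentiable (ext f) x.
Proof. by move=> /(_ 1)[df _]; exact: df. Qed.

End Ext.

(** * Iterated Lebesgue integrals *)

Section IntegralRV.
Context {R : realType}.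

(** Monotonicity taken from the definition as a supremum over simple functions, so that the inner
    integrals of [integral_rV] are compared as they stand, with no measurability to establish. *)
Lemma ge0_le_integralT d (T : measurableType d) (mu : {measure set T -> \bar R})
    (f g : T -> \bar R) : (forall x, 0 <= f x)%E -> (forall x, f x <= g x)%E ->
  (\int[mu]_x f x <= \int[mu]_x g x)%E.
Proof.
move=> f0 fg; have g0 x : (0 <= g x)%E by exact: le_trans (fg x).
rewrite !ge0_integralTE//; apply: ge_ereal_sup => _ [h hf <-].
by apply: ereal_sup_ubound; exists h => // x; exact: le_trans (fg x).
Qed.

Lemma integral_rV_ge0 k (f : 'rV[R]_k -> \bar R) :
  (forall x, 0 <= f x)%E -> (0 <= integral_rV f)%E.
Proof.
elim: k f => [|k IH] f f0 /=; first exact: f0.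
by apply: integral_ge0 => t _; exact: IH.
Qed.

Lemma le_integral_rV k (f g : 'rV[R]_k -> \bar R) :
  (forall x, 0 <= f x)%E -> (forall x, f x <= g x)%E ->
  (integral_rV f <= integral_rV g)%E.
Proof.
elim: k f g => [|k IH] f g f0 fg /=; first exact: fg.
by apply: ge0_le_integralT => t; [exact: integral_rV_ge0|exact: IH].
Qed.

Lemma integral_rV0 k : integral_rV (fun _ : 'rV[R]_k => 0%E) = 0%E.
Proof. by elim: k => //= k IH; under eq_integral do rewrite IH; rewrite integral0. Qed.

Definition unit_box k : set 'rV[R]_k := [set x | forall i, `|x 0 i| <= 1].
Arguments unit_box k : clear implicits.

Lemma unit_box_row_mx k t (x : 'rV[R]_k) :
  (row_mx (const_mx t : 'rV_1) x \in unit_box (1 + k)%N) =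
  (`|t| <= 1) && (x \in unit_box k).
Proof.
apply/idP/andP => [/set_mem H|[t1 /set_mem H]].
  split; first by have := H (lshift k 0); rewrite row_mxEl mxE.
  by apply/mem_set => i; have := H (rshift 1 i); rewrite row_mxEr.
apply/mem_set => i; rewrite mxE; case: splitP => j _; first by rewrite mxE.
exact: H.
Qed.

Lemma integral_rV_box k (c : R) : 0 <= c ->
  integral_rV (fun x : 'rV[R]_k => (c * (x \in unit_box k)%:R)%:E) =
  (c * 2 ^+ k)%:E.
Proof.
move=> c0; elim: k => [|k IH] /=.
  by rewrite mem_set ?expr0// => -[].
transitivity (\int[@lebesgue_measure R]_t ((c * 2 ^+ k)%:E * (\1_(`[-1, 1]%classic) t)%:E))%E.
  apply: eq_integral => t _; rewrite indicE.
  have [tI|tI] := boolP (t \in `[-1, 1]%classic).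
    rewrite mule1 -IH; congr integral_rV; apply/funext => x.
    rewrite unit_box_row_mx; move: tI; rewrite inE/= in_itv/= => tI.
    by rewrite ler_norml tI.
  rewrite mule0 -(integral_rV0 k); congr integral_rV; apply/funext => x.
  rewrite unit_box_row_mx; move: tI; rewrite notin_setE/= in_itv/= => /negP tI.
  by rewrite ler_norml (negbTE tI) mulr0.
rewrite ge0_integralZl//; last 2 first.
- by apply/measurable_EFinP; apply: measurable_indic.
- by rewrite lee_fin mulr_ge0// exprn_ge0.
rewrite integral_indic// setIT.
have vol : lebesgue_measure (`[-1, 1]%classic : set R) = (1 - (-1) : R)%:E.
  by rewrite lebesgue_measure_itv/= lte_fin ifT ?EFinB// (lt_trans (ltrN10 _)).
rewrite [X in (_ * X)%E]vol.
by rewrite -EFinM opprK exprSr mulrA; congr (_ * _)%:E; ring.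
Qed.

End IntegralRV.
Arguments unit_box : clear implicits.

(** Sylvester's determinant identity, from the two orders of multiplication of the same block
    factors. It moves determinants in a tangent basis to matrices of the ambient size. *)
Lemma det_1DmulC (R : comNzRingType) (k n : nat) (A : 'M[R]_(k, n)) (C : 'M[R]_(n, k)) :
  \det (1%:M + A *m C) = \det (1%:M + C *m A).
Proof.
have e1 : block_mx 1%:M A (- C) 1%:M *m block_mx 1%:M 0 C 1%:M =
    block_mx (1%:M + A *m C) A 0 1%:M.
  by rewrite mulmx_block !mulmx1 !mul1mx !mulmx0 !add0r addNr.
have e2 : block_mx 1%:M 0 C 1%:M *m block_mx 1%:M A (- C) 1%:M =
    block_mx 1%:M A 0 (1%:M + C *m A).
  by rewrite mulmx_block !mulmx1 !mul1mx !mul0mx !addr0 subrr [C *m A + _]addrC.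
move/(congr1 determinant): e1; move/(congr1 determinant): e2.
by rewrite !det_mulmx !det_ublock !det1 !mulr1 !mul1r mulrC => <- ->.
Qed.

(** * Complex structure and tangent endomorphisms as ambient matrices *)

Section ComplexStructure.
Context {R : realType} {m : nat}.
Local Notation n := (m.+1 + m.+1)%N.
Local Notation E := 'rV[R]_n.
Implicit Types (u v w p x : E).

Definition Jmx : 'M[R]_n := block_mx 0 1%:M (- 1%:M) 0.

Lemma JcE u : Jc u = u *m Jmx.
Proof.
rewrite -{2}[u]hsubmxK /Jmx mul_row_block !mulmx0 mulmxN !mulmx1 add0r addr0.
by [].
Qed.

Lemma tr_Jmx : Jmx^T = - Jmx.
Proof.
by rewrite /Jmx tr_block_mx opp_block_mx linearN/= !trmx1 !trmx0 opprK oppr0.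
Qed.

Lemma Jmx_sqr : Jmx *m Jmx = - 1%:M.
Proof.
rewrite /Jmx mulmx_block !mul0mx !mulmx0 mulmxN mulmx1 mulNmx mul1mx.
by rewrite !add0r !addr0 [in RHS]scalar_mx_block opp_block_mx oppr0.
Qed.

Lemma JcD u v : Jc (u + v) = Jc u + Jc v.
Proof. by rewrite !JcE mulmxDl. Qed.

Lemma JcZ a u : Jc (a *: u) = a *: Jc u.
Proof. by rewrite !JcE scalemxAl. Qed.

Lemma JcN u : Jc (- u) = - Jc u.
Proof. by rewrite !JcE mulNmx. Qed.

Lemma JcB u v : Jc (u - v) = Jc u - Jc v.
Proof. by rewrite JcD JcN. Qed.

Lemma JcJ u : Jc (Jc u) = - u.
Proof. by rewrite !JcE -mulmxA Jmx_sqr mulmxN mulmx1. Qed.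

Lemma dot_Jcl u v : dot (Jc u) v = - dot u (Jc v).
Proof. by rewrite !JcE dot_mulmxl tr_Jmx mulmxN dotNr. Qed.

Lemma dot_JcJ u v : dot (Jc u) (Jc v) = dot u v.
Proof. by rewrite dot_Jcl JcJ dotNr opprK. Qed.

Lemma dot_Jc_self u : dot u (Jc u) = 0.
Proof.
by have := dot_Jcl u u; rewrite dotC => H; apply/eqP; rewrite -[_ == _]orbb -mulf_eq0; apply/eqP; nra.
Qed.

Lemma sphere_hopf p : sphere p -> dot (hopf p) (hopf p) = 1.
Proof. by rewrite /hopf dot_JcJ. Qed.

Lemma tangent_hopf p : tangent p (hopf p).
Proof. exact: dot_Jc_self. Qed.

Lemma bergerE mu p Y Z : sphere p ->
  berger mu p Y Z = dot Y Z + (mu - 1) * (dot Y (hopf p) * dot Z (hopf p)).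
Proof.
move=> Sp; rewrite /berger /horizontal dotBl !dotBr !dotZl !dotZr sphere_hopf//.
by rewrite (dotC (hopf p) Z); ring.
Qed.

(** Matrices act on row vectors from the right: this is the rank-one endomorphism x |-> <x, u> v. *)
Definition outer u v : 'M[R]_n := u^T *m v.

Definition berger_mx mu p : 'M[R]_n := 1%:M + (mu - 1) *: outer (hopf p) (hopf p).

Lemma mulmx_outer u v w : u *m outer v w = dot u v *: w.
Proof. by rewrite mulmxA [u *m _]mx11_scalar mul_scalar_mx. Qed.

Lemma outer_mulmx u v (M : 'M[R]_n) : outer u v *m M = outer u (v *m M).
Proof. by rewrite /outer mulmxA. Qed.

Lemma tr_outer u v : (outer u v)^T = outer v u.
Proof. by rewrite /outer trmx_mul trmxK. Qed.

Lemma outer_outer u v w x : outer u v *m outer w x = dot v w *: outer u x.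
Proof. by rewrite outer_mulmx mulmx_outer /outer scalemxAr. Qed.

Lemma outer_trmx u v w : outer u v *m w^T = dot v w *: u^T.
Proof. by rewrite /outer -mulmxA [v *m _]mx11_scalar mul_mx_scalar. Qed.

Lemma berger_mxE mu p Y Z : sphere p ->
  berger mu p Y Z = dot (Y *m berger_mx mu p) Z.
Proof.
move=> Sp; rewrite bergerE// /berger_mx mulmxDr mulmx1 -scalemxAr mulmx_outer.
by rewrite dotDl !dotZl (dotC (hopf p) Z).
Qed.

Lemma tr_berger_mx mu p : (berger_mx mu p)^T = berger_mx mu p.
Proof. by rewrite /berger_mx linearD/= linearZ/= trmx1 tr_outer. Qed.

Lemma gram_mxE (k : nat) (h : E -> E -> R) (H : 'M[R]_n) (B : 'M[R]_(k, n)) :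
  (forall i j, h (row i B) (row j B) = dot (row i B *m H) (row j B)) ->
  gram h B = B *m H *m B^T.
Proof.
move=> hE; apply/matrixP => i j; rewrite mxE hE -row_mul dotE [RHS]mxE.
by apply: eq_bigr => l _; rewrite !mxE.
Qed.

(** Inverse of the Berger form on the tangent space (1 on horizontal vectors, 1 / l on V), extended
    by zero to the normal line. *)
Definition inv_berger l p : 'M[R]_n :=
  1%:M - outer p p + (l^-1 - 1) *: outer (hopf p) (hopf p).

Lemma tr_inv_berger l p : (inv_berger l p)^T = inv_berger l p.
Proof. by rewrite /inv_berger !linearD/= linearN/= linearZ/= trmx1 !tr_outer. Qed.

Lemma berger_mx_inv l p : sphere p -> l != 0 ->
  berger_mx l p *m inv_berger l p = 1%:M - outer p p.
Proof.
move=> Sp l0; rewrite /berger_mx /inv_berger mulmxDl mul1mx -scalemxAl.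
rewrite !mulmxDr mulmx1 mulmxN -scalemxAr !outer_outer sphere_hopf// scale1r.
rewrite (dotC (hopf p)) tangent_hopf scale0r subr0 scalerDr scalerA -!addrA.
rewrite -!scalerDl; congr (_ + _).
suff -> : l^-1 - 1 + (l - 1 + (l - 1) * (l^-1 - 1)) = 0 by rewrite scale0r addr0.
by field.
Qed.

Section Gram.
Variables (k : nat) (B : 'M[R]_(k, n)) (p : E).
Hypotheses (Sp : sphere p) (Bp : B *m p^T = 0) (Bfree : row_free B).
Hypothesis Bfull : (kermx p^T <= B)%MS.

(** The rows of [inv_berger l p] are tangent, hence it is M *m B for some M; multiplying by the Gram
    matrix identifies M. The product in the conclusion is thereby independent of the basis B, and
    smooth in p although [tbasis p] need not be. *)
Lemma gram_berger_inv l : l != 0 ->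
  B *m berger_mx l p *m B^T \in unitmx /\
  B^T *m invmx (B *m berger_mx l p *m B^T) *m B = inv_berger l p.
Proof.
move=> l0; have /submxP[M QM] : (inv_berger l p <= B)%MS.
  apply: submx_trans Bfull; apply/sub_kermxP.
  rewrite /inv_berger !mulmxDl mul1mx mulNmx -scalemxAl !outer_trmx Sp scale1r.
  by rewrite subrr add0r (dotC (hopf p)) tangent_hopf scale0r scaler0.
have BQ : B *m berger_mx l p *m B^T *m M^T = B.
  rewrite -mulmxA -trmx_mul -QM tr_inv_berger -mulmxA berger_mx_inv//.
  by rewrite mulmxBr mulmx1 /outer mulmxA Bp mul0mx subr0.
have /row_freeP[B' BB'] := Bfree.
have U : B *m berger_mx l p *m B^T \in unitmx.
  have : B *m berger_mx l p *m B^T *m (M^T *m B') = 1%:M by rewrite mulmxA BQ.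
  by move/mulmx1_unit => [].
split=> //; rewrite -mulmxA -[X in invmx _ *m X]BQ mulKmx// -trmx_mul -QM.
exact: tr_inv_berger.
Qed.

Lemma trace_gram_berger l (H : 'M[R]_n) : l != 0 ->
  \tr (B *m H *m B^T *m invmx (B *m berger_mx l p *m B^T)) =
  \tr (H *m inv_berger l p).
Proof.
move=> l0; have [_ QE] := gram_berger_inv l0.
by rewrite -QE -!mulmxA mxtrace_mulC !mulmxA.
Qed.

Lemma det_gram_berger l (W : 'M[R]_n) : l != 0 ->
  \det (B *m (berger_mx l p + W) *m B^T *m invmx (B *m berger_mx l p *m B^T)) =
  \det (1%:M + W *m inv_berger l p).
Proof.
move=> l0; have [U QE] := gram_berger_inv l0.
rewrite mulmxDr !mulmxDl mulmxV// -mulmxA -[B *m W *m _]mulmxA det_1DmulC.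
by congr (\det (_ + _)); rewrite -QE !mulmxA.
Qed.

End Gram.

Lemma tbasis_tangent p : tbasis p *m p^T = 0.
Proof. by apply/sub_kermxP; rewrite eq_row_base. Qed.

Lemma tbasis_full p : (kermx p^T <= tbasis p)%MS.
Proof. by rewrite eq_row_base. Qed.

Lemma tbasis_free p : row_free (tbasis p).
Proof. exact: row_base_free. Qed.

Lemma row_tbasis_tangent p i : tangent p (row i (tbasis p)).
Proof.
by rewrite /tangent dotC /dot -row_mul tbasis_tangent !mxE.
Qed.

Lemma gram_bergerE (k : nat) mu p (B : 'M[R]_(k, n)) : sphere p ->
  gram (berger mu p) B = B *m berger_mx mu p *m B^T.
Proof. by move=> Sp; apply: gram_mxE => i j; rewrite berger_mxE. Qed.

Lemma trace_endo l p h (H : 'M[R]_n) : sphere p -> l != 0 ->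
  (forall Y Z, tangent p Y -> tangent p Z -> h Y Z = dot (Y *m H) Z) ->
  \tr (endo_mx (berger l p) h p) = \tr (H *m inv_berger l p).
Proof.
move=> Sp l0 hH; rewrite /endo_mx (gram_mxE (H := H)) => [|i j]; last first.
  by apply: hH; exact: row_tbasis_tangent.
rewrite gram_bergerE// trace_gram_berger//.
- exact: tbasis_tangent.
- exact: tbasis_free.
- exact: tbasis_full.
Qed.

Lemma det_endo l p h (W : 'M[R]_n) : sphere p -> l != 0 ->
  (forall Y Z, tangent p Y -> tangent p Z ->
     h Y Z = dot (Y *m (berger_mx l p + W)) Z) ->
  \det (endo_mx (berger l p) h p) = \det (1%:M + W *m inv_berger l p).
Proof.
move=> Sp l0 hH; rewrite /endo_mx (gram_mxE (H := berger_mx l p + W)); last first.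
  by move=> i j; apply: hH; exact: row_tbasis_tangent.
rewrite gram_bergerE// det_gram_berger//.
- exact: tbasis_tangent.
- exact: tbasis_free.
- exact: tbasis_full.
Qed.

End ComplexStructure.
Arguments Jmx {R} m.

(** * Charts by radial projection of affine hyperplanes *)

Section Charts.
Context {R : realType} {k : nat}.
Local Notation E := 'rV[R]_k.+1.
Implicit Types (O : 'M[R]_k.+1) (x : 'rV[R]_k) (p : E).

Definition affine_chart x : E := row_mx (1%:M : 'M[R]_1) x.

(** O is any invertible matrix: the same charts serve for the signed transpositions, whose faces
    cover the sphere, and for their products with unitary matrices, which occur in the invariance of
    the volume. *)
Definition chart O x : E := (enorm (affine_chart x *m O))^-1 *: (affine_chart x *m O).

Lemma affine_chartE x : affine_chart x =
  row_mx (1%:M : 'M[R]_1) 0 + x *m (row_mx 0 1%:M : 'M[R]_(k, 1 + k)).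
Proof. by rewrite mul_mx_row mulmx0 mulmx1 add_row_mx addr0 add0r. Qed.

Lemma row_mx_1E (b : R) (x : 'rV[R]_k) :
  (row_mx (b%:M : 'M[R]_1) x : E) 0 0 = b /\
  forall j, (row_mx (b%:M : 'M[R]_1) x : E) 0 (lift 0 j) = x 0 j.
Proof.
split=> [|j].
  transitivity ((row_mx (b%:M : 'M[R]_1) x) 0 (lshift k 0)).
    by congr (_ _ _); exact/val_inj.
  by rewrite row_mxEl mxE.
transitivity ((row_mx (b%:M : 'M[R]_1) x) 0 (rshift 1 j)).
  by congr (_ _ _); exact/val_inj.
by rewrite row_mxEr.
Qed.

Lemma affine_chart0 x : affine_chart x 0 0 = 1.
Proof. exact: (row_mx_1E 1 x).1. Qed.

Lemma affine_chart_lift x j : affine_chart x 0 (lift 0 j) = x 0 j.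
Proof. exact: (row_mx_1E 1 x).2. Qed.

Lemma Ck_affine_chart d : Ck d setT affine_chart.
Proof.
apply: (@eq_Ck _ _ _ _ _ (fun x => row_mx (1%:M : 'M[R]_1) 0 +
    x *m (row_mx 0 1%:M : 'M[R]_(k, 1 + k)))); first exact: openT.
  by move=> x _; rewrite affine_chartE.
apply: Ck_add; [exact: openT|exact: Ck_cst openT|].
by apply: Ck_mulmx; [exact: openT|exact: Ck_id openT|exact: Ck_cst openT].
Qed.

Section Unit.
Variable O : 'M[R]_k.+1.
Hypothesis uO : O \in unitmx.

Lemma affine_chart_neq0 x : affine_chart x *m O != 0.
Proof.
apply/eqP => /(congr1 (mulmx^~ (invmx O))); rewrite mulmxK// mul0mx.
by move/(congr1 (fun A : E => A 0 0)); rewrite affine_chart0 mxE => /eqP; rewrite oner_eq0.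
Qed.

Lemma Ck_chart d : Ck d setT (chart O).
Proof.
apply: Ck_normalize; [exact: openT|by move=> x _; exact: affine_chart_neq0|].
by apply: Ck_mulmx; [exact: openT|exact: Ck_affine_chart|exact: Ck_cst openT].
Qed.

Lemma chart_sphere x : sphere (chart O x).
Proof. exact/sphere_normalize/affine_chart_neq0. Qed.

Lemma affine_chartZ_inj a b x y : a *: affine_chart x = b *: affine_chart y ->
  a != 0 -> a = b /\ x = y.
Proof.
move=> e a0.
have ab : a = b.
  move/(congr1 (fun A : E => A 0 0)) : (e).
  by rewrite [LHS]mxE [RHS]mxE !affine_chart0 !mulr1.
split=> //; apply/rowP => j; move/(congr1 (fun A : E => A 0 (lift 0 j))) : e.
by rewrite -ab [LHS]mxE [RHS]mxE !affine_chart_lift => /(mulfI a0).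
Qed.

Lemma derive_chart x u : 'D_u (chart O) x = u *m 'J (chart O) x.
Proof.
apply: deriveEjacobian; have [df _] := Ck_chart 1; exact: df.
Qed.

Lemma tangent_chart x u : tangent (chart O x) (u *m 'J (chart O) x).
Proof.
rewrite /tangent -derive_chart.
have dc : is_derive x u (chart O) ('D_u (chart O) x).
  by apply: derivableP; apply: diff_derivable; have [df _] := Ck_chart 1; exact: df.
have [_] := is_derive_dot dc dc.
rewrite (_ : (fun y => _) = cst 1); last by apply/funext => y; exact: chart_sphere.
by rewrite derive_cst (dotC _ (chart O x)) => H; lra.
Qed.

(** If u is killed by the derivative then, after removing O, a' (1, x) + a (0, u) = 0, where a is
    the normalizing factor and a' its derivative along u. The first coordinate gives a' = 0 and the
    others give u = 0. *)
Lemma chart_immersion x : row_free ('J (chart O) x).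
Proof.
apply: inj_row_free => u; rewrite -derive_chart => Du0.
pose a y := (enorm (affine_chart y *m O))^-1.
have da : is_derive x u a ('D_u a x).
  apply: derivableP; apply: diff_derivable.
  have [df _] : Ck 1 setT a; last exact: df.
  apply: Ck_enormV; [exact: openT|by move=> y _; exact: affine_chart_neq0|].
  by apply: Ck_mulmx; [exact: openT|exact: Ck_affine_chart|exact: Ck_cst openT].
pose L : 'M[R]_(k, k.+1) := (row_mx 0 1%:M : 'M[R]_(k, 1 + k)).
have daff : is_derive x u affine_chart (u *m L).
  rewrite (_ : affine_chart = (fun=> row_mx (1%:M : 'M[R]_1) 0) + (fun x => x *m L)).
    have h1 : is_derive x u (fun y => y *m L) (u *m L).
      have := is_derive_mulmx (is_derive_id x u) (is_derive_cst L x u).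
      by rewrite mulmx0 addr0.
    by rewrite -[u *m L]add0r; apply: is_deriveD h1.
  by apply/funext => y; rewrite affine_chartE.
have dco : is_derive x u (chart O) (('D_u a x) *: (affine_chart x *m O) + a x *: (u *m L *m O)).
  apply: DeriveDef.
    by apply: diff_derivable; have [df _] := Ck_chart 1; exact: df.
  have h1 := is_derive_mulmx daff (is_derive_cst O x u).
  rewrite derive_mx; last first.
    by apply: diff_derivable; have [df _] := Ck_chart 1; exact: df.
  apply/rowP => j; rewrite mxE.
  have [_] := is_deriveM da (is_derive_entry 0 j h1).
  rewrite (_ : (fun t => chart O t 0 j) = (a * (fun y => (affine_chart y *m O) 0 j))).
    by move=> ->; rewrite mulmx0 addr0 !mxE /GRing.scale/= addrC; congr (_ + _); rewrite mulrC.
  by apply/funext => y; rewrite /chart mxE.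
have [_] := dco; rewrite Du0 scalemxAl [X in _ + X]scalemxAl -mulmxDl => /esym H.
have {}H : ('D_u a x) *: affine_chart x + a x *: (u *m L) = 0.
  by move/(congr1 (mulmx^~ (invmx O))) : H; rewrite mulmxK// mul0mx.
have uL : u *m L = row_mx (0%:M : 'M[R]_1) u.
  apply: (etrans (mul_mx_row u (0 : 'M[R]_(k, 1)) 1%:M)).
  by rewrite mulmx0 mulmx1 raddf0.
have [L0 Lj] := row_mx_1E 0 u; rewrite -uL in L0 Lj.
have D0 : 'D_u a x = 0.
  move/(congr1 (fun A : E => A 0 0)) : (H).
  rewrite [LHS]mxE [X in X + _]mxE [X in _ + X]mxE [RHS]mxE affine_chart0 L0.
  by rewrite mulr0 addr0 mulr1.
have a0 : a x != 0 by rewrite invr_eq0 gt_eqF// enorm_gt0 affine_chart_neq0.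
apply/rowP => j; rewrite mxE -Lj.
move/(congr1 (fun A : E => A 0 (lift 0 j))) : (H).
by rewrite D0 scale0r add0r mxE [RHS]mxE => /eqP; rewrite mulf_eq0 (negbTE a0) => /eqP.
Qed.

Lemma chart_inj x y : chart O x = chart O y -> x = y.
Proof.
rewrite /chart !scalemxAl => /(congr1 (mulmx^~ (invmx O))); rewrite !mulmxK// => H.
have [|//] := affine_chartZ_inj H.
by rewrite invr_eq0 gt_eqF// enorm_gt0 affine_chart_neq0.
Qed.

Lemma chart_parametrization : @parametrization R k.+1 setT (chart O).
Proof.
split; first exact: openT.
- by move=> d; exact: Ck_chart.
- by move=> x _; exact: chart_sphere.
- by move=> x y _ _; exact: chart_inj.
- by move=> x _; exact: chart_immersion.
Qed.

(** The part of the sphere seen in the chart as the cube [-1, 1]^k: the first coordinate, once O is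
    undone, dominates all others in absolute value. On this compact piece the volume density is
    bounded above and below. *)
Definition face : set E :=
  [set p | sphere p /\ forall j, `|(p *m invmx O) 0 j| <= (p *m invmx O) 0 0].

Lemma chart_face x : face (chart O x) <-> unit_box R k x.
Proof.
rewrite /face/= /chart scalemxAl mulmxK//; set c := _^-1.
have c0 : 0 < c by rewrite invr_gt0 enorm_gt0 affine_chart_neq0.
have sE j : (c *: affine_chart x) 0 j = c * affine_chart x 0 j by rewrite [LHS]mxE.
split=> [[_ H] i|H].
  have := H (lift 0 i); rewrite !sE affine_chart_lift affine_chart0 mulr1.
  by rewrite normrM (gtr0_norm c0) ger_pMr.
split; first by rewrite -scalemxAl; exact: chart_sphere.
move=> j; rewrite !sE affine_chart0 mulr1 normrM (gtr0_norm c0) ger_pMr//.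
have [i ->|->] := unliftP 0 j; first by rewrite affine_chart_lift.
by rewrite affine_chart0 normr1.
Qed.

Lemma face_sub_chart : face `<=` range (chart O).
Proof.
move=> p [Sp H]; set q := p *m invmx O in H.
have pq : p = q *m O by rewrite mulmxKV.
have q0 : 0 < q 0 0.
  rewrite lt_neqAle (le_trans _ (H 0))// andbT eq_sym; apply/eqP => q00.
  have : p = 0.
    rewrite pq (_ : q = 0) ?mul0mx//; apply/rowP => j; rewrite [RHS]mxE.
    by apply/eqP; rewrite -normr_le0 -q00.
  by move/eqP; rewrite (negbTE (sphere_neq0 Sp)).
pose x : 'rV[R]_k := \row_j ((q 0 0)^-1 * q 0 (lift 0 j)).
have xE : affine_chart x = (q 0 0)^-1 *: q.
  apply/rowP => j; rewrite [RHS]mxE; have [i ->|->] := unliftP 0 j.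
    by rewrite affine_chart_lift [LHS]mxE.
  by rewrite affine_chart0 mulVf ?gt_eqF.
exists x => //; rewrite /chart xE -scalemxAl -pq enormZ ?invr_ge0 ?ltW//.
by rewrite enorm_sphere// mulr1 invrK scalerA divff ?scale1r ?gt_eqF.
Qed.

Lemma closed_Ck_le0 (f : E -> R) : Ck 0 setT f -> closed [set p | f p <= 0].
Proof.
move=> Cf; apply: (@preimage_closed _ _ f [set x | x <= 0]); last exact: closed_le.
by move=> p _; exact: (Cf p I).
Qed.

Lemma closed_face : closed face.
Proof.
pose f j p := (p *m invmx O) 0 j.
have -> : face = ([set p | dot p p - 1 <= 0] `&` [set p | 1 - dot p p <= 0]) `&`
    \bigcap_(j in [set: 'I_k.+1])
      ([set p | f j p - f 0 p <= 0] `&` [set p | - f j p - f 0 p <= 0]).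
  apply/seteqP; split=> p.
    move=> [Sp H]; split; first by rewrite /= Sp subrr.
    move=> j _; have := H j; rewrite ler_norml => /andP[H1 H2].
    by split; rewrite /= /f; move: (_ 0 j) (_ 0 0) H1 H2 => a b H1 H2; lra.
  move=> [[/= H1 H2] H]; split; first by rewrite /sphere/=; lra.
  move=> j; have [/= H3 H4] := H j I; rewrite ler_norml.
  move: H3 H4; rewrite /f; move: (_ 0 j) (_ 0 0) => a b H3 H4.
  by apply/andP; split; lra.
have Cd : Ck 0 setT (fun p : E => dot p p).
  by apply: Ck_dot; [exact: openT|exact: Ck_id openT|exact: Ck_id openT].
have C1 : Ck 0 setT (fun p : E => 1 : R) by exact: Ck_cst openT.
have Cfj j : Ck 0 setT (f j).
  apply: Ck_entry; first exact: openT.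
  by apply: Ck_mulmx; [exact: openT|exact: Ck_id openT|exact: Ck_cst openT].
have oT : open [set: E] by exact: openT.
apply: closedI; first by apply: closedI; apply: closed_Ck_le0; exact: Ck_sub.
apply: closed_bigI => j _; apply: closedI; apply: closed_Ck_le0; apply: Ck_sub => //.
exact: Ck_opp.
Qed.

End Unit.

(** A transposition with a sign; the faces of these matrices are the radial projections of the
    facets of the cube [-1, 1]^(k+1). *)
Definition flip (i : 'I_k.+1) (s : bool) : 'M[R]_k.+1 := (-1) ^+ s *: tperm_mx 0 i.

Lemma flip_flip i s : flip i s *m flip i s = 1%:M.
Proof.
rewrite /flip -scalemxAl -scalemxAr scalerA -expr2 sqrr_sign scale1r.
by rewrite /tperm_mx -perm_mxM tperm2 perm_mx1.
Qed.

Lemma unitmx_flip i s : flip i s \in unitmx.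
Proof. by have [] := mulmx1_unit (flip_flip i s). Qed.

(** A coordinate of largest absolute value, together with its sign, designates the facet of the cube
    met by the ray through p. *)
Lemma flip_cover : sphere `<=` \bigcup_(b in [set: 'I_k.+1 * bool]) face (flip b.1 b.2).
Proof.
move=> p Sp; have [i _ imax] := @arg_maxP _ _ _ (0 : 'I_k.+1) xpredT (fun i => `|p 0 i|) isT.
exists (i, p 0 i < 0) => //; split=> // j /=; set s := p 0 i < 0.
have invE : invmx (flip i s) = flip i s.
  by rewrite -[RHS]mul1mx -(mulVmx (unitmx_flip i s)) -mulmxA flip_flip mulmx1.
have pE l : (p *m invmx (flip i s)) 0 l = (-1) ^+ s * p 0 (tperm 0 i l).
  rewrite invE /flip -scalemxAr [LHS]mxE; congr (_ * _).
  by rewrite /tperm_mx -[in LHS]tpermV -col_permE mxE.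
rewrite !pE tpermL normrM normr_sign mul1r.
suff -> : (-1) ^+ s * p 0 i = `|p 0 i| by exact: imax.
rewrite /s; have [H|H] := ltP (p 0 i) 0; first by rewrite expr1 mulN1r ltr0_norm.
by rewrite expr0 mul1r ger0_norm.
Qed.

End Charts.

(** * Borel sets and continuous functions on the sphere *)

Section BorelSphere.
Context {R : realType} {n : nat}.
Local Notation E := 'rV[R]_n.
Local Notation S := (sphere : set (borel R n)).

Lemma borel_open (A : set E) : open A -> measurable (A : set (borel R n)).
Proof. by move=> oA; exact: sub_sigma_algebra. Qed.

Lemma borel_closed (A : set E) : closed A -> measurable (A : set (borel R n)).
Proof.
move=> cA; rewrite -[A]setCK; apply: measurableC; apply: borel_open.
exact: closed_openC.
Qed.

Lemma closed_sphere : closed (sphere : set E).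
Proof.
apply: (@preimage_closed _ _ (fun p : E => dot p p) [set x | x = 1]);
  last exact: closed_eq.
move=> p _; have C : Ck 0 setT (fun p : E => dot p p).
  by apply: Ck_dot; [exact: openT|exact: Ck_id openT|exact: Ck_id openT].
exact: (C p I).
Qed.

Lemma compact_sphere : compact (sphere : set E).
Proof.
apply: bounded_closed_compact; last exact: closed_sphere.
exists 1; split; first exact: num_real.
move=> x x1 p Sp; rewrite /= (le_trans _ (ltW x1))//.
rewrite /Num.norm/= mx_normrE bigmax_le// => -[i j] _ /=; rewrite ord1.
rewrite -(@ler_pXn2r _ 2)// ?nnegrE// expr1n real_normK ?num_real//.
by rewrite -Sp dotE (bigD1 j)//= -expr2 lerDl sumr_ge0// => l _; rewrite -expr2 sqr_ge0.
Qed.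

Lemma borel_sphere : measurable S.
Proof. exact: borel_closed closed_sphere. Qed.

(** Continuity is given at the points of the sphere only, so the preimage of an interval is replaced
    by its interior, which has the same trace on the sphere. *)
Lemma measurable_sphere (f : E -> R) :
  (forall p, sphere p -> {for p, continuous f}) -> measurable_fun S f.
Proof.
move=> cf; apply: (measurability _ (RGenOpens.measurableE R)).
move=> _ [_ [a [b ->] <-]].
have -> : S `&` f @^-1` `]a, b[%classic =
    S `&` interior (f @^-1` `]a, b[%classic).
  apply/seteqP; split=> p [Sp fp]; split=> //; last exact: interior_subset.
  apply: cf => //; apply: open_nbhs_nbhs; split=> //.
apply: measurableI; first exact: borel_sphere.
by apply: borel_open; exact: open_interior.
Qed.

Lemma bounded_sphere (f : E -> R) :
  (forall p, sphere p -> {for p, continuous f}) -> exists2 M, 0 <= M &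
  forall p, sphere p -> `|f p| <= M.
Proof.
move=> cf; have [[p0 Sp0]|S0] := pselect (exists p : E, sphere p); last first.
  by exists 0 => // p Sp; case: S0; exists p.
have cnf : {within sphere, continuous (fun p => `|f p|)}.
  apply: continuous_in_subspaceT => p /set_mem Sp.
  by apply: (@continuous_comp _ _ _ f Num.norm); [exact: cf|exact: norm_continuous].
have [c /set_mem Sc fc] := compact_EVT_max (ex_intro _ p0 Sp0) compact_sphere cnf.
by exists `|f c| => // p Sp; apply: fc; exact: mem_set.
Qed.

Variable nu : {measure set (borel R n) -> \bar R}.
Hypothesis nuS : (nu sphere < +oo)%E.

Lemma integrable_sphere (f : E -> R) :
  (forall p, sphere p -> {for p, continuous f}) -> nu.-integrable S (EFin \o f).
Proof.
move=> cf; apply: measurable_bounded_integrable => //.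
- exact: borel_sphere.
- exact: measurable_sphere.
- have [M M0 fM] := bounded_sphere cf; exists M; split; first exact: num_real.
  by move=> x Mx p Sp; rewrite /= (le_trans (fM p Sp))// ltW.
Qed.

End BorelSphere.

(** * Volume measure: positivity, finiteness, unitary invariance *)

Section BergerVolume.
Context {R : realType} {m : nat}.
Local Notation n := (m.+1 + m.+1)%N.
Local Notation k := (m + m.+1)%N.
Local Notation E := 'rV[R]_n.
Local Notation S := (sphere : set (borel R n)).
Implicit Types (O T : 'M[R]_n) (p : E).

Lemma sphere_full (B : 'M[R]_(k, n)) p : sphere p -> B *m p^T = 0 ->
  row_free B -> (kermx p^T <= B)%MS.
Proof.
move=> Sp Bp /eqP rB; have BK : (B <= kermx p^T)%MS by exact/sub_kermxP.
rewrite -(mxrank_leqif_sup BK) rB mxrank_ker mxrank_tr rank_rV sphere_neq0//.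
by rewrite subn1.
Qed.

Section Charts.
Variables (mu : R) (mu0 : mu != 0) (O : 'M[R]_n) (uO : O \in unitmx).

Local Notation phi := (chart (k := k) O).

Definition chart_density (x : 'rV[R]_k) : R :=
  Num.sqrt `|\det (gram (berger mu (phi x)) ('J phi x))|.

Lemma jacobian_tangent x : 'J phi x *m (phi x)^T = 0.
Proof.
apply/row_matrixP => i; rewrite row_mul row0 rowE [LHS]mx11_scalar.
have := tangent_chart uO x (delta_mx 0 i); rewrite /tangent dotC /dot => ->.
exact: raddf0.
Qed.

Lemma det_chart_neq0 x : \det (gram (berger mu (phi x)) ('J phi x)) != 0.
Proof.
have Sp := chart_sphere uO x; rewrite gram_bergerE// -unitfE -unitmxE.
apply: (gram_berger_inv Sp _ _ _ mu0).1.
- exact: jacobian_tangent.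
- exact: chart_immersion.
- apply: sphere_full => //; first exact: jacobian_tangent.
  exact: chart_immersion.
Qed.

Lemma chart_density_gt0 x : 0 < chart_density x.
Proof. by rewrite /chart_density sqrtr_gt0 normr_gt0 det_chart_neq0. Qed.

Lemma Ck_jacobian d : Ck d setT (fun x => 'J phi x).
Proof.
have oT : open [set: 'rV[R]_k] by exact: openT.
apply: Ck_mx => // i j.
apply: (@eq_Ck _ _ _ _ _ (fun x => ('D_(delta_mx 0 i) phi x) 0 j)) => //.
  by move=> x _; rewrite derive_chart// -rowE mxE.
by apply: Ck_entry => //; apply: Ck_derive; exact: Ck_chart.
Qed.

Lemma continuous_chart_density : continuous chart_density.
Proof.
have oT : open [set: 'rV[R]_k] by exact: openT.
pose d x := \det (gram (berger mu (phi x)) ('J phi x)).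
have Cphi : Ck 0 setT phi by exact: Ck_chart.
have Cv : Ck 0 setT (fun x => phi x *m Jmx m).
  by apply: (Ck_mulmx oT); [exact: Cphi|exact: Ck_cst].
have Cd : Ck 0 setT d.
  apply: (@eq_Ck _ _ _ _ _ (fun x => \det ('J phi x *m berger_mx mu (phi x) *m ('J phi x)^T)) _ oT).
    by move=> x _; rewrite /d gram_bergerE//; exact: chart_sphere.
  have CJ : Ck 0 setT (fun x => 'J phi x) by exact: Ck_jacobian.
  apply: (Ck_det oT); apply: (Ck_mulmx oT); last exact: (Ck_trmx oT).
  apply: (Ck_mulmx oT) => //.
  apply: (Ck_add oT); first exact: Ck_cst.
  apply: (Ck_scalemx oT); first exact: Ck_cst.
  apply: (@eq_Ck _ _ _ _ _ (fun x => (phi x *m Jmx m)^T *m (phi x *m Jmx m)) _ oT).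
    by move=> x _; rewrite /outer /hopf !JcE.
  exact: (Ck_mulmx oT (Ck_trmx oT Cv) Cv).
have Cs : Ck 0 setT (fun x => Num.sqrt (Num.sqrt (d x ^+ 2))).
  have d2 x : 0 < d x ^+ 2 by rewrite exprn_even_gt0//= det_chart_neq0.
  apply: (Ck_sqrt oT); first by move=> x _; rewrite sqrtr_gt0.
  by apply: (Ck_sqrt oT); [move=> x _|exact: (Ck_exp _ oT)].
have {}Cs : Ck 0 setT chart_density.
  by apply: (eq_Ck oT) Cs => x _; rewrite sqrtr_sqr.
by move=> x; exact: (Cs x I).
Qed.

Lemma chart_density_bounds : exists c C, [/\ 0 < c, 0 <= C &
  forall x, unit_box R k x -> c <= chart_density x <= C].
Proof.
have cB : compact (unit_box R k).
  rewrite /unit_box; apply: (@rV_compact R^o k (fun=> [set x : R | `|x| <= 1])) => _.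
  have -> : [set x : R | `|x| <= 1] = `[-1, 1]%classic.
    by apply/seteqP; split=> x /=; rewrite in_itv/= ler_norml.
  exact: segment_compact.
have B0 : unit_box R k !=set0 by exists 0 => i; rewrite mxE normr0.
have cd : {within unit_box R k, continuous chart_density}.
  exact: continuous_subspaceT continuous_chart_density.
have [a _ Ha] := EVT_max_rV B0 cB cd; have [b _ Hb] := EVT_min_rV B0 cB cd.
exists (chart_density b), (chart_density a); split.
- exact: chart_density_gt0.
- exact/ltW/chart_density_gt0.
- move=> x xB; have xB' : x \in unit_box R k by exact/mem_set.
  by apply/andP; split; [apply: Hb|apply: Ha].
Qed.

Variable nu : {measure set (borel R n) -> \bar R}.
Hypothesis Hnu : volume_measure (berger mu) nu.

Lemma volume_chart (B : set (borel R n)) : measurable B -> B `<=` range phi ->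
  nu B = integral_rV (fun x : 'rV[R]_k => (chart_density x * (phi x \in B)%:R)%:E).
Proof.
move=> mB BU; rewrite (Hnu (chart_parametrization uO) mB BU).
by congr integral_rV; apply/funext => x; rewrite indicE setTI.
Qed.

Lemma borel_face : measurable (face (k := k) O : set (borel R n)).
Proof. by apply: borel_closed; exact: closed_face. Qed.

(** Comparison with the cube: [chart_face] makes the domain of integration exactly [unit_box], where
    the density lies between positive constants. *)
Lemma volume_face : (0 < nu (face (k := k) O) < +oo)%E.
Proof.
rewrite volume_chart; [|exact: borel_face|exact: face_sub_chart].
have inE x : (phi x \in (face (k := k) O : set (borel R n))) = (x \in unit_box R k).
  by apply/idP/idP => /set_mem /(chart_face uO) H; apply/mem_set.
have [c [C [c0 C0 H]]] := chart_density_bounds.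
apply/andP; split.
  apply: (@lt_le_trans _ _ (c * 2 ^+ k)%:E); first by rewrite lte_fin mulr_gt0// exprn_gt0.
  rewrite -integral_rV_box ?(ltW c0)//; apply: le_integral_rV => x; rewrite lee_fin.
    by rewrite mulr_ge0// ltW.
  rewrite inE; have [/set_mem/H/andP[? _]|_] := boolP (x \in _); last by rewrite !mulr0.
  by rewrite !mulr1.
apply: (@le_lt_trans _ _ (C * 2 ^+ k)%:E); last exact: ltry.
rewrite -integral_rV_box//; apply: le_integral_rV => x; rewrite lee_fin.
  by rewrite mulr_ge0// sqrtr_ge0.
rewrite inE; have [/set_mem/H/andP[_ ?]|_] := boolP (x \in _); last by rewrite !mulr0.
by rewrite !mulr1.
Qed.

End Charts.

End BergerVolume.

Section FiniteCover.
Context {d : measure_display} {T : measurableType d} {R : realType}.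
Context {I : Type}.
Implicit Types (C : I -> set T) (nu : {measure set T -> \bar R}).

Lemma finite_cover_measure nu C (r : seq I) :
  (forall i, measurable (C i)) -> (forall i, (nu (C i) < +oo)%E) ->
  (nu (\big[setU/set0]_(i <- r) C i) < +oo)%E.
Proof.
move=> mC fC; elim: r => [|i r IH]; first by rewrite big_nil measure0 ltry.
rewrite big_cons; apply: le_lt_trans (measureU2 _ _ _) _ => //.
  by apply: bigsetU_measurable.
by apply: lte_add_pinfty; [exact: fC|exact: IH].
Qed.

(** Pieces are split off one at a time, so overlaps do no harm; agreement of two measures chart by
    chart becomes agreement on the sphere. *)
Lemma finite_cover_eq nu1 nu2 C (r : seq I) (B : set T) :
  (forall i, measurable (C i)) ->
  (forall i B, measurable B -> B `<=` C i -> nu1 B = nu2 B) ->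
  measurable B -> B `<=` \big[setU/set0]_(i <- r) C i -> nu1 B = nu2 B.
Proof.
move=> mC H; elim: r B => [|i r IH] B mB.
  by rewrite big_nil subset0 => ->; rewrite !measure0.
rewrite big_cons => BC; have -> : B = (B `&` C i) `|` (B `\` C i) by rewrite setUIDK.
have dis : (B `&` C i) `&` (B `\` C i) = set0.
  by apply/seteqP; split=> x // [[_ ?] []].
have mI : measurable (B `&` C i) by exact: measurableI.
have mD : measurable (B `\` C i) by exact: measurableD.
have -> := measureU nu1 mI mD dis; have -> := measureU nu2 mI mD dis.
congr (_ + _)%E; first by apply: H => //; exact: subIsetr.
by apply: IH => // x [Bx nC]; case: (BC x Bx).
Qed.

End FiniteCover.

Section BergerVolumeInvariance.
Context {R : realType} {m : nat}.
Local Notation n := (m.+1 + m.+1)%N.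
Local Notation k := (m + m.+1)%N.
Local Notation E := 'rV[R]_n.
Local Notation S := (sphere : set (borel R n)).
Implicit Types (O T : 'M[R]_n) (p : E).
Variables (mu : R) (mu0 : mu != 0) (nu : {measure set (borel R n) -> \bar R}).
Hypothesis Hnu : volume_measure (berger mu) nu.

Local Notation facei := (fun b : 'I_k.+1 * bool => face (k := k) (flip b.1 b.2)).

Lemma sphere_sub_faces :
  S `<=` \big[setU/set0]_(b : 'I_k.+1 * bool) (facei b : set (borel R n)).
Proof.
by move=> p /flip_cover [b _ fb]; rewrite -bigcup_seq; exists b => //=; exact: mem_index_enum.
Qed.

Lemma volume_sphere_fin : (nu sphere < +oo)%E.
Proof.
apply: (@le_lt_trans _ _ (nu (\big[setU/set0]_(b : 'I_k.+1 * bool) (facei b : set (borel R n))))).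
  apply: le_measure; rewrite ?inE; last exact: sphere_sub_faces.
    exact: borel_sphere.
  by apply: bigsetU_measurable => b _; exact: borel_face.
apply: finite_cover_measure => b; first exact: borel_face.
by have /andP[] := volume_face mu0 (unitmx_flip b.1 b.2) Hnu.
Qed.

Lemma volume_sphere_gt0 : (0 < nu sphere)%E.
Proof.
have /andP[h _] := volume_face mu0 (unitmx1 R k.+1) Hnu.
apply: lt_le_trans h _; apply: le_measure; rewrite ?inE.
- exact: borel_face.
- exact: borel_sphere.
- by move=> p [].
Qed.

Section Unitary.
Variable T : 'M[R]_n.
Hypotheses (TT : T *m T^T = 1%:M) (TJ : T *m Jmx m = Jmx m *m T).

Lemma unitary_mulT : T^T *m T = 1%:M.
Proof. by apply: mulmx1C. Qed.

Lemma unitary_trJ : T^T *m Jmx m = Jmx m *m T^T.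
Proof.
have := congr1 trmx TJ; rewrite !trmx_mul tr_Jmx mulNmx mulmxN => /oppr_inj ->.
by [].
Qed.

Lemma unitary_dot (u v : E) : dot (u *m T^T) (v *m T^T) = dot u v.
Proof. by rewrite dot_mulmxl trmxK -mulmxA unitary_mulT mulmx1. Qed.

Lemma unitary_sphere p : sphere (p *m T) <-> sphere p.
Proof. by rewrite /sphere/= dot_mulmxl -mulmxA TT mulmx1. Qed.

Lemma chart_unitary O x : chart (k := k) (O *m T^T) x = chart (k := k) O x *m T^T.
Proof.
rewrite /chart -scalemxAl mulmxA; congr (_^-1 *: _).
by rewrite /enorm unitary_dot.
Qed.

Lemma unitmx_unitary O : O \in unitmx -> O *m T^T \in unitmx.
Proof. by move=> uO; rewrite unitmx_mul uO; have [] := mulmx1_unit TT. Qed.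

(** The Jacobians of the two charts differ by T^T, an isometry commuting with J, hence one that
    carries V to V and preserves the Berger form. The two Gram matrices coincide. *)
Lemma chart_density_unitary O x : O \in unitmx ->
  chart_density mu (O *m T^T) x = chart_density mu O x.
Proof.
move=> uO; have uOT := unitmx_unitary uO.
rewrite /chart_density !gram_bergerE; [|exact: chart_sphere..].
have -> : 'J (chart (k := k) (O *m T^T)) x = 'J (chart (k := k) O) x *m T^T.
  apply/row_matrixP => i; set e : 'rV[R]_k := delta_mx 0 i.
  have dO : is_derive x e (chart (k := k) O) (e *m 'J (chart (k := k) O) x).
    rewrite -(derive_chart uO); apply: derivableP; apply: diff_derivable.
    by have [df _] := Ck_chart uO 1; exact: df.
  have [_] := is_derive_mulmx dO (is_derive_cst (T^T) x e).
  rewrite mulmx0 addr0 => De.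
  transitivity (e *m 'J (chart (k := k) (O *m T^T)) x); first exact: rowE.
  transitivity (e *m 'J (chart (k := k) O) x *m T^T); last by rewrite -mulmxA -rowE.
  rewrite -De -(derive_chart uOT); congr ('D_e _ x).
  by apply/funext => y; exact: chart_unitary.
rewrite chart_unitary; set q := chart O x; set J1 := 'J _ x.
suff GE : T^T *m berger_mx mu (q *m T^T) *m T = berger_mx mu q.
  by rewrite trmx_mul trmxK !mulmxA -(mulmxA J1) -(mulmxA J1) GE.
rewrite /berger_mx /hopf !JcE mulmxDr mulmxDl mulmx1 unitary_mulT; congr (_ + _).
rewrite -scalemxAr -scalemxAl; congr (_ *: _).
have e : q *m T^T *m Jmx m = q *m Jmx m *m T^T by rewrite -!mulmxA unitary_trJ.
rewrite /outer e; move: (q *m Jmx m) => w; rewrite trmx_mul trmxK !mulmxA.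
by rewrite unitary_mulT mul1mx -(mulmxA _ T^T T) unitary_mulT mulmx1.
Qed.

Lemma measurable_mulmx : measurable_fun setT ((fun p => p *m T) : borel R n -> borel R n).
Proof.
apply: (@measurability _ _ (borel R n) (borel R n) setT _ open) => //.
move=> _ [A oA <-]; rewrite setTI; apply: borel_open.
apply: open_comp => // p _; exact: continuous_mulmxr.
Qed.

(** The pushforward of nu is compared with nu on each face. If B lies in the chart of O, its
    preimage lies in the chart of O *m T^T at the same parameters, so both volumes are the same
    iterated integral and no change of variables occurs. *)
Lemma volume_unitary (B : set (borel R n)) : measurable B -> B `<=` sphere ->
  nu ((fun p => p *m T) @^-1` B) = nu B.
Proof.
move=> mB BS.
pose nu' := measure_function_pushforward__canonical__measure_function_Measure
  nu measurable_mulmx.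
apply: (@finite_cover_eq _ _ _ _ nu' nu facei (index_enum _)) => //.
- by move=> b; exact: borel_face.
- move=> b {mB BS}B mB BF; have uO : (flip b.1 b.2 : 'M[R]_n) \in unitmx by exact: unitmx_flip.
  have uOT := unitmx_unitary uO.
  have HB p : B (p *m T) -> range (chart (k := k) (flip b.1 b.2 *m T^T)) p.
    move=> /BF /(face_sub_chart uO)[x _ e]; exists x => //.
    by rewrite chart_unitary e -mulmxA TT mulmx1.
  have mfB : measurable ((fun p => p *m T) @^-1` B : set (borel R n)).
    by rewrite -[X in measurable X]setTI; exact: measurable_mulmx.
  have BU : B `<=` range (chart (k := k) (flip b.1 b.2)).
    by move=> p /BF; exact: face_sub_chart.
  apply: (etrans (volume_chart uOT Hnu mfB HB)).
  apply: (etrans _ (esym (volume_chart uO Hnu mB BU))).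
  congr integral_rV; apply/funext => x; rewrite chart_density_unitary// chart_unitary.
  congr (_ * _%:R)%:E; congr nat_of_bool; apply/idP/idP => /set_mem H; apply/mem_set.
    by move: H; rewrite /preimage/= -mulmxA unitary_mulT mulmx1.
  by rewrite /preimage/= -mulmxA unitary_mulT mulmx1.
- exact: subset_trans BS sphere_sub_faces.
Qed.

Lemma integral_unitary (f : E -> R) : (forall p, sphere p -> {for p, continuous f}) ->
  \int[nu]_(p in S) f (p *m T) = \int[nu]_(p in S) f p.
Proof.
move=> cf; rewrite /Rintegral; congr fine.
(* Extension by zero off the sphere, because the pushforward formula is applied to a function
   measurable on the whole space. *)
pose g : borel R n -> \bar R := (EFin \o f) \_ S.
pose F : borel R n -> borel R n := fun p => p *m T.
have preS : F @^-1` S = S by apply/seteqP; split=> p /unitary_sphere.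
have mg : measurable_fun setT g.
  have mf : measurable_fun S (EFin \o f).
    by apply: measurableT_comp => //; exact: measurable_sphere.
  by have [H _] := @measurable_restrictT _ _ _ _ S (EFin \o f) borel_sphere; exact: H.
have gE p : sphere p -> g p = (f p)%:E by move=> Sp; rewrite /g patchT//; exact: mem_set.
have ig : nu.-integrable (F @^-1` S) (g \o F).
  rewrite preS; apply: (eq_integrable borel_sphere (EFin \o (fun p => f (p *m T)))).
    by move=> p /set_mem Sp; rewrite /= gE//; exact/unitary_sphere.
  apply: (integrable_sphere volume_sphere_fin) => p Sp.
  apply: (@continuous_comp _ _ _ (fun p => p *m T) f); first exact: continuous_mulmxr.
  exact/cf/unitary_sphere.
have := integral_pushforward measurable_mulmx mg ig borel_sphere.
rewrite -/F preS => e.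
transitivity (\int[nu]_(p in S) (g \o F) p)%E.
  by apply: eq_integral => p /set_mem Sp; rewrite /= gE//; exact/unitary_sphere.
rewrite -e; transitivity (\int[nu]_(p in S) g p)%E.
  apply: (@eq_measure_integral _ _ _ S nu
    (measure_function_pushforward__canonical__measure_function_Measure
       nu measurable_mulmx)) => A mA AS.
  exact: volume_unitary.
by apply: eq_integral => p /set_mem Sp; rewrite gE.
Qed.

End Unitary.
End BergerVolumeInvariance.

Lemma compact_bounded_continuous (R : realType) (T : topologicalType) (K : set T) (f : T -> R) :
  compact K -> (forall x, K x -> {for x, continuous f}) ->
  exists2 M, 0 <= M & forall x, K x -> `|f x| <= M.
Proof.
move=> cK cf; have [[x0 Kx0]|K0] := pselect (exists x, K x); last first.
  by exists 0 => // x Kx; case: K0; exists x.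
have cnf : {within K, continuous (fun x => `|f x|)}.
  apply: continuous_in_subspaceT => x /set_mem Kx.
  by apply: (@continuous_comp _ _ _ f Num.norm); [exact: cf|exact: norm_continuous].
have [c _ fc] := compact_EVT_max (ex_intro _ x0 Kx0) cK cnf.
by exists `|f c| => // x Kx; apply: fc; exact: mem_set.
Qed.

(** * Differentiation under the integral sign *)

Section UnderIntegral.
Context {R : realType} {n : nat}.
Local Notation E := 'rV[R]_n.
Local Notation S := (sphere : set (borel R n)).
Variables (nu : {measure set (borel R n) -> \bar R}) (nuS : (nu sphere < +oo)%E).

Lemma is_derive_integral_sphere (F F' : R -> E -> R) (delta t : R) :
  (forall (s : R) (p : E), `|s| < delta -> sphere p -> {for p, continuous (F s)}) ->
  (forall (s : R) (p : E), `|s| < delta -> sphere p -> is_derive s 1 (F ^~ p) (F' s p)) ->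
  (forall (s : R) (p : E), `|s| < delta -> sphere p ->
    {for (s, p), continuous (fun z : R^o * E => F' z.1 z.2)}) ->
  `|t| < delta ->
  is_derive t 1 (fun s => \int[nu]_(p in S) F s p) (\int[nu]_(p in S) F' t p).
Proof.
(* r lies strictly between |t| and delta, so [F'] is bounded on the compact product of [-r, r] with
   the sphere, and a constant dominates it near t. *)
move=> cF dF cF' td; pose r := (`|t| + delta) / 2.
have tr : `|t| < r by rewrite midf_lt.
have rd : r < delta by rewrite midf_lt.
have cK : compact (`[- r, r]%classic `*` (sphere : set E) : set (R^o * E)).
  by apply: compact_setX; [exact: segment_compact|exact: compact_sphere].
have [M M0 HM] : exists2 M, 0 <= M & forall z : R^o * E,
    (`[- r, r]%classic `*` (sphere : set E)) z -> `|F' z.1 z.2| <= M.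
  apply: compact_bounded_continuous => // -[s p] [/=]; rewrite in_itv/= => sr Sp.
  by apply: cF' => //; apply: le_lt_trans rd; rewrite ler_norml.
pose I : set R := `]- r, r[%classic.
have It : I t by rewrite /I/= in_itv/= -ltr_norml.
have Id x : I x -> `|x| < delta.
  by rewrite /I/= in_itv/= -ltr_norml => /lt_trans; apply.
have intF x : I x -> nu.-integrable S (EFin \o F x).
  by move=> Ix; apply: (integrable_sphere nuS) => p; exact/cF/Id.
have derF x y : I x -> S y -> derivable (F ^~ y) x 1.
  by move=> Ix Sy; have [] := dF x y (Id x Ix) Sy.
have intG : nu.-integrable S (EFin \o (cst M : borel R n -> R)).
  apply: (integrable_sphere nuS) => p _.
    have C : Ck 0 [set: E] (fun=> M) by exact: Ck_cst openT.
    exact: (C p Logic.I).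
have p1E x y : I x -> S y -> partial1of2 F x y = F' x y.
  by move=> Ix Sy; rewrite partial1of2E; have [_ ->] := dF x y (Id x Ix) Sy.
have Gub x y : I x -> S y -> `|partial1of2 F x y| <= (cst M : borel R n -> R) y.
  move=> Ix Sy; rewrite p1E//; apply: (HM (x, y)); split=> //=; rewrite in_itv/=.
  by move: Ix; rewrite /I/= in_itv/= => /andP[? ?]; rewrite !ltW.
have mS := @borel_sphere R n.
apply: DeriveDef.
  exact: (derivable_under_integral mS It intF derF (fun=> M0) intG Gub).
rewrite -derive1E (differentiation_under_integral mS It intF derF (fun=> M0) intG Gub).
by apply: eq_Rintegral => p /set_mem Sp; rewrite p1E.
Qed.

End UnderIntegral.

Section DirectionalDerivative.
Context {R : realType} {n : nat}.
Local Notation E := 'rV[R]_n.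

Lemma derive_basis (W : normedModType R) (f : E -> W) x v : differentiable f x ->
  'D_v f x = \sum_i v 0 i *: 'D_(delta_mx 0 i) f x.
Proof.
move=> df; rewrite deriveE// {1}[v]row_sum_delta linear_sum/=.
by apply: eq_bigr => i _; rewrite linearZ/= deriveE.
Qed.

Lemma derive_lincomb (W : normedModType R) (f : E -> W) x a u v : differentiable f x ->
  'D_(a *: u + v) f x = a *: 'D_u f x + 'D_v f x.
Proof. by move=> df; rewrite !deriveE// linearP. Qed.

Lemma derive_sumdir (W : normedModType R) (f : E -> W) x (I : finType) (c : I -> R)
    (u : I -> E) : differentiable f x ->
  'D_(\sum_i c i *: u i) f x = \sum_i c i *: 'D_(u i) f x.
Proof.
move=> df; rewrite deriveE// linear_sum/=.
by apply: eq_bigr => i _; rewrite linearZ/= deriveE.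
Qed.

Lemma smoothS_continuous (W : normedModType R) (f : E -> W) (x : E) :
  smoothS f -> x != 0 -> {for x, continuous (ext f)}.
Proof. by move=> /(_ 0) cf; exact: cf. Qed.

Lemma smoothS_derive_continuous (W : normedModType R) (f : E -> W) (x v : E) :
  smoothS f -> x != 0 -> {for x, continuous (fun y => 'D_v (ext f) y)}.
Proof. by move=> /(_ 1)[_ /(_ v)] cf; exact: cf. Qed.

End DirectionalDerivative.

(** * Killing fields from one-parameter unitary groups *)

Section Killing.
Context {R : realType} {m : nat}.
Local Notation n := (m.+1 + m.+1)%N.
Local Notation E := 'rV[R]_n.
Local Notation S := (sphere : set (borel R n)).
Variables (mu : R) (mu0 : mu != 0) (nu : {measure set (borel R n) -> \bar R}).
Hypothesis Hnu : volume_measure (berger mu) nu.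
Implicit Types (w p : E) (psi : E -> R^o).

Let nuS := volume_sphere_fin mu0 Hnu.

Definition plane_proj w : 'M[R]_n := outer w w + outer (Jc w) (Jc w).
Definition plane_rot w : 'M[R]_n := outer w (Jc w) - outer (Jc w) w.
(** For a unit vector w: multiplication by exp (i s) on the complex line of w and the identity on
    its orthogonal complement. [plane_rot w] is the generator of this group. *)
Definition phase w (s : R) : 'M[R]_n :=
  1%:M + (cos s - 1) *: plane_proj w + sin s *: plane_rot w.

Lemma Jmx_outer u w : Jmx m *m outer u w = - outer (Jc u) w.
Proof.
rewrite /outer mulmxA JcE trmx_mul tr_Jmx !mulNmx opprK.
by [].
Qed.

Lemma outer_Jmx u w : outer u w *m Jmx m = outer u (Jc w).
Proof. by rewrite outer_mulmx JcE. Qed.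

Lemma outerNl u w : outer (- u) w = - outer u w.
Proof. by rewrite /outer linearN/= mulNmx. Qed.

Lemma outerNr u w : outer u (- w) = - outer u w.
Proof. by rewrite /outer mulmxN. Qed.

Lemma tr_plane_rot w : (plane_rot w)^T = - plane_rot w.
Proof. by rewrite /plane_rot linearB/= !tr_outer opprB. Qed.

Lemma phase_unitary w s : dot w w = 1 -> phase w s *m (phase w s)^T = 1%:M.
Proof.
move=> w1; have v1 : dot (Jc w) (Jc w) = 1 by rewrite dot_JcJ.
have wv := dot_Jc_self w; have vw : dot (Jc w) w = 0 by rewrite dotC.
set A := plane_proj w; set B := plane_rot w.
have AA : A *m A = A.
  by rewrite /A /plane_proj mulmxDl !mulmxDr !outer_outer w1 v1 wv vw !scale1r !scale0r addr0 add0r.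
have AB : A *m B = B.
  rewrite /A /B /plane_proj /plane_rot mulmxDl !mulmxBr !outer_outer w1 v1 wv vw.
  by rewrite !scale1r !scale0r subr0 sub0r.
have BA : B *m A = B.
  rewrite /A /B /plane_proj /plane_rot mulmxBl !mulmxDr !outer_outer w1 v1 wv vw.
  by rewrite !scale1r !scale0r addr0 add0r.
have BB : B *m B = - A.
  rewrite /A /B /plane_proj /plane_rot mulmxBl !mulmxBr !outer_outer w1 v1 wv vw.
  by rewrite !scale1r !scale0r subr0 sub0r opprD.
have trA : A^T = A by rewrite /A /plane_proj linearD/= !tr_outer.
have trB : B^T = - B by exact: tr_plane_rot.
rewrite /phase -/A -/B; clearbody A B.
rewrite !linearD/= !linearZ/= trmx1 trA trB.
set c := cos s; set d := sin s.
have cd : c ^+ 2 + d ^+ 2 = 1 by exact: cos2Dsin2.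
transitivity (1%:M + (c ^+ 2 + d ^+ 2 - 1) *: A).
  rewrite mulmx1 !mulmxN !mulmxDl !mul1mx -!scalemxAl AA AB BA BB.
  apply/matrixP => i j; rewrite !mxE.
  by move: (A i j) (B i j) ((i == j)%:R) => x y z; ring.
by rewrite cd subrr scale0r addr0.
Qed.

Lemma phase_J w s : phase w s *m Jmx m = Jmx m *m phase w s.
Proof.
rewrite /phase /plane_proj /plane_rot.
rewrite !(mulmxDl, mulmxDr) mul1mx mulmx1 -!(scalemxAl, scalemxAr).
rewrite !(mulmxDl, mulmxDr, mulNmx, mulmxN) !Jmx_outer !outer_Jmx !JcJ.
rewrite !(outerNl, outerNr) opprK.
move: (outer w w) (outer w (Jc w)) (outer (Jc w) w) (outer (Jc w) (Jc w)) => a b c d.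
by apply/matrixP => i j; rewrite !mxE; ring.
Qed.

Lemma phase0 w : phase w 0 = 1%:M.
Proof. by rewrite /phase cos0 sin0 subrr !scale0r !addr0. Qed.

Definition phase' w (s : R) : 'M[R]_n := - sin s *: plane_proj w + cos s *: plane_rot w.

Lemma is_derive_phase w p (s : R) :
  is_derive s 1 (fun s => p *m phase w s) (p *m phase' w s).
Proof.
have e : (fun s => p *m phase w s) = cst p +
    ((fun s => (cos s - 1) *: (p *m plane_proj w)) + (fun s => sin s *: (p *m plane_rot w))).
  apply/funext => r; rewrite /phase; move: (plane_proj w) (plane_rot w) => A B.
  by rewrite !mulmxDr mulmx1 -!scalemxAr -addrA.
have dZ (f : R -> R) (df : R) (u : E) : is_derive s 1 f df ->
    is_derive s 1 (fun s => f s *: u) (df *: u).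
  move=> [Df Ef]; have dfs : differentiable f s by exact/derivable1_diffP.
  apply: DeriveDef; first by apply: diff_derivable; exact: differentiableZl.
  by rewrite deriveE ?diffZl -?deriveE ?Ef//; exact: differentiableZl.
rewrite e /phase'; move: (plane_proj w) (plane_rot w) => A B.
rewrite mulmxDr -!scalemxAr -[X in is_derive _ _ _ X]add0r.
have h1 : is_derive s 1 (fun s => (cos s - 1) *: (p *m A)) (- sin s *: (p *m A)).
  apply: dZ; have := is_deriveB (is_derive_cos s) (is_derive_cst (1 : R) s 1).
  by rewrite subr0.
have h2 : is_derive s 1 (fun s => sin s *: (p *m B)) (cos s *: (p *m B)).
  by apply: dZ; exact: is_derive_sin.
exact: (is_deriveD (is_derive_cst p s 1) (is_deriveD h1 h2)).
Qed.

Let joint := (R^o * E)%type.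

Lemma Ck0_phase w : Ck 0 setT (fun z : joint => z.2 *m phase w z.1) /\
  Ck 0 setT (fun z : joint => z.2 *m phase' w z.1).
Proof.
have oT : open [set: joint] by exact: openT.
have C2 : Ck 0 setT (fun z : joint => z.2) by move=> z _; exact: cvg_snd.
have Cc : Ck 0 setT (fun z : joint => cos z.1 : R).
  move=> z _; apply: (@continuous_comp _ _ _ (fun z : joint => z.1) cos); first exact: cvg_fst.
  exact: continuous_cos.
have Cs : Ck 0 setT (fun z : joint => sin z.1 : R).
  move=> z _; apply: (@continuous_comp _ _ _ (fun z : joint => z.1) sin); first exact: cvg_fst.
  exact: continuous_sin.
split; apply: (Ck_mulmx oT C2).
  apply: (Ck_add oT); last exact: (Ck_scalemx oT Cs (Ck_cst _ _ oT)).
  apply: (Ck_add oT); first exact: (Ck_cst _ _ oT).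
  apply: (Ck_scalemx oT _ (Ck_cst _ _ oT)).
  exact: (Ck_sub oT Cc (Ck_cst _ _ oT)).
apply: (Ck_add oT); last exact: (Ck_scalemx oT Cc (Ck_cst _ _ oT)).
exact: (Ck_scalemx oT (Ck_opp oT Cs) (Ck_cst _ _ oT)).
Qed.

(** The integral of psi along the flow is constant in s by unitary invariance; its derivative at s =
    0, taken under the integral sign, is the left-hand side. *)
Lemma integral_phase psi w : smoothS psi -> dot w w = 1 ->
  \int[nu]_(p in S) 'D_(p *m plane_rot w) (ext psi) p = 0.
Proof.
move=> spsi w1.
pose F s p := ext psi (p *m phase w s).
pose F' s p := \sum_i (p *m phase' w s) 0 i * 'D_(delta_mx 0 i) (ext psi) (p *m phase w s).
have Sph s p : sphere p -> sphere (p *m phase w s).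
  by move=> Sp; apply/(unitary_sphere (phase_unitary s w1)).
have c0 : {for 0, continuous (fun s : R => s)} by exact: cvg_id.
have D : is_derive (0 : R) 1 (fun s => \int[nu]_(p in S) F s p) (\int[nu]_(p in S) F' 0 p).
  apply: (is_derive_integral_sphere nuS (delta := 1)); last by rewrite normr0.
  - move=> s p _ Sp; apply: (@continuous_comp _ _ _ (fun p => p *m phase w s) (ext psi)).
      exact: continuous_mulmxr.
    by apply: smoothS_continuous => //; exact/sphere_neq0/Sph.
  - move=> s p _ Sp.
    have dpsi : differentiable (ext psi) (p *m phase w s).
      by apply: smoothS_differentiable => //; exact/sphere_neq0/Sph.
    have := is_derive_curve (is_derive_phase w p s) dpsi.
    by rewrite derive_basis.
  - move=> s p _ Sp.
    have [C1 C2] := Ck0_phase w.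
    have oU : open [set z : joint | z.2 *m phase w z.1 != 0].
      apply: (@open_comp _ _ (fun z : joint => z.2 *m phase w z.1) [set x | x != 0]).
        by move=> z _; exact: (C1 z I).
      exact: open_neq0.
    suff C : Ck 0 [set z : joint | z.2 *m phase w z.1 != 0] (fun z : joint => F' z.1 z.2).
      by apply: (C (s, p)); exact/sphere_neq0/Sph.
    apply: (@Ck_sum R joint R^o 0 _ _ (index_enum 'I_n) xpredT (fun i (z : joint) =>
      (z.2 *m phase' w z.1) 0 i * 'D_(delta_mx 0 i) (ext psi) (z.2 *m phase w z.1)) oU) => i _.
    apply: (Ck_mul oU).
      by apply: (Ck_entry _ _ oU) => z _; exact: (C2 z I).
    move=> z /= z0.
    apply: (@continuous_comp _ _ _ (fun z : joint => z.2 *m phase w z.1)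
      (fun y => 'D_(delta_mx 0 i) (ext psi) y)); first exact: (C1 z I).
    exact: smoothS_derive_continuous.
have cst_int : (fun s => \int[nu]_(p in S) F s p) = cst (\int[nu]_(p in S) ext psi p).
  apply/funext => s.
  have cpsi : forall p, sphere p -> {for p, continuous (ext psi : E -> R)}.
    by move=> p Sp; apply: smoothS_continuous => //; exact: sphere_neq0.
  exact: (integral_unitary mu0 Hnu (phase_unitary s w1) (phase_J w s) cpsi).
move: D; rewrite cst_int => -[_]; rewrite derive_cst => E0.
rewrite [RHS]E0; apply: eq_Rintegral => p /set_mem Sp.
rewrite /F' phase0 mulmx1 /phase' sin0 cos0 oppr0 scale0r add0r scale1r.
by rewrite [LHS]derive_basis//; apply: smoothS_differentiable => //; exact: sphere_neq0.
Qed.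

End Killing.

Section SmoothS.
Context {R : realType} {n : nat}.
Local Notation E := 'rV[R]_n.
Local Notation U0 := [set x : E | x != 0].
Implicit Types (f g : E -> R^o).

Lemma smoothS_cst (W : normedModType R) (c : W) : smoothS (fun _ : E => c).
Proof. by move=> k; exact: Ck_cst open_neq0. Qed.

Lemma smoothS_mulmx (M : 'M[R]_n) : smoothS (fun p : E => p *m M).
Proof.
move=> k; apply: (Ck_mulmx open_neq0) (Ck_cst _ _ open_neq0).
by apply: (Ck_normalize open_neq0) => //; exact: Ck_id open_neq0.
Qed.

Lemma smoothS_id : smoothS (id : E -> E).
Proof.
by move=> k; apply: (Ck_normalize open_neq0) => //; exact: Ck_id open_neq0.
Qed.

Lemma smoothS_dot (X Y : E -> E) : smoothS X -> smoothS Y ->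
  smoothS (fun p => dot (X p) (Y p) : R^o).
Proof. by move=> sX sY k; exact: (Ck_dot open_neq0 (sX k) (sY k)). Qed.

Lemma smoothS_mul f g : smoothS f -> smoothS g -> smoothS (fun p => f p * g p : R^o).
Proof. by move=> sf sg k; exact: (Ck_mul open_neq0 (sf k) (sg k)). Qed.

Lemma smoothS_scale f (X : E -> E) : smoothS f -> smoothS X ->
  smoothS (fun p => f p *: X p).
Proof. by move=> sf sX k; exact: (Ck_scalemx open_neq0 (sf k) (sX k)). Qed.

Lemma smoothS_add (W : normedModType R) (X Y : E -> W) : smoothS X -> smoothS Y ->
  smoothS (fun p => X p + Y p).
Proof. by move=> sX sY k; exact: (Ck_add open_neq0 (sX k) (sY k)). Qed.

Lemma smoothS_subv (X Y : E -> E) : smoothS X -> smoothS Y ->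
  smoothS (fun p => X p - Y p).
Proof. by move=> sX sY k; exact: (Ck_subv open_neq0 (sX k) (sY k)). Qed.

Lemma smoothS_mulmxr (X : E -> E) (M : 'M[R]_n) : smoothS X ->
  smoothS (fun p => X p *m M).
Proof. by move=> sX k; exact: (Ck_mulmx open_neq0 (sX k) (Ck_cst _ _ open_neq0)). Qed.

Lemma derive_ext_mulmx (M : 'M[R]_n) (p v : E) : sphere p -> tangent p v ->
  'D_v (ext (fun p : E => p *m M)) p = v *m M.
Proof.
move=> Sp pv; have idM : is_derive p v (fun y : E => y *m M) (v *m M).
  have := is_derive_mulmx (is_derive_id p v) (is_derive_cst M p v).
  by rewrite mulmx0 addr0.
have [df _] : Ck 1 setT (fun p : E => p *m M).
  by apply: (Ck_mulmx openT); [exact: Ck_id openT|exact: Ck_cst openT].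
have [_ <-] := idM; rewrite (derive_ext _ Sp (df p Logic.I)).
by rewrite pv scale0r subr0.
Qed.

Lemma is_derive_smoothS (W : normedModType R) (X : E -> W) (p v : E) :
  smoothS X -> p != 0 -> is_derive p v (ext X) ('D_v (ext X) p).
Proof.
by move=> sX p0; apply/derivableP/diff_derivable; exact: smoothS_differentiable.
Qed.

Lemma derive_ext_dot (X Y : E -> E) (p v : E) : smoothS X -> smoothS Y -> sphere p ->
  'D_v (ext (fun p => dot (X p) (Y p) : R^o)) p =
  dot ('D_v (ext X) p) (Y p) + dot (X p) ('D_v (ext Y) p).
Proof.
move=> sX sY Sp; have p0 := sphere_neq0 Sp.
have [_] := is_derive_dot (is_derive_smoothS v sX p0) (is_derive_smoothS v sY p0).
by rewrite !ext_sphere.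
Qed.

Lemma derive_ext_mul f g (p v : E) : smoothS f -> smoothS g -> sphere p ->
  'D_v (ext (fun p => f p * g p : R^o)) p =
  'D_v (ext f) p * g p + f p * 'D_v (ext g) p.
Proof.
move=> sf sg Sp; have p0 := sphere_neq0 Sp.
have [_ H] := is_deriveM (is_derive_smoothS v sf p0 : is_derive p v (ext f : E -> R) _)
  (is_derive_smoothS v sg p0 : is_derive p v (ext g : E -> R) _).
by apply: (etrans H); rewrite !ext_sphere// /GRing.scale/= addrC mulrC.
Qed.

Lemma Ck_dirderiv k (f : E -> R^o) (V : E -> E) : smoothS f -> Ck k U0 V ->
  Ck k U0 (fun p => 'D_(V p) (ext f) p : R).
Proof.
move=> sf CV; apply: (@eq_Ck _ _ _ _ _ (fun p => \sum_i V p 0 i * 'D_(delta_mx 0 i) (ext f) p) _ open_neq0).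
  by move=> x x0; rewrite [RHS]derive_basis//; exact: smoothS_differentiable.
apply: (@Ck_sum R E R k U0 _ (index_enum 'I_n) xpredT
  (fun i p => V p 0 i * 'D_(delta_mx 0 i) (ext f) p) open_neq0) => i _; apply: (Ck_mul open_neq0).
  exact: (Ck_entry _ _ open_neq0 CV).
exact: (sf k.+1).2.
Qed.

End SmoothS.

(** * Integration by parts on the sphere *)

Section IBP.
Context {R : realType} {m : nat}.
Local Notation n := (m.+1 + m.+1)%N.
Local Notation E := 'rV[R]_n.
Local Notation S := (sphere : set (borel R n)).
Local Notation U0 := [set x : E | x != 0].
Variables (mu : R) (mu0 : mu != 0) (nu : {measure set (borel R n) -> \bar R}).
Hypothesis Hnu : volume_measure (berger mu) nu.
Implicit Types (w p b : E) (psi : E -> R^o) (K L : 'M[R]_n).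

Let nuS := volume_sphere_fin mu0 Hnu.

Lemma integrable_Ck0 (f : E -> R) : Ck 0 U0 f -> nu.-integrable S (EFin \o f).
Proof. by move=> Cf; apply: (integrable_sphere nuS) => p Sp; exact/Cf/sphere_neq0. Qed.

Lemma integral_Ck0D (f g : E -> R) : Ck 0 U0 f -> Ck 0 U0 g ->
  \int[nu]_(p in S) (f p + g p) = \int[nu]_(p in S) f p + \int[nu]_(p in S) g p.
Proof.
by move=> Cf Cg; exact: (RintegralD borel_sphere (integrable_Ck0 Cf) (integrable_Ck0 Cg)).
Qed.

Lemma integral_Ck0Z a (f : E -> R) : Ck 0 U0 f ->
  \int[nu]_(p in S) (a * f p) = a * \int[nu]_(p in S) f p.
Proof. by move=> Cf; exact: (RintegralZl a borel_sphere (integrable_Ck0 Cf)). Qed.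

Lemma integral_Ck0_sum (I : finType) (f : I -> E -> R) : (forall i, Ck 0 U0 (f i)) ->
  \int[nu]_(p in S) (\sum_i f i p) = \sum_i \int[nu]_(p in S) f i p.
Proof.
move=> Cf; elim: (index_enum I) => [|i r IH].
  rewrite big_nil -[RHS](mul0r (fine (nu S))) -Rintegral_cst; last exact: borel_sphere.
  by apply: eq_Rintegral => p _; rewrite big_nil.
rewrite big_cons -IH -integral_Ck0D; [|exact: Cf|].
  by apply: eq_Rintegral => p _; rewrite big_cons.
by apply: (@Ck_sum R E R 0 U0 _ r xpredT f open_neq0) => j _; exact: Cf.
Qed.

(** Recorded through the vanishing of integrals because this condition is linear in K, whereas flows
    are constructed for [plane_rot] only. *)
Definition killing K := K^T = - K /\ forall psi, smoothS psi ->
  \int[nu]_(p in S) 'D_(p *m K) (ext psi) p = 0.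

Lemma Ck_mul_id k K : Ck k U0 (fun p : E => p *m K).
Proof. exact: (Ck_mulmx open_neq0 (Ck_id _ open_neq0) (Ck_cst _ _ open_neq0)). Qed.

Lemma killing_lincomb a K L : killing K -> killing L -> killing (a *: K + L).
Proof.
move=> [tK HK] [tL HL]; split; first by rewrite linearP/= tK tL scalerN opprD.
move=> psi spsi.
transitivity (\int[nu]_(p in S) (a * 'D_(p *m K) (ext psi) p + 'D_(p *m L) (ext psi) p)).
  apply: eq_Rintegral => p /set_mem Sp; rewrite mulmxDr -scalemxAr.
  rewrite derive_lincomb//; exact: smoothS_differentiable spsi (sphere_neq0 Sp).
have CK := Ck_dirderiv spsi (Ck_mul_id 0 K); have CL := Ck_dirderiv spsi (Ck_mul_id 0 L).
rewrite (integral_Ck0D (Ck_mul open_neq0 (Ck_cst 0 a open_neq0) CK) CL).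
by rewrite (integral_Ck0Z a CK) HK// HL// mulr0 addr0.
Qed.

Lemma outer_entry (u w : E) i j : outer u w i j = u 0 i * w 0 j.
Proof. by rewrite mxE big_ord1 mxE. Qed.

Lemma outerZ a c u w : outer (a *: u) (c *: w : E) = (a * c) *: outer u w.
Proof.
apply/matrixP => i j; rewrite [RHS]mxE !outer_entry.
by rewrite [X in X * _ = _]mxE [X in _ * X = _]mxE mulrACA.
Qed.

Lemma plane_rotZ a w : plane_rot (a *: w) = a ^+ 2 *: plane_rot w.
Proof.
by rewrite /plane_rot JcZ !outerZ -scalerBr expr2.
Qed.

Lemma killing_plane_rot w : killing (plane_rot w).
Proof.
split; first exact: tr_plane_rot.
have [->|w0] := eqVneq w 0.
  move=> psi _; rewrite (_ : plane_rot 0 = 0); last first.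
    by rewrite -(scale0r 0) plane_rotZ expr0n scale0r.
  transitivity (\int[nu]_(p in S) (0 : R)).
    by apply: eq_Rintegral => p _; rewrite mulmx0 derive0.
  by rewrite Rintegral_cst ?mul0r//; exact: borel_sphere.
move=> psi spsi; pose u := (enorm w)^-1 *: w.
have wu : w = enorm w *: u.
  by rewrite /u scalerA divff ?scale1r// gt_eqF// enorm_gt0.
have u1 : dot u u = 1 by exact: sphere_normalize.
have HK := integral_phase mu0 Hnu spsi u1.
have CK := Ck_dirderiv spsi (Ck_mul_id 0 (plane_rot u)).
transitivity (\int[nu]_(p in S) (enorm w ^+ 2 * 'D_(p *m plane_rot u) (ext psi) p)).
  apply: eq_Rintegral => p /set_mem Sp; rewrite {1}wu plane_rotZ -scalemxAr.
  have dp := smoothS_differentiable spsi (sphere_neq0 Sp).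
  have := derive_lincomb (enorm w ^+ 2) (p *m plane_rot u) 0 dp.
  by rewrite addr0 derive0 addr0.
by rewrite (integral_Ck0Z _ CK) HK mulr0.
Qed.

Lemma killing0 : killing 0.
Proof.
by have := killing_plane_rot 0; rewrite -(scale0r 0) plane_rotZ expr0n scale0r.
Qed.

Lemma killingZ a K : killing K -> killing (a *: K).
Proof. by move=> /(killing_lincomb a)/(_ killing0); rewrite addr0. Qed.

Lemma killing_sum (I : finType) (F : I -> 'M[R]_n) :
  (forall i, killing (F i)) -> killing (\sum_i F i).
Proof.
move=> H; apply: (big_ind killing killing0 _ (fun i _ => H i)) => K L kK kL.
by have := killing_lincomb 1 kK kL; rewrite scale1r.
Qed.

Lemma sum_outer_basis : \sum_(i < n) outer (delta_mx 0 i : E) (delta_mx 0 i) = 1%:M.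
Proof.
have dE (l i : 'I_n) : (delta_mx 0 l : E) 0 i = (i == l)%:R by rewrite mxE.
apply/matrixP => i j; rewrite summxE (bigD1 i)//= outer_entry !dE eqxx mul1r.
rewrite big1 => [|l li]; first by rewrite addr0 mxE eq_sym.
by rewrite outer_entry !dE eq_sym (negbTE li) mul0r.
Qed.

(** Half the sum of [plane_rot] over the real standard basis, since every complex coordinate line is
    met twice. *)
Lemma killing_J : killing (Jmx m).
Proof.
have -> : Jmx m = 2^-1 *: \sum_(i < n) plane_rot (delta_mx 0 i : E).
  rewrite /plane_rot sumrB.
  have -> : \sum_(i < n) outer (delta_mx 0 i : E) (Jc (delta_mx 0 i)) = Jmx m.
    under eq_bigr do rewrite -outer_Jmx.
    by rewrite -mulmx_suml sum_outer_basis mul1mx.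
  have -> : \sum_(i < n) outer (Jc (delta_mx 0 i)) (delta_mx 0 i : E) = - Jmx m.
    under eq_bigr do rewrite -[outer _ _]opprK -Jmx_outer.
    by rewrite sumrN -mulmx_sumr sum_outer_basis mulmx1.
  by rewrite opprK scalerDr -scalerDl (_ : 2^-1 + 2^-1 = 1) ?scale1r//; field.
by apply: killingZ; apply: killing_sum => i; exact: killing_plane_rot.
Qed.

(** The generator of the real rotation in the plane of a and b plus its conjugate by J: an element
    of the Lie algebra of the unitary group. *)
Definition unitary_gen a b : 'M[R]_n :=
  outer a b - outer b a + outer (Jc a) (Jc b) - outer (Jc b) (Jc a).

(** Polarization of the quadratic map [plane_rot] at a and [Jc b]. *)
Lemma killing_unitary_gen a b : killing (unitary_gen a b).
Proof.
have -> : unitary_gen a b = 1 *: plane_rot a + (1 *: plane_rot (Jc b) +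
    (-1) *: plane_rot (a + Jc b)).
  rewrite !scale1r scaleN1r /unitary_gen /plane_rot JcD JcJ.
  move: (Jc a) (Jc b) => c d.
  have DE (u w : E) i : (u + w) 0 i = u 0 i + w 0 i by rewrite [LHS]mxE.
  have NE (u : E) i : (- u) 0 i = - u 0 i by rewrite [LHS]mxE.
  have DM (A B : 'M[R]_n) i j : (A + B) i j = A i j + B i j by rewrite [LHS]mxE.
  have NM (A : 'M[R]_n) i j : (- A) i j = - A i j by rewrite [LHS]mxE.
  by apply/matrixP => i j; rewrite !(DM, NM, outer_entry, DE, NE); ring.
apply: killing_lincomb; first exact: killing_plane_rot.
apply: killing_lincomb; first exact: killing_plane_rot.
by apply: killingZ; exact: killing_plane_rot.
Qed.

(** The field p *m K integrates the derivative of the product <p, c> psi to zero. *)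
Lemma killing_ibp K psi c : killing K -> smoothS psi ->
  \int[nu]_(p in S) (dot p c * 'D_(p *m K) (ext psi) p) =
  - \int[nu]_(p in S) (dot (p *m K) c * psi p).
Proof.
move=> [tK HK] spsi; pose chi : E -> R^o := fun p => dot p c.
have schi : smoothS chi by apply: smoothS_dot smoothS_id (smoothS_cst c).
have := HK _ (smoothS_mul schi spsi).
have CK := Ck_dirderiv spsi (Ck_mul_id 0 K).
have Cchi : Ck 0 U0 (fun p : E => dot p c).
  exact: (Ck_dot open_neq0 (Ck_id _ open_neq0) (Ck_cst _ _ open_neq0)).
have CchiK : Ck 0 U0 (fun p : E => dot (p *m K) c).
  exact: (Ck_dot open_neq0 (Ck_mul_id 0 K) (Ck_cst _ _ open_neq0)).
rewrite (_ : \int[nu]_(p in S) _ = \int[nu]_(p in S) (dot (p *m K) c * ext psi p +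
    dot p c * 'D_(p *m K) (ext psi) p)); last first.
  apply: eq_Rintegral => p /set_mem Sp; rewrite (derive_ext_mul _ schi spsi Sp).
  have tpK : tangent p (p *m K).
    have := dot_mulmxl p K p; rewrite tK mulmxN dotNr dotC => H.
    by rewrite /tangent; lra.
  rewrite ext_sphere//; congr (_ * _ + _).
  rewrite (derive_ext_dot _ smoothS_id (smoothS_cst c) Sp).
  have -> : 'D_(p *m K) (ext (fun=> c)) p = 0 by rewrite derive_cst.
  rewrite dot0r addr0; congr (dot _ c).
  have e1 : (fun q : E => q *m 1%:M) = id by apply/funext => q; rewrite mulmx1.
  by have := derive_ext_mulmx 1%:M Sp tpK; rewrite e1 mulmx1.
rewrite (integral_Ck0D (Ck_mul open_neq0 CchiK (spsi 0)) (Ck_mul open_neq0 Cchi CK)).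
rewrite addrC => /eqP; rewrite addr_eq0 => /eqP ->; congr (- _).
by apply: eq_Rintegral => p /set_mem Sp; rewrite ext_sphere.
Qed.

Definition hproj p b : E := b - dot b p *: p - dot b (hopf p) *: hopf p.

Lemma Ck_hproj k b : Ck k U0 (fun p => hproj p b).
Proof.
have Cid : Ck k U0 (id : E -> E) by exact: Ck_id open_neq0.
have Ch : Ck k U0 (fun p : E => hopf p).
  apply: (@eq_Ck _ _ _ _ _ (fun p => p *m Jmx m) _ open_neq0).
    by move=> p _; rewrite /hopf JcE.
  exact: (Ck_mulmx open_neq0 Cid (Ck_cst _ _ open_neq0)).
have Cb : Ck k U0 (fun _ : E => b) by exact: Ck_cst open_neq0.
apply: (Ck_subv open_neq0).
  by apply: (Ck_subv open_neq0 Cb); exact: (Ck_scalemx open_neq0 (Ck_dot open_neq0 Cb Cid) Cid).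
exact: (Ck_scalemx open_neq0 (Ck_dot open_neq0 Cb Ch) Ch).
Qed.

(** Contracting the unitary generators with p gives a tangent vector with the right horizontal part
    but vertical component 2 <b, V>; the multiple of the Hopf generator removes it. Horizontal
    projections of constant vectors thus become combinations of Killing fields with linear
    coefficients. *)
Lemma hprojE p b : sphere p -> hproj p b =
  \sum_(i < n) dot p (delta_mx 0 i) *: (p *m unitary_gen (delta_mx 0 i) b) +
  (- 2 * dot b (hopf p)) *: (p *m Jmx m).
Proof.
move=> Sp.
have dE (u : E) i : dot u (delta_mx 0 i) = u 0 i.
  rewrite dotE (bigD1 i)//= mxE !eqxx mulr1 big1 ?addr0// => j ji.
  by rewrite mxE eqxx (negbTE ji) mulr0.
have sumE (u v : E) : \sum_(i < n) (dot u (delta_mx 0 i) * dot v (delta_mx 0 i)) = dot u v.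
  by rewrite dotE; apply: eq_bigr => i _; rewrite !dE.
have sumV (u : E) : \sum_(i < n) dot u (delta_mx 0 i) *: (delta_mx 0 i : E) = u.
  by rewrite [RHS]row_sum_delta; apply: eq_bigr => i _; rewrite dE.
have -> : \sum_(i < n) dot p (delta_mx 0 i) *: (p *m unitary_gen (delta_mx 0 i) b) =
    b - dot p b *: p + dot b (hopf p) *: hopf p.
  transitivity (\sum_(i < n) ((dot p (delta_mx 0 i) * dot p (delta_mx 0 i)) *: b -
     dot p b *: (dot p (delta_mx 0 i) *: (delta_mx 0 i : E)) +
     (- (dot p (delta_mx 0 i) * dot (Jc p) (delta_mx 0 i))) *: Jc b +
     dot b (hopf p) *: (dot p (delta_mx 0 i) *: (delta_mx 0 i : E) *m Jmx m))).
    apply: eq_bigr => i _; rewrite /unitary_gen !(mulmxDr, mulmxN) !mulmx_outer.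
    have -> : dot p (Jc (delta_mx 0 i)) = - dot (Jc p) (delta_mx 0 i).
      by rewrite dot_Jcl opprK.
    have -> : dot p (Jc b) = - dot b (hopf p) by rewrite -[LHS]opprK -dot_Jcl dotC.
    rewrite -scalemxAl -JcE; move: (Jc _) (Jc b) (dot _ _) (dot _ _) (dot _ _) (dot _ _).
    move: (delta_mx 0 i : E) => e e' b' x y z w.
    have DE (u v : E) l : (u + v) 0 l = u 0 l + v 0 l by rewrite [LHS]mxE.
    have NE (u : E) l : (- u) 0 l = - u 0 l by rewrite [LHS]mxE.
    have ZE a (u : E) l : (a *: u) 0 l = a * u 0 l by rewrite [LHS]mxE.
    by apply/rowP => j; rewrite !(DE, NE, ZE); ring.
  rewrite !big_split/= -!scaler_suml -!scaler_sumr sumrN sumE Sp scale1r.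
  rewrite -scaler_sumr sumV -mulmx_suml sumV.
  have -> : \sum_(i < n) - (dot p (delta_mx 0 i) * dot (Jc p) (delta_mx 0 i)) = 0.
    by rewrite sumrN sumE dot_Jc_self oppr0.
  by rewrite scale0r addr0 /hopf JcE.
rewrite /hproj (dotC p) /hopf -JcE.
move: (Jc p) (dot b p) (dot b (Jc p)) => q x y.
have DE (u v : E) l : (u + v) 0 l = u 0 l + v 0 l by rewrite [LHS]mxE.
have NE (u : E) l : (- u) 0 l = - u 0 l by rewrite [LHS]mxE.
have ZE a (u : E) l : (a *: u) 0 l = a * u 0 l by rewrite [LHS]mxE.
by apply/rowP => j; rewrite !(DE, NE, ZE); ring.
Qed.

(** The field [hproj _ b] has divergence - 2 m <p, b>. In the constant 2 m, the trace of the unitary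
    generators contributes the real dimension 2 m + 2 and the Hopf generator contributes - 2. *)
Lemma horizontal_ibp psi b : smoothS psi ->
  \int[nu]_(p in S) 'D_(hproj p b) (ext psi) p =
  (2 * m)%:R * \int[nu]_(p in S) (dot p b * psi p).
Proof.
move=> spsi.
have Cd (c : E) : Ck 0 U0 (fun p : E => dot p c).
  exact: (Ck_dot open_neq0 (Ck_id _ open_neq0) (Ck_cst _ _ open_neq0)).
have CD K := Ck_dirderiv spsi (Ck_mul_id 0 K).
have intext (f : E -> R) : \int[nu]_(p in S) (f p * psi p) = \int[nu]_(p in S) (f p * ext psi p).
  by apply: eq_Rintegral => p /set_mem Sp; rewrite ext_sphere.
transitivity (\int[nu]_(p in S)
   (\sum_(i < n) dot p (delta_mx 0 i) * 'D_(p *m unitary_gen (delta_mx 0 i) b) (ext psi) p +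
    2 * (dot p (Jc b) * 'D_(p *m Jmx m) (ext psi) p))).
  apply: eq_Rintegral => p /set_mem Sp; rewrite hprojE//.
  have dp := smoothS_differentiable spsi (sphere_neq0 Sp).
  rewrite addrC derive_lincomb// derive_sumdir// addrC; congr (_ + _).
  by rewrite /GRing.scale/= -[dot b _]opprK /hopf -dot_Jcl dotC; ring.
have C1 i : Ck 0 U0 (fun p : E => dot p (delta_mx 0 i) *
   'D_(p *m unitary_gen (delta_mx 0 i) b) (ext psi) p).
  exact: (Ck_mul open_neq0 (Cd _) (CD _)).
have C2 : Ck 0 U0 (fun p : E => dot p (Jc b) * 'D_(p *m Jmx m) (ext psi) p).
  exact: (Ck_mul open_neq0 (Cd _) (CD _)).
rewrite integral_Ck0D; last 2 first.
- exact: (@Ck_sum R E R 0 U0 _ (index_enum 'I_n) xpredT (fun i p => dot p (delta_mx 0 i) *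
   'D_(p *m unitary_gen (delta_mx 0 i) b) (ext psi) p) open_neq0 (fun i _ => C1 i)).
- exact: (Ck_mul open_neq0 (Ck_cst 0 (2 : R) open_neq0) C2).
rewrite integral_Ck0_sum// (integral_Ck0Z _ C2).
rewrite (killing_ibp _ killing_J spsi).
under eq_bigr do rewrite (killing_ibp _ (killing_unitary_gen _ _) spsi) intext.
rewrite !intext sumrN -integral_Ck0_sum; last first.
  move=> i; apply: (Ck_mul open_neq0 _ (spsi 0)).
  exact: (Ck_dot open_neq0 (Ck_mul_id 0 _) (Ck_cst _ _ open_neq0)).
have trace p : \sum_(i < n) (dot (p *m unitary_gen (delta_mx 0 i) b) (delta_mx 0 i)) =
    - n%:R * dot p b.
  have sumE (u v : E) : \sum_(i < n) (dot u (delta_mx 0 i) * dot v (delta_mx 0 i)) = dot u v.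
    have dE (w : E) i : dot w (delta_mx 0 i) = w 0 i.
      rewrite dotE (bigD1 i)//= mxE !eqxx mulr1 big1 ?addr0// => j ji.
      by rewrite mxE eqxx (negbTE ji) mulr0.
    by rewrite dotE; apply: eq_bigr => i _; rewrite !dE.
  transitivity (\sum_(i < n) (dot p (delta_mx 0 i) * dot b (delta_mx 0 i) - dot p b
    - dot (Jc p) (delta_mx 0 i) * dot (Jc b) (delta_mx 0 i))).
    apply: eq_bigr => i _; rewrite /unitary_gen !(mulmxDr, mulmxN) !mulmx_outer.
    have -> : dot p (Jc (delta_mx 0 i)) = - dot (Jc p) (delta_mx 0 i).
      by rewrite dot_Jcl opprK.
    rewrite !(dotDl, dotNl, dotZl) (dotC (Jc (delta_mx 0 i))) dot_Jc_self.
    have e1 : dot (delta_mx 0 i : E) (delta_mx 0 i) = 1.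
      by rewrite dotE (bigD1 i)//= mxE !eqxx mulr1 big1 ?addr0// => j ji;
        rewrite mxE eqxx (negbTE ji) mulr0.
    by rewrite e1; ring.
  rewrite !sumrB !sumE dot_JcJ sumr_const card_ord -mulr_natl; ring.
have C3 : Ck 0 U0 (fun p : E => dot p b * ext psi p).
  exact: (Ck_mul open_neq0 (Cd b) (spsi 0)).
have -> : \int[nu]_(p in S) (dot (p *m Jmx m) (Jc b) * ext psi p) =
    \int[nu]_(p in S) (dot p b * ext psi p).
  by apply: eq_Rintegral => p _; rewrite -JcE dot_JcJ.
have -> : \int[nu]_(p in S) (\sum_(i < n) dot (p *m unitary_gen (delta_mx 0 i) b) (delta_mx 0 i) *
    ext psi p) = \int[nu]_(p in S) (- n%:R * (dot p b * ext psi p)).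
  by apply: eq_Rintegral => p _; rewrite -mulr_suml trace mulrA.
rewrite (integral_Ck0Z _ C3) -mulNr opprK mulrN -mulrBl; congr (_ * _).
rewrite (_ : (m.+1 + m.+1)%N = (2 * m + 2)%N) ?natrD ?addrK//.
by rewrite mul2n addnn doubleS addn2.
Qed.

End IBP.

(** * The Levi-Civita connection of the Berger metric *)

Section LeviCivita.
Context {R : realType} {m : nat}.
Local Notation n := (m.+1 + m.+1)%N.
Local Notation E := 'rV[R]_n.
Implicit Types (p u w x : E) (X Y Z : E -> E).
Variable (mu : R).

Definition horizontal_mx p : 'M[R]_n := 1%:M - outer p p - outer (hopf p) (hopf p).

Definition nabla_mx p x (D : 'M[R]_n) : 'M[R]_n :=
  D + outer x p + (mu - 1) *: (dot x (hopf p) *: (horizontal_mx p *m Jmx m) +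
    outer (hopf p) (x *m horizontal_mx p *m Jmx m)).

Definition grad_mx X p : 'M[R]_n :=
  \matrix_(i, j) ('D_(delta_mx 0 i) (ext X) p) 0 j.

Lemma grad_mxE X p u : smoothS X -> p != 0 -> u *m grad_mx X p = 'D_u (ext X) p.
Proof.
move=> sX p0; rewrite derive_basis; last exact: smoothS_differentiable.
rewrite {1}[u]row_sum_delta mulmx_suml; apply: eq_bigr => i _.
by rewrite -scalemxAl -rowE; congr (_ *: _); apply/rowP => j; rewrite !mxE.
Qed.

Lemma horizontal_tangent p u : tangent p u ->
  u *m horizontal_mx p *m Jmx m = Jc u + dot u (hopf p) *: p.
Proof.
move=> pu; rewrite /horizontal_mx !mulmxBr mulmx1 !mulmx_outer (dotC u p) pu scale0r subr0.
by rewrite mulmxBl -scalemxAl -!JcE JcJ scalerN opprK.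
Qed.

Lemma nabla_mxE p x D u : tangent p u -> tangent p x ->
  u *m nabla_mx p x D = u *m D + dot u x *: p +
    (mu - 1) *: (dot x (hopf p) *: (Jc u + dot u (hopf p) *: p) +
                 dot u (hopf p) *: (Jc x + dot x (hopf p) *: p)).
Proof.
move=> pu px; have := horizontal_tangent px; have := horizontal_tangent pu.
rewrite /nabla_mx; move: (horizontal_mx p) => H <- <-.
by rewrite !mulmxDr -scalemxAr mulmxDr -scalemxAr !mulmx_outer mulmxA.
Qed.

Lemma smoothS_hopf : smoothS (fun p : E => hopf p).
Proof.
have -> : (fun p : E => hopf p) = fun p => p *m Jmx m by apply/funext => p; exact: JcE.
exact: smoothS_mulmx.
Qed.

Lemma derive_hopf p u : sphere p -> tangent p u ->
  'D_u (ext (fun p : E => hopf p)) p = Jc u.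
Proof.
move=> Sp pu.
have -> : (fun p : E => hopf p) = fun p => p *m Jmx m by apply/funext => q; exact: JcE.
by rewrite derive_ext_mulmx// JcE.
Qed.

Lemma near_ext (W : normedModType R) (f g : E -> W) p : sphere p ->
  (forall q, sphere q -> f q = g q) -> {near p, ext f =1 ext g}.
Proof.
move=> Sp fg; have := open_nbhs_nbhs (conj (@open_neq0 R n) (sphere_neq0 Sp)).
by apply: filterS => x /= x0; exact: ext_congr.
Qed.

Lemma vfield_deriv_normal X p u : vfield X -> sphere p -> tangent p u ->
  dot ('D_u (ext X) p) p = - dot u (X p).
Proof.
move=> [sX tX] Sp pu.
have h : {near p, ext (fun q => dot (X q) q : R^o) =1 ext (fun=> 0 : R^o)}.
  by apply: near_ext => // q Sq; rewrite dotC; exact: tX.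
have := derive_ext_dot u sX (@smoothS_id R n) Sp.
rewrite (near_eq_derive _ h) derive_cst.
have e1 : (fun q : E => q *m 1%:M) = id by apply/funext => q; rewrite mulmx1.
have := derive_ext_mulmx 1%:M Sp pu; rewrite e1 mulmx1 => -> H.
by rewrite (dotC u); lra.
Qed.

Lemma nabla_mx_tangent X p u : vfield X -> sphere p -> tangent p u ->
  tangent p (u *m nabla_mx p (X p) (grad_mx X p)).
Proof.
move=> vX Sp pu; have px := vX.2 p Sp; have p0 := sphere_neq0 Sp.
rewrite nabla_mxE// (grad_mxE _ vX.1 p0) /tangent dotC !(dotDl, dotZl).
rewrite vfield_deriv_normal// Sp !dot_Jcl -/(hopf p); ring.
Qed.

Lemma berger_nabla_mx X Y p u : vfield X -> vfield Y -> sphere p -> tangent p u ->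
  berger mu p (u *m nabla_mx p (X p) (grad_mx X p)) (Y p) =
  dot ('D_u (ext X) p) (Y p) + (mu - 1) * (dot (X p) (hopf p) * dot (Jc u) (Y p) +
    dot u (hopf p) * dot (Jc (X p)) (Y p) + dot ('D_u (ext X) p) (hopf p) * dot (Y p) (hopf p)).
Proof.
move=> vX vY Sp pu; have px := vX.2 p Sp; have py := vY.2 p Sp; have p0 := sphere_neq0 Sp.
rewrite bergerE// nabla_mxE// (grad_mxE _ vX.1 p0) !(dotDl, dotZl).
have tangentC v : tangent p v -> dot v p = 0 by rewrite dotC.
have -> : dot p (Y p) = 0 by [].
have -> : dot p (hopf p) = 0 by exact: tangent_hopf.
rewrite {3 5}/hopf !dot_JcJ (tangentC u)// (tangentC (X p))//.
ring.
Qed.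

Lemma nabla_mx_metric X Y p u : vfield X -> vfield Y -> sphere p -> tangent p u ->
  'D_u (ext (fun q => berger mu q (X q) (Y q) : R^o)) p =
  berger mu p (u *m nabla_mx p (X p) (grad_mx X p)) (Y p) +
  berger mu p (X p) (u *m nabla_mx p (Y p) (grad_mx Y p)).
Proof.
move=> vX vY Sp pu; have [sX tX] := vX; have [sY tY] := vY.
have bC a b : berger mu p a b = berger mu p b a by rewrite !bergerE// dotC; ring.
rewrite (bC (X p)) !berger_nabla_mx//.
pose f : E -> R^o := fun q => dot (X q) (Y q).
pose g : E -> R^o := fun q => dot (X q) (hopf q).
pose h : E -> R^o := fun q => dot (Y q) (hopf q).
have sf : smoothS f := smoothS_dot sX sY.
have sg : smoothS g := smoothS_dot sX smoothS_hopf.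
have sh : smoothS h := smoothS_dot sY smoothS_hopf.
have sgh : smoothS (fun q => g q * h q : R^o) := smoothS_mul sg sh.
have p0 := sphere_neq0 Sp.
have E0 : {near p, ext (fun q => berger mu q (X q) (Y q) : R^o) =1
    ext (fun q => (mu - 1) *: (g q * h q : R^o) + f q)}.
  by apply: near_ext => // q Sq; rewrite bergerE// addrC.
rewrite (near_eq_derive _ E0).
have [_ ->] := is_deriveD (is_deriveZ (mu - 1) (is_derive_smoothS u sgh p0)) (is_derive_smoothS u sf p0).
rewrite derive_ext_mul// !derive_ext_dot// ?derive_hopf//; try exact: smoothS_hopf.
rewrite /GRing.scale/= /g /h !(dotC (Jc (Y p))) (dotC (Jc u)) (dotC (Jc u)).
rewrite -[dot (Jc (X p)) (Y p)]opprK dot_Jcl opprK (dotC (X p) ('D_u _ _)).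
ring.
Qed.

Lemma nabla_mx_torsion X Y p : vfield X -> vfield Y -> sphere p ->
  X p *m nabla_mx p (Y p) (grad_mx Y p) - Y p *m nabla_mx p (X p) (grad_mx X p) =
  lie_bracket X Y p.
Proof.
move=> vX vY Sp; have px := vX.2 p Sp; have py := vY.2 p Sp; have p0 := sphere_neq0 Sp.
rewrite !nabla_mxE// (grad_mxE _ vX.1 p0) (grad_mxE _ vY.1 p0) /lie_bracket.
rewrite (dotC (Y p) (X p)); move: (dot (X p) (Y p)) (dot (X p) _) (dot (Y p) _) => a b c.
move: (Jc (X p)) (Jc (Y p)) ('D_(X p) _ p) ('D_(Y p) _ p) => d e f g.
by apply/rowP => j; rewrite !mxE; ring.
Qed.

(** Extends a tangent vector at a point to a global field, since the metric and torsion axioms of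
    [levi_civita] speak of fields. *)
Definition tangent_field w : E -> E := fun q => w - dot w q *: q.

Lemma vfield_tangent_field w : vfield (tangent_field w).
Proof.
split.
  apply: smoothS_subv; first exact: smoothS_cst.
  by apply: smoothS_scale (@smoothS_id R n); exact: smoothS_dot (smoothS_cst w) (@smoothS_id R n).
by move=> p Sp; rewrite /tangent dotBr dotZr Sp (dotC p) mulr1 subrr.
Qed.

Lemma tangent_fieldE w p : tangent p w -> tangent_field w p = w.
Proof. by move=> pw; rewrite /tangent_field dotC pw scale0r subr0. Qed.

Lemma berger_nondeg p w : mu != 0 -> sphere p -> tangent p w ->
  (forall Y, vfield Y -> berger mu p w (Y p) = 0) -> w = 0.
Proof.
move=> mu0 Sp pw H.
have wv : dot w (hopf p) = 0.
  have := H _ (vfield_tangent_field (hopf p)).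
  rewrite tangent_fieldE; last exact: tangent_hopf.
  rewrite bergerE// sphere_hopf// mulr1 -[X in X + _]mul1r -mulrDl addrC subrK => /eqP.
  by rewrite mulf_eq0 (negbTE mu0) => /eqP.
have := H _ (vfield_tangent_field w); rewrite tangent_fieldE// bergerE// wv mul0r mulr0 addr0.
by move/eqP; rewrite dot_eq0 => /eqP.
Qed.

(** Uniqueness in the fundamental lemma of Riemannian geometry. [nabla_mx] is metric and
    torsion-free; the difference with nabla, lowered by the metric, is skew in its last two
    arguments and symmetric in its first two. Six alternations of these rules give S = - S, and
    nondegeneracy (mu nonzero) concludes. *)
Lemma levi_civitaE (nabla : (E -> E) -> E -> E -> E) X p u : mu != 0 ->
  levi_civita (berger mu) nabla -> vfield X -> sphere p -> tangent p u ->
  nabla X p u = u *m nabla_mx p (X p) (grad_mx X p).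
Proof.
move=> mu0 LC vX Sp pu.
pose N X u := u *m nabla_mx p (X p) (grad_mx X p).
pose T X Z := nabla X p (Z p) - N X (Z p).
have bB a b c : berger mu p (a - b) c = berger mu p a c - berger mu p b c.
  by rewrite !bergerE// !dotBl; ring.
have bC a b : berger mu p a b = berger mu p b a by rewrite !bergerE// dotC; ring.
pose S Z X Y := berger mu p (T X Z) (Y p).
have skew Z A B : vfield A -> vfield B -> vfield Z -> S Z A B = - S Z B A.
  move=> vA vB vZ; rewrite /S /T !bB.
  have := lc_metric LC vA vB Sp (vZ.2 p Sp).
  rewrite (nabla_mx_metric vA vB Sp (vZ.2 p Sp)) !(bC (A p)) -/(N A (Z p)) -/(N B (Z p)).
  move=> ?; lra.
have sym A B : vfield A -> vfield B -> T A B = T B A.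
  move=> vA vB; have := lc_torsion_free LC vA vB Sp.
  rewrite -(nabla_mx_torsion vA vB Sp) -/(N B (A p)) -/(N A (B p)) /T.
  move=> H; apply/eqP; rewrite subr_eq -subr_eq0; apply/eqP.
  have -> : nabla B p (A p) = nabla A p (B p) + (N B (A p) - N A (B p)).
    by rewrite -H addrC subrK.
  by apply/rowP => j; rewrite !mxE; ring.
have symS Z A B : vfield A -> vfield Z -> S Z A B = S A Z B.
  by move=> vA vZ; rewrite /S sym.
pose U := tangent_field u; have vU : vfield U := vfield_tangent_field u.
have TU : T X U = 0.
  apply: (berger_nondeg mu0 Sp).
    rewrite /T /tangent dotBr; have := (lc_vfield LC vX vU).2 p Sp; rewrite /tangent => ->.
    by have := nabla_mx_tangent vX Sp (vU.2 p Sp); rewrite /tangent => ->; rewrite subr0.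
  move=> Y vY.
  suff : S U X Y = - S U X Y by move=> H; rewrite -[LHS]/(S U X Y); lra.
  have e1 := skew U X Y vX vY vU; have e2 := symS U Y X vY vU.
  have e3 := skew Y U X vU vX vY; have e4 := symS Y X U vX vY.
  have e5 := skew X Y U vY vU vX; have e6 := symS X U Y vU vX.
  move: e1 e2 e3 e4 e5 e6; clearbody S; move: (S U X Y) (S U Y X) (S Y U X) (S Y X U) (S X Y U) (S X U Y).
  by move=> *; lra.
by have := TU; rewrite /T /U tangent_fieldE// => /eqP; rewrite subr_eq0 => /eqP.
Qed.

End LeviCivita.

(** * Pointwise algebra of the energy and volume densities *)

Section PointwiseAlgebra.
Context {R : realType} {m : nat}.
Local Notation n := (m.+1 + m.+1)%N.
Local Notation E := 'rV[R]_n.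
Variables (mu : R) (p : E).
Hypotheses (mu0 : mu != 0) (Sp : sphere p).

Local Notation J := (Jmx m).
Local Notation v := (hopf p).
Local Notation P := (horizontal_mx p).
Local Notation G := (berger_mx mu p).
Local Notation Q l := (inv_berger l p).

Lemma tr_horizontal_mx : P^T = P.
Proof. by rewrite /horizontal_mx !linearB/= trmx1 !tr_outer. Qed.

Lemma hopf_horizontal : v *m P = 0.
Proof.
rewrite /horizontal_mx !mulmxBr mulmx1 !mulmx_outer sphere_hopf// scale1r.
by rewrite (dotC v) tangent_hopf scale0r subr0 subrr.
Qed.

Lemma normal_horizontal : p *m P = 0.
Proof.
rewrite /horizontal_mx !mulmxBr mulmx1 !mulmx_outer Sp scale1r.
by rewrite tangent_hopf scale0r subrr subr0.
Qed.

Lemma outer_horizontal : outer v v *m P = 0.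
Proof. by rewrite outer_mulmx hopf_horizontal /outer mulmx0. Qed.

Lemma horizontal_outer : P *m outer v v = 0.
Proof.
rewrite /outer mulmxA -[P *m _]trmxK trmx_mul trmxK tr_horizontal_mx.
by rewrite hopf_horizontal trmx0 mul0mx.
Qed.

Lemma horizontal_idem : P *m P = P.
Proof.
rewrite {1}/horizontal_mx !mulmxBl mul1mx !outer_mulmx normal_horizontal hopf_horizontal.
by rewrite /outer !mulmx0 !subr0.
Qed.

Lemma horizontal_J : P *m J = J *m P.
Proof.
rewrite /horizontal_mx !(mulmxBl, mulmxBr) mul1mx mulmx1 !outer_Jmx !Jmx_outer.
by rewrite JcJ outerNl outerNr !opprK -!addrA; congr (_ + _); rewrite addrC.
Qed.

Lemma inv_bergerE l : Q l = P + l^-1 *: outer v v.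
Proof. by rewrite /inv_berger /horizontal_mx scalerBl scale1r -[RHS]addrA [- _ + _]addrC. Qed.

Lemma mxtrace_outer (u w : E) : \tr (outer u w) = dot u w.
Proof. by rewrite /outer mxtrace_mulC trace_mx11 dotC. Qed.

Lemma mxtrace_horizontal : \tr P = (2 * m)%:R.
Proof.
rewrite /horizontal_mx !raddfB/= mxtrace1 !mxtrace_outer Sp sphere_hopf//.
rewrite (_ : (m.+1 + m.+1)%N = (2 * m + 2)%N) ?natrD; first by ring.
by rewrite mul2n addnn doubleS addn2.
Qed.

Lemma horizontal_berger : P *m G = P.
Proof. by rewrite /berger_mx mulmxDr mulmx1 -scalemxAr horizontal_outer scaler0 addr0. Qed.

Lemma berger_horizontal : G *m P = P.
Proof. by rewrite /berger_mx mulmxDl mul1mx -scalemxAl outer_horizontal scaler0 addr0. Qed.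

Lemma horizontal_inv l : P *m Q l = P.
Proof. by rewrite inv_bergerE mulmxDr -scalemxAr horizontal_idem horizontal_outer scaler0 addr0. Qed.

Lemma inv_horizontal l : Q l *m P = P.
Proof. by rewrite inv_bergerE mulmxDl -scalemxAl horizontal_idem outer_horizontal scaler0 addr0. Qed.

Definition hopf_nabla : 'M[R]_n := ((Num.sqrt `|mu|)^-1 * mu) *: (P *m J).
Local Notation N0 := hopf_nabla.
Local Notation c := ((Num.sqrt `|mu|)^-1 * mu).

Lemma hopf_nabla_coef : c ^+ 2 = `|mu|.
Proof.
rewrite exprMn exprVn sqr_sqrtr// -(real_normK (num_real mu)) expr2 mulrA mulVf ?mul1r//.
by rewrite normr_eq0.
Qed.

Lemma tr_hopf_nabla : N0^T = - N0.
Proof.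
by rewrite /hopf_nabla linearZ/= trmx_mul tr_Jmx tr_horizontal_mx mulNmx -horizontal_J scalerN.
Qed.

Lemma hopf_nabla_P : N0 *m P = N0 /\ P *m N0 = N0.
Proof.
rewrite /hopf_nabla -scalemxAl -scalemxAr mulmxA horizontal_idem; split=> //.
by rewrite -mulmxA -horizontal_J mulmxA horizontal_idem.
Qed.

Lemma hopf_nabla_sqr : N0 *m N0^T = `|mu| *: P.
Proof.
rewrite tr_hopf_nabla /hopf_nabla mulmxN -scalemxAl -scalemxAr scalerA -expr2 hopf_nabla_coef.
rewrite mulmxA -(mulmxA P J P) -horizontal_J mulmxA horizontal_idem -mulmxA Jmx_sqr.
by rewrite mulmxN mulmx1 scalerN opprK.
Qed.

Lemma hopf_nabla_absorb (X : 'M[R]_n) : (P *m X = P -> N0 *m X = N0) /\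
  (X *m P = P -> X *m N0 = N0).
Proof.
have [h1 h2] := hopf_nabla_P.
by split=> e; [rewrite -h1 -mulmxA e|rewrite -h2 mulmxA e].
Qed.

Lemma hopf_nabla_kill : v *m N0 = 0.
Proof. by rewrite /hopf_nabla -scalemxAr mulmxA hopf_horizontal mul0mx scaler0. Qed.

Lemma hopf_nabla_expand (M : 'M[R]_n) :
  (N0 + M) *m G *m (N0 + M)^T =
  `|mu| *: P + (N0 *m M^T + M *m N0^T + M *m G *m M^T).
Proof.
have N0G : N0 *m G = N0 by apply: (hopf_nabla_absorb _).1; exact: horizontal_berger.
have GN0 : G *m N0 = N0 by apply: (hopf_nabla_absorb _).2; exact: berger_horizontal.
rewrite -hopf_nabla_sqr tr_hopf_nabla; have -> : (N0 + M)^T = - N0 + M^T.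
  by rewrite linearD/= tr_hopf_nabla.
move: N0 (berger_mx mu p) N0G GN0 => N G' N0G GN0.
rewrite (mulmxDl N M G') N0G mulmxDl !mulmxDr -(mulmxA M G' (- N)) (mulmxN G') GN0.
by rewrite -!addrA; congr (_ + _); rewrite addrCA addrA.
Qed.

(** [hopf_nabla] is horizontal, where [inv_berger l p] is the identity. Hence the term linear in M
    is the same for every l, and among the terms in M only the quadratic one sees l. *)
Lemma energy_density l (M : 'M[R]_n) :
  \tr ((G + (N0 + M) *m G *m (N0 + M)^T) *m Q l) =
  (\tr (G *m Q l) + `|mu| * (2 * m)%:R) +
  (2 * \tr (M *m N0^T) + \tr (M *m G *m M^T *m Q l)).
Proof.
have N0Q : N0 *m Q l = N0 by apply: (hopf_nabla_absorb _).1; exact: horizontal_inv.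
have QT := tr_inv_berger l p.
have e3 : \tr (`|mu| *: P *m Q l) = `|mu| * (2 * m)%:R.
  by rewrite -scalemxAl horizontal_inv mxtraceZ mxtrace_horizontal.
rewrite hopf_nabla_expand.
have e1 : \tr (M *m N0^T *m Q l) = \tr (M *m N0^T).
  by rewrite -mulmxA tr_hopf_nabla mulNmx N0Q.
have e2 : \tr (N0 *m M^T *m Q l) = \tr (M *m N0^T).
  by rewrite -mxtrace_tr !trmx_mul trmxK QT mxtrace_mulC -mulmxA tr_hopf_nabla mulNmx N0Q.
move: e1 e2 e3; move: (inv_berger l p) (berger_mx mu p) (`|mu| *: P) N0.
by move=> Q' G' X N e1 e2 e3; rewrite !mulmxDl !mxtraceD e1 e2 e3; ring.
Qed.

Local Notation al := (1 + `|mu|).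

(** Inverse of 1 + |mu| P, which on the tangent space is the endomorphism L of the Hopf field. *)
Definition hopf_resolvent : 'M[R]_n := 1%:M - P + al^-1 *: P.
Local Notation Rv := hopf_resolvent.

Lemma alpha_gt0 : 0 < al. Proof. by rewrite ltr_pwDl. Qed.

Lemma hopf_resolvent_inv : (1%:M + `|mu| *: P) *m Rv = 1%:M.
Proof.
have a0 : al != 0 by rewrite gt_eqF// alpha_gt0.
rewrite /hopf_resolvent mulmxDl mul1mx -scalemxAl mulmxDr mulmxBr mulmx1 horizontal_idem.
rewrite subrr add0r -scalemxAr horizontal_idem scalerA -addrA -scalerDl.
have -> : al^-1 + `|mu| * al^-1 = 1 by field.
by rewrite scale1r subrK.
Qed.

(** The value is (1 + |mu|)^(2 m), one factor for each horizontal direction. Once the scalar is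
    factored out of the ambient matrix, the remaining perturbation has rank two, carried by p and V,
    and Sylvester's identity reduces it to a 2 x 2 determinant. *)
Lemma det_hopf : \det (1%:M + `|mu| *: P) = al ^+ n * (al ^- 2).
Proof.
have a0 : al != 0 by rewrite gt_eqF// alpha_gt0.
pose W : 'M[R]_(1 + 1, n) := col_mx p v.
have WW : W *m W^T = 1%:M.
  rewrite /W tr_col_mx mul_col_row [RHS]scalar_mx_block.
  have e (a b : E) : a *m b^T = (dot a b)%:M by rewrite [LHS]mx11_scalar.
  by rewrite !e Sp sphere_hopf// (dotC v) tangent_hopf raddf0.
have PW : P = 1%:M - W^T *m W.
  by rewrite /W tr_col_mx mul_row_col /horizontal_mx opprD addrA.
have -> : 1%:M + `|mu| *: P = al *: (1%:M + W^T *m (- (`|mu| / al) *: W)).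
  rewrite PW -scalemxAr; move: (W^T *m W) => X.
  by apply/matrixP => i j; rewrite !mxE; field.
rewrite detZ det_1DmulC -scalemxAl WW scalemx1 -raddfD/= det_scalar.
by congr (_ * _); rewrite -exprVn; congr (_ ^+ 2); field.
Qed.

(** What remains inside the determinant once its value at the Hopf field is factored out; it
    vanishes with M, so the expansion takes place at the identity matrix. *)
Definition hopf_perturbation (M : 'M[R]_n) : 'M[R]_n :=
  Rv *m ((N0 *m M^T + M *m N0^T + M *m G *m M^T) *m Q mu).

Lemma volume_density (M : 'M[R]_n) :
  \det (1%:M + (N0 + M) *m G *m (N0 + M)^T *m Q mu) =
  al ^+ n * (al ^- 2) * \det (1%:M + hopf_perturbation M).
Proof.
have e : (1%:M + `|mu| *: P) *m hopf_perturbation M =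
    (N0 *m M^T + M *m N0^T + M *m G *m M^T) *m Q mu.
  by rewrite /hopf_perturbation (mulmxA (1%:M + `|mu| *: P) Rv) hopf_resolvent_inv mul1mx.
rewrite hopf_nabla_expand -det_hopf -det_mulmx.
rewrite (mulmxDr (1%:M + `|mu| *: P) 1%:M) mulmx1 e (mulmxDl (`|mu| *: P)).
by rewrite -[(`|mu| *: P) *m _]scalemxAl horizontal_inv addrA.
Qed.

Lemma inv_resolvent : Q mu *m Rv = al^-1 *: P + mu^-1 *: outer v v.
Proof.
have QP := inv_horizontal mu; have QE := inv_bergerE mu.
rewrite /hopf_resolvent; move: (inv_berger mu p) (P) QP QE => Q' P' QP QE.
rewrite mulmxDr mulmxBr mulmx1 -scalemxAr QP QE.
by move: (mu^-1 *: _) (al^-1 *: P') => X Y; rewrite [P' + X]addrC addrK addrC.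
Qed.

(** Z is left free so that the statement serves both for the first-order part (Z = 0) and for the
    second-order part, where Z is quadratic in M. *)
Lemma trace_hopf_perturbation (M Z : 'M[R]_n) :
  \tr (Rv *m ((N0 *m M^T + M *m N0^T + Z) *m Q mu)) =
  2 * al^-1 * \tr (M *m N0^T) + \tr (Z *m (Q mu *m Rv)).
Proof.
rewrite mxtrace_mulC -(mulmxA _ (Q mu) Rv) inv_resolvent.
have N0W : N0 *m (al^-1 *: P + mu^-1 *: outer v v) = al^-1 *: N0.
  have [h1 _] := hopf_nabla_P.
  rewrite -[in LHS]h1 -mulmxA mulmxDr -!scalemxAr horizontal_idem horizontal_outer.
  by rewrite scaler0 addr0 -scalemxAr h1.
have trW : (al^-1 *: P + mu^-1 *: outer v v)^T = al^-1 *: P + mu^-1 *: outer v v.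
  by rewrite linearD/= !linearZ/= tr_horizontal_mx tr_outer.
move: (al^-1 *: P + mu^-1 *: outer v v) N0W trW => W N0W trW.
have e1 : \tr (M *m N0^T *m W) = al^-1 * \tr (M *m N0^T).
  by rewrite -mulmxA tr_hopf_nabla mulNmx N0W mulmxN -scalemxAr mulmxN !raddfN/= mxtraceZ mulrN.
have e2 : \tr (N0 *m M^T *m W) = al^-1 * \tr (M *m N0^T).
  by rewrite -e1 -mxtrace_tr !trmx_mul trmxK trW mxtrace_mulC -mulmxA.
move: e1 e2; move: (berger_mx mu p) N0 => G' N e1 e2.
by rewrite !(mulmxDl _ _ W) !mxtraceD e1 e2; ring.
Qed.

End PointwiseAlgebra.

(** * Second-order jets of curves *)

Section Jets.
Context {R : realType}.

(** First and second derivative at 0. The value at 0 is not part of the jet and reappears as [f 0]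
    in the product rule. *)
Definition jet2 (W : normedModType R) (d : R) (f : R -> W) (a b : W) : Prop :=
  exists f1 : R -> W, [/\ forall t, `|t| < d -> is_derive t (1 : R) f (f1 t),
    f1 0 = a & is_derive (0 : R) (1 : R) f1 b].

Lemma is_derive_mxtrace (V : normedModType R) n (f : V -> 'M[R]_n) (x v : V) df :
  is_derive x v f df -> is_derive x v (fun y => \tr (f y)) (\tr df).
Proof.
move=> Df; rewrite (_ : (fun y => _) = \sum_(i < n) (fun y => f y i i)).
  by apply: is_derive_sum => i; exact: is_derive_entry.
by apply/funext => y; rewrite fct_sumE.
Qed.

Lemma is_derive_mx (V : normedModType R) p q (f : V -> 'M[R]_(p, q)) (x v : V)
    (df : 'M[R]_(p, q)) :
  (forall i j, is_derive x v (fun y => f y i j : R) (df i j)) -> is_derive x v f df.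
Proof.
move=> H; have dv : derivable f x v by apply/derivable_mxP => a b; have [] := H a b.
apply: DeriveDef => //; rewrite derive_mx//; apply/matrixP => a b; rewrite mxE.
by have [_ ->] := H a b.
Qed.

(** Jacobi's formula. By linearity in H it suffices to perturb a single entry, and the determinant
    is affine in each entry with slope the cofactor. *)
Lemma derive_det n (B H : 'M[R]_n) :
  is_derive B H (fun A : 'M[R]_n => \det A : R) (\tr (H *m \adj B)).
Proof.
have dd : differentiable (fun A : 'M[R]_n => \det A : R) B.
  have [df _] : Ck 1 setT (fun A : 'M[R]_n => \det A : R).
    by apply: (Ck_det openT); exact: Ck_id openT.
  exact: df.
apply: DeriveDef; first exact: diff_derivable.
rewrite deriveE// {1}[H]matrix_sum_delta linear_sum/= /mxtrace.
apply: eq_bigr => i _; rewrite linear_sum mxE/=; apply: eq_bigr => j _.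
rewrite linearZ/= -deriveE//; congr (_ * _).
have cofE (h : R) l : cofactor (h *: delta_mx i j + B) i l = cofactor B i l.
  rewrite /cofactor; congr (_ * \det _).
  by apply/matrixP => a b; rewrite !mxE eq_sym (negbTE (neq_lift _ _)) mulr0 add0r.
have detE (h : R) : \det (h *: delta_mx i j + B) = h * cofactor B i j + \det B.
  rewrite (expand_det_row _ i) (expand_det_row B i).
  under eq_bigr do rewrite cofE !mxE eqxx/= mulrDl.
  rewrite big_split/=; congr (_ + _); rewrite (bigD1 j)//= eqxx mulr1 big1 ?addr0//.
  by move=> l lj; rewrite (negbTE lj) mulr0 mul0r.
rewrite mxE.
have hq (h : R) : \det (h *: delta_mx i j + B) - \det B
    = (h *: (1 : R) + 0) * cofactor B i j - 0 * cofactor B i j.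
  by rewrite detE [h *: 1]mulr1 addr0 mul0r subr0 addrK.
have [-> _] := @derive_quotient R R 'M[R]_n R (fun A => \det A)
  (fun h : R => h * cofactor B i j) B (delta_mx i j) 0 1 hq.
have [_ ->] : is_derive (0 : R) (1 : R) (fun h : R => h * cofactor B i j) (cofactor B i j).
  have := is_deriveM (is_derive_id (0 : R) (1 : R)) (is_derive_cst (cofactor B i j : R) (0 : R) (1 : R)).
  by rewrite scaler0 add0r [_ *: _]mulr1.
by [].
Qed.

Lemma is_derive_det n (B : R -> 'M[R]_n) (t : R) (B1 : 'M[R]_n) :
  is_derive t (1 : R) B B1 ->
  is_derive t (1 : R) (fun s => \det (B s)) (\tr (B1 *m \adj (B t))).
Proof.
move=> DB; have [_ <-] := derive_det (B t) B1.
apply: (@is_derive_curve R 'M[R]_n R (fun A => \det A) B t B1 DB).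
have [df _] : Ck 1 setT (fun A : 'M[R]_n => \det A : R).
  by apply: (Ck_det openT); exact: Ck_id openT.
exact: df.
Qed.

(** Minors are used for derivability only; the value comes from differentiating B *m \adj B = (\det
    B)%:M at a point where B is the identity. *)
Lemma is_derive_adjugate1 n (B : R -> 'M[R]_n) (t : R) (B1 : 'M[R]_n) :
  is_derive t (1 : R) B B1 -> B t = 1%:M ->
  is_derive t (1 : R) (fun s => \adj (B s)) ((\tr B1)%:M - B1).
Proof.
move=> DB Bt.
have dadj : derivable (fun s => \adj (B s)) t 1.
  apply/derivable_mxP => i j.
  rewrite (_ : (fun s => _) = (fun s => (-1) ^+ (j + i) * \det (row' j (col' i (B s))))); last first.
    by apply/funext => s; rewrite mxE.
  have Dsub : is_derive t (1 : R) (fun s => row' j (col' i (B s))) (row' j (col' i B1)).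
    apply: is_derive_mx => a b.
    rewrite (_ : (fun s => _) = (fun s => B s (lift j a) (lift i b))); last first.
      by apply/funext => s; rewrite !mxE.
    by rewrite !mxE; exact: is_derive_entry.
  by have [h _] := is_derive_det Dsub; apply: (@derivableM R R^o (cst _)) => //; exact: derivable_cst.
apply: DeriveDef => //.
have := is_derive_mulmx DB (derivableP dadj).
rewrite (_ : (fun y => _) = (fun s => (\det (B s))%:M)); last first.
  by apply/funext => s; rewrite mul_mx_adj.
rewrite Bt adj1 mulmx1 mul1mx => -[_] e1.
have De := is_derive_det DB.
have : is_derive t (1 : R) (fun s => (\det (B s))%:M : 'M[R]_n) ((\tr B1)%:M).
  apply: is_derive_mx => a b.
  rewrite (_ : (fun s => _) = (fun s => \det (B s)) * cst ((a == b)%:R)); last first.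
    by apply/funext => s; rewrite mxE; exact/esym/mulr_natr.
  have := is_deriveM De (is_derive_cst ((a == b)%:R : R) t (1 : R)).
  rewrite Bt adj1 mulmx1 /GRing.scale/= mulr0 add0r.
  by rewrite [X in is_derive _ _ _ X -> _]mulrC mulr_natr mxE.
by move=> [_]; rewrite e1 => <-; rewrite addrC addKr.
Qed.

Lemma jet2_cst (W : normedModType R) d (w : W) : jet2 d (fun=> w) 0 0.
Proof. by exists (fun=> 0); split=> // *; exact: is_derive_cst. Qed.

Lemma jet2_add (W : normedModType R) d (f g : R -> W) a b a' b' :
  jet2 d f a b -> jet2 d g a' b' -> jet2 d (fun t => f t + g t) (a + a') (b + b').
Proof.
move=> [f1 [h1 <- h3]] [g1 [k1 <- k3]]; exists (fun t => f1 t + g1 t).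
by split=> // [t td|]; [exact: is_deriveD (h1 t td) (k1 t td)|exact: is_deriveD h3 k3].
Qed.

Lemma jet2_scale d (f : R -> R) (c : R) a b :
  jet2 d f a b -> jet2 d (fun t => c * f t) (c * a) (c * b).
Proof.
move=> [f1 [h1 <- h3]]; exists (fun t => c * f1 t).
split=> // [t td|]; first by have := is_deriveZ c (h1 t td).
by have := is_deriveZ c h3.
Qed.

Lemma jet2_trmx d p q (f : R -> 'M[R]_(p, q)) a b :
  jet2 d f a b -> jet2 d (fun t => (f t)^T) a^T b^T.
Proof.
move=> [f1 [h1 <- h3]]; exists (fun t => (f1 t)^T).
by split=> // [t td|]; [exact: is_derive_trmx (h1 t td)|exact: is_derive_trmx h3].
Qed.

Lemma jet2_mxtrace d n (f : R -> 'M[R]_n) a b :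
  jet2 d f a b -> jet2 d (fun t => \tr (f t)) (\tr a) (\tr b).
Proof.
move=> [f1 [h1 <- h3]]; exists (fun t => \tr (f1 t)).
by split=> // [t td|]; [exact: is_derive_mxtrace (h1 t td)|exact: is_derive_mxtrace h3].
Qed.

Lemma jet2_mulmx d p q r (f : R -> 'M[R]_(p, q)) (g : R -> 'M[R]_(q, r)) a b a' b' :
  0 < d -> jet2 d f a b -> jet2 d g a' b' ->
  jet2 d (fun t => f t *m g t) (a *m g 0 + f 0 *m a')
    (b *m g 0 + a *m a' + (a *m a' + f 0 *m b')).
Proof.
move=> d0 [f1 [h1 <- h3]] [g1 [k1 <- k3]]; exists (fun t => f1 t *m g t + f t *m g1 t).
have z : `|0 : R| < d by rewrite normr0.
split=> // [t td|]; first exact: is_derive_mulmx (h1 t td) (k1 t td).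
exact: is_deriveD (is_derive_mulmx h3 (k1 0 z)) (is_derive_mulmx (h1 0 z) k3).
Qed.

Lemma jet2_mulmxl d p q r (f : R -> 'M[R]_(p, q)) (M : 'M[R]_(r, p)) a b :
  0 < d -> jet2 d f a b -> jet2 d (fun t => M *m f t) (M *m a) (M *m b).
Proof.
move=> d0 h; have := jet2_mulmx d0 (jet2_cst d M) h.
by rewrite !mul0mx !add0r.
Qed.

Lemma jet2_mulmxr d p q r (f : R -> 'M[R]_(p, q)) (M : 'M[R]_(q, r)) a b :
  0 < d -> jet2 d f a b -> jet2 d (fun t => f t *m M) (a *m M) (b *m M).
Proof.
move=> d0 h; have := jet2_mulmx d0 h (jet2_cst d M).
by rewrite !mulmx0 !addr0.
Qed.

(** Since f vanishes at 0, the first derivative is zero and the acceleration b drops out of the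
    second. *)
Lemma jet2_quad d p q r (f : R -> 'M[R]_(p, q)) (A : 'M[R]_q) (B : 'M[R]_(p, r)) a b :
  0 < d -> jet2 d f a b -> f 0 = 0 ->
  jet2 d (fun t => f t *m A *m (f t)^T *m B) 0 (a *m A *m a^T *m B + a *m A *m a^T *m B).
Proof.
move=> d0 h f0; have h1 := jet2_mulmx d0 (jet2_mulmxr A d0 h) (jet2_trmx h).
rewrite f0 trmx0 !mulmx0 !mul0mx !addr0 !add0r in h1.
by have := jet2_mulmxr B d0 h1; rewrite mul0mx mulmxDl.
Qed.

(** The expansion sqrt (det (1 + K)) = 1 + tr K / 2 + (tr K)^2 / 8 - tr (K^2) / 4 + ...,
    differentiated twice along K. *)
Lemma jet2_sqrt_det d n (K : R -> 'M[R]_n) a b :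
  0 < d -> jet2 d K a b -> K 0 = 0 -> (forall t, `|t| < d -> 0 < \det (1%:M + K t)) ->
  jet2 d (fun t => Num.sqrt (\det (1%:M + K t))) (2^-1 * \tr a)
    (2^-1 * \tr b + 4^-1 * (\tr a) ^+ 2 - 2^-1 * \tr (a *m a)).
Proof.
move=> d0 [K1 [h1 <- h3]] K0 dp; have z : `|0 : R| < d by rewrite normr0.
pose B t : 'M[R]_n := 1%:M + K t.
have DB t : `|t| < d -> is_derive t (1 : R) B (K1 t).
  by move=> td; have := is_deriveD (is_derive_cst (1%:M : 'M[R]_n) t (1 : R)) (h1 t td); rewrite add0r.
have B0 : B 0 = 1%:M by rewrite /B K0 addr0.
pose e t := \det (B t); pose e1 t := \tr (K1 t *m \adj (B t)).
have De t : `|t| < d -> is_derive t (1 : R) e (e1 t) by move=> td; apply: is_derive_det; exact: DB.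
have e0 : e 0 = 1 by rewrite /e B0 det1.
have e10 : e1 0 = \tr (K1 0) by rewrite /e1 B0 adj1 mulmx1.
have De1 : is_derive (0 : R) (1 : R) e1 (\tr b + (\tr (K1 0)) ^+ 2 - \tr (K1 0 *m K1 0)).
  have := is_derive_mxtrace (is_derive_mulmx h3 (is_derive_adjugate1 (DB 0 z) B0)).
  rewrite B0 adj1 mulmx1 mulmxBr mul_mx_scalar mxtraceD [\tr (_ - _)]raddfB/= mxtraceZ.
  by rewrite -expr2 addrA.
pose s t := Num.sqrt (e t).
have ep t : `|t| < d -> 0 < e t by exact: dp.
have Ds t : `|t| < d -> is_derive t (1 : R) s ((2 * s t)^-1 * e1 t).
  by move=> td; have := is_derive1_comp (is_derive1_sqrt (ep t td)) (De t td).
have s0 : s 0 = 1 by rewrite /s e0 sqrtr1.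
exists (fun t => (2 * s t)^-1 * e1 t); split=> //.
  by rewrite s0 mulr1 e10.
pose s2 (t : R) := 2 * s t.
have D2s : is_derive (0 : R) (1 : R) s2 (\tr (K1 0)).
  have := is_deriveZ 2 (Ds 0 z); rewrite s0 e10 mulr1 /GRing.scale/= mulrA divff ?mul1r//.
have n0 : s2 0 != 0 by rewrite /s2 s0 mulr1.
have := is_deriveM (is_deriveV n0 D2s) De1.
rewrite /s2 s0 e10 !mulr1 /GRing.scale/= => -[H1 H2]; apply: DeriveDef => //.
by rewrite H2; field.
Qed.

End Jets.

(** * Second variation of an integral over the sphere *)

Section SecondVariation.
Context {R : realType} {n : nat}.
Local Notation E := 'rV[R]_n.
Local Notation S := (sphere : set (borel R n)).
Local Notation dt := ((1, 0) : R^o * E).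
Variables (nu : {measure set (borel R n) -> \bar R}) (nuS : (nu sphere < +oo)%E).

Lemma jet2_slice (W : normedModType R) (U : set (R^o * E)) (F : R^o * E -> W) d p :
  0 < d -> (forall t, `|t| < d -> U (t, p)) -> Ck 2 U F ->
  jet2 d (fun t => F (t, p)) ('D_dt F (0, p)) ('D_dt (fun z => 'D_dt F z) (0, p)).
Proof.
move=> d0 dU [dF DF]; have [dF1 _] := DF dt.
exists (fun t => 'D_dt F (t, p)); split=> // [t td|].
  exact: is_derive_fst (dF _ (dU t td)).
by apply: (is_derive_fst (F := fun z => 'D_dt F z)); apply/dF1/dU; rewrite normr0.
Qed.

Lemma jet2_unique (W : normedModType R) d (f : R -> W) a b a' b' : 0 < d ->
  jet2 d f a b -> jet2 d f a' b' -> a = a' /\ b = b'.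
Proof.
move=> d0 [f1 [h1 h2 h3]] [g1 [k1 k2 k3]].
have fg t : `|t| < d -> f1 t = g1 t.
  by move=> td; have [_ <-] := h1 t td; have [_ <-] := k1 t td.
split; first by rewrite -h2 -k2 fg// normr0.
have nfg : \forall t \near (0 : R), f1 t = g1 t.
  by apply: filterS (nbhsx_ballx (0 : R) d d0) => t; rewrite /ball/= sub0r normrN => /fg.
by have [_ <-] := near_eq_is_derive nfg h3; have [_ <-] := k3.
Qed.

Lemma is_derive_integral_slice (W : set (R^o * E)) (G : R^o * E -> R) (d t : R) :
  (forall t p, `|t| < d -> sphere p -> W (t, p)) -> Ck 1 W G -> `|t| < d ->
  is_derive (t : R^o) 1 (fun s : R^o => \int[nu]_(p in S) G (s, p))
    (\int[nu]_(p in S) 'D_dt G (t, p)).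
Proof.
move=> dW [dG DG] td.
apply: (@is_derive_integral_sphere _ _ nu nuS (fun s p => G (s, p))
    (fun s p => 'D_dt G (s, p)) d t) => //.
- move=> s p sd Sp; apply: differentiable_continuous.
  exact: (differentiable_slice (dG _ (dW s p sd Sp))).
- by move=> s p sd Sp; apply: is_derive_fst; exact/dG/dW.
move=> s p sd Sp.
rewrite (_ : (fun z : R^o * E => 'D_dt G (z.1, z.2)) = (fun z => 'D_dt G z)); last first.
  by apply/funext => -[].
exact: (DG dt _ (dW s p sd Sp)).
Qed.

(** If the first jet of the integrand vanishes pointwise, the functional is stationary and its
    second derivative is the integral of the second jets. Uniqueness of jets identifies the
    algebraically computed ones with the t-derivatives of [Psi]. The set W is a parameter because
    the volume density is smooth only where a determinant is positive. *)
Lemma second_variation (W : set (R^o * E)) (Psi : R^o * E -> R) (q : E -> R)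
    (f : R^o -> R^o) (d : R) :
  0 < d -> (forall t p, `|t| < d -> sphere p -> W (t, p)) -> Ck 2 W Psi ->
  (forall p, sphere p -> jet2 d (fun t => Psi (t, p)) 0 (q p)) ->
  (forall t, `|t| < d -> f t = \int[nu]_(p in S) Psi (t, p)) ->
  [/\ is_derive (0 : R^o) 1 f 0, \forall t \near (0 : R^o), derivable f t 1 &
      is_derive (0 : R^o) 1 (fun t => 'D_1 f t) (\int[nu]_(p in S) q p)].
Proof.
move=> d0 dW CPsi Hq ff; have [dF DF] := CPsi.
have D1 t : `|t| < d -> is_derive (t : R^o) 1 f (\int[nu]_(p in S) 'D_dt Psi (t, p)).
  move=> td; apply: (@near_eq_is_derive _ _ _ (fun s => \int[nu]_(p in S) Psi (s, p))).
    have := nbhsx_ballx (t : R) (d - `|t|); rewrite subr_gt0 => /(_ td).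
    apply: filterS => s; rewrite /ball/= => st; rewrite ff//.
    rewrite -[s](subrK t) (le_lt_trans (ler_normD _ _))//.
    by rewrite distrC -ltrBrDr.
  exact: (is_derive_integral_slice dW (CkW CPsi) td).
have d00 : `|0 : R| < d by rewrite normr0.
have jq p : sphere p -> 'D_dt Psi (0, p) = 0 /\ 'D_dt (fun z => 'D_dt Psi z) (0, p) = q p.
  move=> Sp; exact: (jet2_unique d0 (jet2_slice d0 (fun t td => dW t p td Sp) CPsi) (Hq p Sp)).
split.
- have := D1 0 d00; rewrite (_ : Rintegral _ _ _ = 0)//.
  transitivity (\int[nu]_(p in S) (0 : R)); last by rewrite /Rintegral integral0_eq.
  by apply: eq_Rintegral => p /set_mem Sp; have [] := jq p Sp.
- apply: filterS (nbhsx_ballx (0 : R) d d0) => t; rewrite /ball/= sub0r normrN => td.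
  by have [] := D1 t td.
apply: (@near_eq_is_derive _ _ _ (fun s => \int[nu]_(p in S) 'D_dt Psi (s, p))).
  apply: filterS (nbhsx_ballx (0 : R) d d0) => t; rewrite /ball/= sub0r normrN => td.
  by have [_ ->] := D1 t td.
rewrite (_ : \int[nu]_(p in S) q p =
    \int[nu]_(p in S) 'D_dt (fun z => 'D_dt Psi z) (0, p)); last first.
  by apply: eq_Rintegral => p /set_mem Sp; have [_ ->] := jq p Sp.
exact: (is_derive_integral_slice dW (DF dt) d00).
Qed.

End SecondVariation.

(** * Deviation of a variation from the Hopf field *)

Section Deviation.
Context {R : realType} {m : nat}.
Local Notation n := (m.+1 + m.+1)%N.
Local Notation E := 'rV[R]_n.
Local Notation J := (Jmx m).
Local Notation dx i := ((0, delta_mx 0 i) : R^o * E).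
Variables (mu : R) (mu0 : mu != 0).
Implicit Types (p x y : E) (D : 'M[R]_n).
Local Notation s := (Num.sqrt `|mu|)^-1.

Lemma nabla_mx_lin p a x y D D' : nabla_mx mu p (a *: x + y) (a *: D + D') =
  a *: nabla_mx mu p x D + nabla_mx mu p y D'.
Proof.
rewrite /nabla_mx; move: (horizontal_mx p) => P; move: (hopf p) => v.
have -> : (a *: x + y) *m P *m J = a *: (x *m P *m J) + y *m P *m J.
  by rewrite !mulmxDl -!scalemxAl.
move: (x *m P *m J) (y *m P *m J) (P *m J) => x' y' A.
by apply/matrixP => i j; rewrite dotDl dotZl !mxE !big_ord1 !mxE; ring.
Qed.

(** The normal part of the Jacobian of V cancels the tangential correction, leaving s (1 + (mu - 1))
    P J; hence the factor s mu in [hopf_nabla]. *)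
Lemma nabla_mx_hopf_unit p : sphere p ->
  nabla_mx mu p (s *: hopf p) (s *: ((1%:M - outer p p) *m J)) = hopf_nabla mu p.
Proof.
move=> Sp; have e1 : s *: hopf p *m horizontal_mx p *m J = 0.
  by rewrite -scalemxAl hopf_horizontal// scaler0 mul0mx.
have e2 : (1%:M - outer p p) *m J = horizontal_mx p *m J - outer (hopf p) p.
  have -> : 1%:M - outer p p = horizontal_mx p + outer (hopf p) (hopf p).
    by rewrite /horizontal_mx subrK.
  by rewrite mulmxDl outer_Jmx JcJ /outer mulmxN.
have e3 : outer (s *: hopf p) p = s *: outer (hopf p) p.
  by rewrite /outer linearZ/= -scalemxAl.
have e4 : outer (hopf p) (0 : E) = 0 by rewrite /outer mulmx0.
rewrite /nabla_mx /hopf_nabla e1 e2 e3 e4 dotZl sphere_hopf// addr0.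
move: (horizontal_mx p *m J) (outer _ _) => A B.
by apply/matrixP => i j; rewrite !mxE; ring.
Qed.

Definition unit_deviation (F : R^o * E -> E) (z : R^o * E) : E :=
  F z - s *: hopf z.2.

(** On the sphere, the covariant derivative of the field minus that of the Hopf field: the
    subtracted matrix is the Jacobian of the extended Hopf field there. Elsewhere it is only a
    smooth extension, chosen so that [Ck] applies on an open set of pairs (t, x). *)
Definition nabla_deviation (F : R^o * E -> E) (z : R^o * E) : 'M[R]_n :=
  nabla_mx mu z.2 (unit_deviation F z)
    (\matrix_(i, j) ('D_(dx i) F z) 0 j - s *: ((1%:M - outer z.2 z.2) *m J)).

Lemma Ck_snd k (U : set (R^o * E)) : open U -> Ck k U (fun z => z.2).
Proof.
move=> oU; have ls : linear (fun z : R^o * E => z.2) by move=> a u v.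
pose L := HB.pack (fun z : R^o * E => z.2) (GRing.isLinear.Build _ _ _ _ _ ls) :
  {linear (R^o * E)%type -> E}.
have cL : continuous L by move=> z; exact: cvg_snd.
exact: (Ck_linear k oU cL).
Qed.

Lemma Ck_hopf_snd k (U : set (R^o * E)) : open U -> Ck k U (fun z => hopf z.2).
Proof.
move=> oU; have := Ck_mulmx oU (Ck_snd k oU) (Ck_cst k J oU).
by apply: (eq_Ck oU) => z _; rewrite -JcE.
Qed.

Lemma Ck_outer (V : normedModType R) k (U : set V) (f g : V -> E) : open U ->
  Ck k U f -> Ck k U g -> Ck k U (fun z => outer (f z) (g z)).
Proof. by move=> oU Cf Cg; exact: (Ck_mulmx oU (Ck_trmx oU Cf) Cg). Qed.

Lemma Ck_proj_snd k (U : set (R^o * E)) : open U ->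
  Ck k U (fun z => 1%:M - outer z.2 z.2).
Proof.
move=> oU; have C2 := Ck_snd k oU.
exact: (Ck_subv oU (Ck_cst k 1%:M oU) (Ck_outer oU C2 C2)).
Qed.

Lemma Ck_horizontal_snd k (U : set (R^o * E)) : open U ->
  Ck k U (fun z => horizontal_mx z.2).
Proof.
move=> oU; have C2 := Ck_hopf_snd k oU.
exact: (Ck_subv oU (Ck_proj_snd k oU) (Ck_outer oU C2 C2)).
Qed.

Lemma Ck_berger_snd k l (U : set (R^o * E)) : open U ->
  Ck k U (fun z => berger_mx l z.2).
Proof.
move=> oU; have C2 := Ck_hopf_snd k oU.
apply: (Ck_add oU (Ck_cst k 1%:M oU)).
exact: (Ck_scalemx oU (Ck_cst k (l - 1) oU) (Ck_outer oU C2 C2)).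
Qed.

Lemma Ck_inv_berger_snd k l (U : set (R^o * E)) : open U ->
  Ck k U (fun z => inv_berger l z.2).
Proof.
move=> oU; have C2 := Ck_hopf_snd k oU.
apply: (Ck_add oU (Ck_proj_snd k oU)).
exact: (Ck_scalemx oU (Ck_cst k (l^-1 - 1) oU) (Ck_outer oU C2 C2)).
Qed.

Lemma Ck_hopf_nabla_snd k (U : set (R^o * E)) : open U ->
  Ck k U (fun z => hopf_nabla mu z.2).
Proof.
move=> oU; apply: (Ck_scalemx oU (Ck_cst k (s * mu) oU)).
exact: (Ck_mulmx oU (Ck_horizontal_snd k oU) (Ck_cst k J oU)).
Qed.

Lemma Ck_hopf_resolvent_snd k (U : set (R^o * E)) : open U ->
  Ck k U (fun z => hopf_resolvent mu z.2).
Proof.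
move=> oU; have CP := Ck_horizontal_snd k oU; apply: (Ck_add oU).
  exact: (Ck_subv oU (Ck_cst k 1%:M oU) CP).
exact: (Ck_scalemx oU (Ck_cst k (1 + `|mu|)^-1 oU) CP).
Qed.

Lemma Ck_unit_deviation k (U : set (R^o * E)) F : open U -> Ck k U F ->
  Ck k U (unit_deviation F).
Proof.
move=> oU CF; apply: (Ck_subv oU CF).
exact: (Ck_scalemx oU (Ck_cst k s oU) (Ck_hopf_snd k oU)).
Qed.

Lemma Ck_nabla_deviation k (U : set (R^o * E)) F : open U -> Ck k.+1 U F ->
  Ck k U (nabla_deviation F).
Proof.
move=> oU CF; have CY := Ck_unit_deviation oU (CkW CF).
have Cp := Ck_snd k oU; have Cv := Ck_hopf_snd k oU; have CP := Ck_horizontal_snd k oU.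
have CJ := Ck_cst k J oU.
apply: (Ck_add oU).
  apply: (Ck_add oU); last exact: (Ck_outer oU CY Cp).
  apply: (Ck_subv oU).
    apply: (Ck_mx oU) => i j.
    have := Ck_entry 0 j oU (Ck_derive (dx i) CF).
    by apply: (eq_Ck oU) => z _; rewrite mxE.
  exact: (Ck_scalemx oU (Ck_cst k s oU) (Ck_mulmx oU (Ck_proj_snd k oU) CJ)).
apply: (Ck_scalemx oU (Ck_cst k (mu - 1) oU)); apply: (Ck_add oU).
  exact: (Ck_scalemx oU (Ck_dot oU CY Cv) (Ck_mulmx oU CP CJ)).
exact: (Ck_outer oU Cv (Ck_mulmx oU (Ck_mulmx oU CY CP) CJ)).
Qed.

End Deviation.

Section DeviationValues.
Context {R : realType} {m : nat}.
Local Notation n := (m.+1 + m.+1)%N.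
Local Notation E := 'rV[R]_n.
Local Notation J := (Jmx m).
Local Notation dx i := ((0, delta_mx 0 i) : R^o * E).
Local Notation dt := ((1, 0) : R^o * E).
Variables (mu : R) (mu0 : mu != 0).
Implicit Types (p x y : E) (D : 'M[R]_n).
Local Notation s := (Num.sqrt `|mu|)^-1.

Lemma is_derive_nabla_mx p (x : R -> E) (D : R -> 'M[R]_n) (t : R) x' D' :
  is_derive t 1 x x' -> is_derive t 1 D D' ->
  is_derive t 1 (fun a => nabla_mx mu p (x a) (D a)) (nabla_mx mu p x' D').
Proof.
have split_D (y : E) B : nabla_mx mu p y B = B + nabla_mx mu p y 0.
  by rewrite /nabla_mx add0r addrA.
pose f (y : E) := nabla_mx mu p y 0.
have lf : linear f.
  by move=> a y z; rewrite /f -nabla_mx_lin scaler0 addr0.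
pose L := HB.pack f (GRing.isLinear.Build _ _ _ _ _ lf) : {linear E -> 'M[R]_n}.
have cL : continuous L.
  suff Cf : Ck 0 [set: E] f by move=> y; exact: (Cf y Logic.I).
  have Cx : Ck 0 [set: E] id by exact: Ck_id openT.
  have Cc q r (M : 'M[R]_(q, r)) : Ck 0 [set: E] (fun=> M) by exact: Ck_cst openT.
  apply: (Ck_add openT).
    exact: (Ck_add openT (Cc _ _ _) (Ck_outer openT Cx (Cc _ _ p))).
  apply: (Ck_scalemx openT (Ck_cst 0 (mu - 1) openT)); apply: (Ck_add openT).
    exact: (Ck_scalemx openT (Ck_dot openT Cx (Cc _ _ (hopf p))) (Cc _ _ _)).
  apply: (Ck_outer openT (Cc _ _ (hopf p))).
  exact: (Ck_mulmx openT (Ck_mulmx openT Cx (Cc _ _ _)) (Cc _ _ _)).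
move=> Dx DD; have dL := linear_differentiable (x t) cL.
have := is_deriveD DD (is_derive_curve Dx dL).
rewrite deriveE// diff_lin// -(split_D x' D').
by rewrite (_ : _ + _ = (fun a => nabla_mx mu p (x a) (D a)))//; apply/funext => a; rewrite [RHS]split_D.
Qed.

Lemma grad_mx_row (X : E -> E) p i : row i (grad_mx X p) = 'D_(delta_mx 0 i) (ext X) p.
Proof. by apply/rowP => j; rewrite !mxE. Qed.

Lemma hopf_unitE p : hopf_unit mu p = p *m (s *: J).
Proof. by rewrite /hopf_unit /hopf JcE scalemxAr. Qed.

Lemma smoothS_hopf_unit : smoothS (hopf_unit mu : E -> E).
Proof.
rewrite (_ : hopf_unit mu = fun p : E => p *m (s *: J)); first exact: smoothS_mulmx.
by apply/funext => p; rewrite hopf_unitE.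
Qed.

Lemma grad_mx_hopf_unit p : sphere p ->
  grad_mx (hopf_unit mu) p = s *: ((1%:M - outer p p) *m J).
Proof.
move=> Sp; have p0 := sphere_neq0 Sp; apply/row_matrixP => i; rewrite grad_mx_row.
rewrite derive_ext_proj//; last exact: smoothS_differentiable smoothS_hopf_unit p0.
rewrite (_ : hopf_unit mu = fun p : E => p *m (s *: J)); last first.
  by apply/funext => q; rewrite hopf_unitE.
rewrite derive_ext_mulmx//; last first.
  by rewrite /tangent dotBr dotZr Sp mulr1 subrr.
rewrite scalemxAr row_mul; congr (_ *m _).
by rewrite rowE mulmxBr mulmx1 mulmx_outer dotC.
Qed.

Lemma grad_mx_sub (X Y : E -> E) p : smoothS X -> smoothS Y -> p != 0 ->
  grad_mx (fun q => X q - Y q) p = grad_mx X p - grad_mx Y p.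
Proof.
move=> sX sY p0; apply/row_matrixP => i; rewrite raddfB/= !grad_mx_row.
by have [_ <-] := is_deriveB (is_derive_smoothS (delta_mx 0 i) sX p0)
  (is_derive_smoothS (delta_mx 0 i) sY p0).
Qed.

Lemma nabla_deviation_slice (F : R^o * E -> E) (t : R) (X : E -> E) p : sphere p ->
  (forall x, x != 0 -> F (t, x) = ext X x) ->
  nabla_deviation mu F (t, p) = nabla_mx mu p (X p) (grad_mx X p) - hopf_nabla mu p.
Proof.
move=> Sp FX; have p0 := sphere_neq0 Sp.
have gE : \matrix_(i, j) ('D_(dx i) F (t, p)) 0 j = grad_mx X p.
  apply/row_matrixP => i; rewrite grad_mx_row -(near_eq_derive (f := fun y => F (t, y))).
    by rewrite -derive_snd; apply/rowP => j; rewrite !mxE.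
  by have := open_nbhs_nbhs (conj open_neq0 p0); apply: filterS => y /FX.
rewrite /nabla_deviation gE /unit_deviation FX//= ext_sphere//.
have oppE (V : lmodType R) (a b : V) : a - b = -1 *: b + a by rewrite scaleN1r addrC.
by rewrite [X p - _]oppE [grad_mx X p - _]oppE nabla_mx_lin nabla_mx_hopf_unit// -oppE.
Qed.

Lemma nabla_mx_sub_hopf_unit (X : E -> E) p : smoothS X -> sphere p ->
  nabla_mx mu p (X p) (grad_mx X p) - hopf_nabla mu p =
  nabla_mx mu p (X p - hopf_unit mu p) (grad_mx (fun q => X q - hopf_unit mu q) p).
Proof.
move=> sX Sp; rewrite (grad_mx_sub sX smoothS_hopf_unit (sphere_neq0 Sp)).
rewrite grad_mx_hopf_unit//.
have oppE (V : lmodType R) (a b : V) : a - b = -1 *: b + a by rewrite scaleN1r addrC.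
by rewrite [X p - _]oppE [grad_mx X p - _]oppE nabla_mx_lin nabla_mx_hopf_unit// -oppE.
Qed.

Lemma Ck_slice (V W : normedModType R) k (U : set (R^o * V)) (F : R^o * V -> W) (t : R) :
  Ck k U F -> Ck k [set w : V | U (t, w)] (fun w => F (t, w)).
Proof.
elim: k F => [|k IH] F.
  move=> cF w Uw; apply: (@continuous_comp _ _ _ (fun w : V => (t : R^o, w)) F); last exact: cF.
  have dp : differentiable (fun w : V => (t : R^o, w)) w by exact: ex_diff.
  exact: differentiable_continuous dp.
move=> [dF DF]; split=> [w Uw|v]; first by apply: differentiable_slice; exact: dF.
rewrite (_ : (fun w => _) = (fun w => 'D_((0, v) : R^o * V) F (t, w))).
  exact: (IH _ (DF ((0, v) : R^o * V))).
by apply/funext => w; rewrite derive_snd.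
Qed.

(** As [nabla_mx] is linear in the value and Jacobian of the field, the point is that the
    t-derivative of the Jacobian is the Jacobian of the velocity, an exchange of derivatives granted
    by [schwarz]. *)
Lemma derive_nabla_deviation (U : set (R^o * E)) (F : R^o * E -> E) (A : E -> E) p :
  open U -> Ck 2 U F -> (forall x, x != 0 -> U (0, x)) -> sphere p -> smoothS A ->
  (forall x, x != 0 -> 'D_dt F (0, x) = ext A x) ->
  'D_dt (nabla_deviation mu F) (0, p) = nabla_mx mu p (A p) (grad_mx A p).
Proof.
move=> oU CF U0 Sp sA FA; have p0 := sphere_neq0 Sp; have Up := U0 p p0.
have [dF DF] := CF; rewrite derive_fst.
suff Dd : is_derive (0 : R) 1 (fun t : R => nabla_deviation mu F (t, p))
    (nabla_mx mu p (A p) (grad_mx A p)) by have [_ ->] := Dd.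
apply: is_derive_nabla_mx.
  have := is_deriveB (is_derive_fst (dF _ Up)) (is_derive_cst (s *: hopf p : E) (0 : R^o) (1 : R^o)).
  by rewrite FA// ext_sphere// subr0.
rewrite -[grad_mx A p]subr0; apply: is_deriveB; last first.
  exact: (is_derive_cst (s *: ((1%:M - outer p p) *m J) : 'M[R]_n) (0 : R^o) (1 : R^o)).
apply: is_derive_mx => i j.
rewrite [X in is_derive _ _ X _](_ : _ = (fun a : R => ('D_(dx i) F (a, p)) 0 j)); last first.
  by apply/funext => a; rewrite mxE.
have := is_derive_entry 0 j (is_derive_fst (F := fun z => 'D_(dx i) F z) ((DF (dx i)).1 _ Up)).
suff -> : ('D_dt (fun z => 'D_(dx i) F z) (0, p)) 0 j = grad_mx A p i j by [].
have nU : \forall z \near (0 : R^o, p), U z by exact: open_nbhs_nbhs.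
have De w : 'D_dt (fun z => 'D_w F z 0 j) (0, p) = ('D_dt (fun z => 'D_w F z) (0, p)) 0 j.
  by apply: derive_entry; apply: diff_derivable; exact: (DF w).1.
have ent w z : U z -> 'D_w (fun z' => F z' 0 j) z = ('D_w F z) 0 j.
  by move=> Uz; apply: derive_entry; apply: diff_derivable; exact: dF.
rewrite -De -(near_eq_derive (f := fun z => 'D_(dx i) (fun z' => F z' 0 j) z)); last first.
  by apply: filterS nU => z /ent.
rewrite (schwarz (dx i) dt oU Up (Ck_entry 0 j oU CF)).
rewrite (near_eq_derive (g := fun z => 'D_dt F z 0 j)); last by apply: filterS nU => z /ent.
rewrite derive_snd (near_eq_derive (g := fun y => ext A y 0 j)); last first.
  have := open_nbhs_nbhs (conj open_neq0 p0).
  by apply: filterS => y /FA ->.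
rewrite derive_entry; first by rewrite mxE.
exact/diff_derivable/smoothS_differentiable.
Qed.

End DeviationValues.

(** * Integration by parts of the linear term *)

Section LinearTerm.
Context {R : realType} {m : nat}.
Local Notation n := (m.+1 + m.+1)%N.
Local Notation E := 'rV[R]_n.
Local Notation S := (sphere : set (borel R n)).
Local Notation J := (Jmx m).
Local Notation U0 := [set x : E | x != 0].
Variables (mu l : R) (mu0 : mu != 0) (l0 : l != 0).
Variables (nu : {measure set (borel R n) -> \bar R}).
Hypothesis Hnu : volume_measure (berger l) nu.
Implicit Types (p x y : E) (Y X : E -> E).
Local Notation s := (Num.sqrt `|mu|)^-1.

Lemma mxtrace_mulmx_tr (k r : nat) (A B : 'M[R]_(k, r)) :
  \tr (A *m B^T) = \sum_i dot (row i A) (row i B).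
Proof.
by apply: eq_bigr => i _; rewrite mxE dotE; apply: eq_bigr => j _; rewrite !mxE.
Qed.

Lemma mulmx_horizontal p b : b *m horizontal_mx p = hproj p b.
Proof. by rewrite /horizontal_mx !mulmxBr mulmx1 !mulmx_outer. Qed.

(** The terms of [nabla_mx] with image along p, or supported on V, are orthogonal to the horizontal
    matrix P J. There remain the flat derivative, written so that [horizontal_ibp] applies to each
    summand, and the multiple of P J, whose squared norm is 2 m. *)
Lemma trace_nabla_hopf Y p : smoothS Y -> sphere p ->
  \tr (nabla_mx mu p (Y p) (grad_mx Y p) *m (hopf_nabla mu p)^T) =
  s * mu * (\sum_(i < n) 'D_(hproj p (delta_mx 0 i))
      (ext (fun q => dot (Y q) (Jc (delta_mx 0 i)) : R^o)) p +
    (mu - 1) * (2 * m)%:R * dot (Y p) (hopf p)).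
Proof.
move=> sY Sp; have p0 := sphere_neq0 Sp.
have e1 : \tr (grad_mx Y p *m (horizontal_mx p *m J)^T) =
    \sum_(i < n) 'D_(hproj p (delta_mx 0 i))
      (ext (fun q => dot (Y q) (Jc (delta_mx 0 i)) : R^o)) p.
  rewrite trmx_mul tr_horizontal_mx// mulmxA mxtrace_mulC mulmxA mxtrace_mulmx_tr.
  apply: eq_bigr => i _; rewrite (derive_ext_dot _ sY (smoothS_cst _) Sp).
  rewrite row_mul rowE mulmx_horizontal grad_mxE// rowE -JcE.
  rewrite (_ : 'D_ _ (ext (fun=> Jc _)) p = 0); first by rewrite dot0r addr0.
  exact: derive_cst.
have e2 : \tr (outer (Y p) p *m (horizontal_mx p *m J)^T) = 0.
  rewrite outer_mulmx mxtrace_outer trmx_mul tr_horizontal_mx// tr_Jmx mulNmx -horizontal_J//.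
  by rewrite mulmxN mulmxA normal_horizontal// mul0mx oppr0 dot0r.
have e3 : \tr (horizontal_mx p *m J *m (horizontal_mx p *m J)^T) = (2 * m)%:R.
  rewrite trmx_mul tr_horizontal_mx// tr_Jmx mulNmx mulmxN -mulmxA [J *m _]mulmxA Jmx_sqr.
  by rewrite mulNmx mul1mx mulmxN opprK horizontal_idem// mxtrace_horizontal.
have e4 x : \tr (outer (hopf p) x *m (horizontal_mx p *m J)^T) = dot (hopf p) (x *m J^T *m horizontal_mx p).
  by rewrite outer_mulmx mxtrace_outer trmx_mul tr_horizontal_mx// mulmxA.
have e5 x : dot (hopf p) (x *m horizontal_mx p) = 0.
  by rewrite dotC dot_mulmxl tr_horizontal_mx// hopf_horizontal// dot0r.
rewrite /hopf_nabla linearZ/= -scalemxAr mxtraceZ; congr (_ * _).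
rewrite /nabla_mx mulmxDl mxtraceD mulmxDl mxtraceD e1 e2 addr0; congr (_ + _).
rewrite -scalemxAl mxtraceZ mulmxDl mxtraceD -scalemxAl mxtraceZ e3 e4 e5 addr0.
by rewrite -mulrA [_ * dot _ _]mulrC.
Qed.

Lemma dot_delta p i : dot p (delta_mx 0 i) = p 0 i.
Proof.
rewrite dotE (bigD1 i)//= mxE !eqxx mulr1 big1 ?addr0// => j ji.
by rewrite mxE (negbTE ji) andbF mulr0.
Qed.

Lemma smoothS_Ck0 (f : E -> R^o) : smoothS f -> Ck 0 U0 (ext f).
Proof. by move=> sf; exact: sf. Qed.

Lemma eq_integral_sphere (f g : E -> R) : (forall p, sphere p -> f p = g p) ->
  \int[nu]_(p in S) f p = \int[nu]_(p in S) g p.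
Proof. by move=> fg; apply: eq_Rintegral => p /set_mem; exact: fg. Qed.

(** Integration by parts turns the flat derivative into 2 m <Y, V>, which adds to (mu - 1) 2 m <Y,
    V>; this is the origin of the second factor mu. *)
Lemma integral_trace_nabla_hopf Y : smoothS Y ->
  \int[nu]_(p in S) \tr (nabla_mx mu p (Y p) (grad_mx Y p) *m (hopf_nabla mu p)^T) =
  s * mu * mu * (2 * m)%:R * \int[nu]_(p in S) dot (Y p) (hopf p).
Proof.
move=> sY; pose psi i q : R^o := dot (Y q) (Jc (delta_mx 0 i)).
have spsi i : smoothS (psi i) by exact: (smoothS_dot sY (smoothS_cst _)).
have syv : smoothS (fun q => dot (Y q) (hopf q) : R^o) by exact: (smoothS_dot sY smoothS_hopf).
pose a i p : R := 'D_(hproj p (delta_mx 0 i)) (ext (psi i)) p.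
pose b p : R := ext (fun q => dot (Y q) (hopf q) : R^o) p.
have Ca i : Ck 0 U0 (a i) by exact: (Ck_dirderiv (spsi i) (Ck_hproj 0 (delta_mx 0 i))).
have Cb : Ck 0 U0 b by exact: (smoothS_Ck0 syv).
have CSa : Ck 0 U0 (fun p => \sum_i a i p).
  have H := @Ck_sum R E R 0 U0 'I_n (index_enum 'I_n) xpredT a open_neq0.
  exact: (H (fun i _ => Ca i)).
rewrite (@eq_integral_sphere _ (fun p => s * mu * (\sum_i a i p + (mu - 1) * (2 * m)%:R * b p))); last first.
  by move=> p Sp; rewrite trace_nabla_hopf// /b ext_sphere.
rewrite (@integral_Ck0Z _ _ l l0 nu Hnu); last first.
  exact: (Ck_add open_neq0 CSa (Ck_mul open_neq0 (Ck_cst 0 ((mu - 1) * (2 * m)%:R : R) open_neq0) Cb)).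
rewrite (@integral_Ck0D _ _ l l0 nu Hnu)//; last first.
  exact: (Ck_mul open_neq0 (Ck_cst 0 ((mu - 1) * (2 * m)%:R : R) open_neq0) Cb).
rewrite (@integral_Ck0_sum _ _ l l0 nu Hnu)// (@integral_Ck0Z _ _ l l0 nu Hnu)//.
have -> : \sum_i \int[nu]_(p in S) a i p = (2 * m)%:R * \int[nu]_(p in S) b p.
  under eq_bigr do rewrite (horizontal_ibp l0 Hnu _ (spsi _)).
  rewrite -mulr_sumr; congr (_ * _).
  pose c i p : R := dot p (delta_mx 0 i) * ext (psi i) p.
  transitivity (\sum_i \int[nu]_(p in S) c i p).
    apply: eq_bigr => i _; apply: eq_integral_sphere => p Sp.
    by rewrite /c ext_sphere.
  rewrite -(@integral_Ck0_sum _ _ l l0 nu Hnu); last first.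
    move=> i; apply: (Ck_mul open_neq0 _ (smoothS_Ck0 (spsi i))).
    exact: (Ck_dot open_neq0 (Ck_id 0 open_neq0) (Ck_cst 0 _ open_neq0)).
  apply: eq_integral_sphere => p Sp.
  rewrite /b ext_sphere//.
  have -> : hopf p = \sum_i dot p (delta_mx 0 i) *: Jc (delta_mx 0 i).
    rewrite /hopf {1}[p]row_sum_delta JcE mulmx_suml; apply: eq_bigr => i _.
    by rewrite -scalemxAl -JcE dot_delta.
  by rewrite dot_sumr; apply: eq_bigr => i _; rewrite dotZr /c ext_sphere.
rewrite [X in _ = _ * X](@eq_integral_sphere _ b); last first.
  by move=> p Sp; rewrite /b ext_sphere.
by ring.
Qed.

(** X and V^mu have the same g-square, so 2 g(X - V^mu, V^mu) = - g(X - V^mu, X - V^mu); moreover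
    g(Y, V^mu) = s mu <Y, V>. *)
Lemma unit_deviation_berger X p : unit_vfield mu X -> sphere p ->
  s * mu * (2 * dot (X p - hopf_unit mu p) (hopf p)) =
  - berger mu p (X p - hopf_unit mu p) (X p - hopf_unit mu p).
Proof.
move=> [_ uX] Sp; have := uX p Sp; rewrite !bergerE// /hopf_unit.
have a0 : `|mu| != 0 by rewrite normr_eq0.
have r0 : Num.sqrt `|mu| != 0 by rewrite sqrtr_eq0 -ltNge normr_gt0.
have r2 : Num.sqrt `|mu| ^+ 2 = `|mu| by rewrite sqr_sqrtr.
rewrite !dotBl !dotBr !dotZl !dotZr [dot (hopf p) (X p)]dotC sphere_hopf//.
move: (Num.sqrt _) r0 r2 => r r0 r2; rewrite -{1}r2 => e.
have -> : dot (X p) (X p) = mu / r ^+ 2 - (mu - 1) * (dot (X p) (hopf p) * dot (X p) (hopf p)).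
  by rewrite -e addrK.
by field.
Qed.

Lemma integral_deviation_hopf X : unit_vfield mu X ->
  \int[nu]_(p in S) \tr ((nabla_mx mu p (X p) (grad_mx X p) - hopf_nabla mu p) *m (hopf_nabla mu p)^T) =
  - (m%:R * mu) * \int[nu]_(p in S) berger mu p (X p - hopf_unit mu p) (X p - hopf_unit mu p).
Proof.
move=> uX; have sX := uX.1.1.
have sY : smoothS (fun p => X p - hopf_unit mu p) by exact: (smoothS_subv sX (smoothS_hopf_unit mu)).
rewrite (@eq_integral_sphere _ (fun p => \tr (nabla_mx mu p (X p - hopf_unit mu p)
  (grad_mx (fun q => X q - hopf_unit mu q) p) *m (hopf_nabla mu p)^T))); last first.
  by move=> p Sp; rewrite nabla_mx_sub_hopf_unit.
rewrite (integral_trace_nabla_hopf sY) [RHS](_ : _ = - (m%:R * mu) *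
  \int[nu]_(p in S) (- (s * mu * 2) * ext (fun q => dot (X q - hopf_unit mu q) (hopf q) : R^o) p)); last first.
  congr (_ * _); apply: eq_integral_sphere => p Sp; rewrite ext_sphere//.
  by rewrite mulNr -[s * mu * 2 * _]mulrA unit_deviation_berger// opprK.
have syv := smoothS_dot sY smoothS_hopf.
rewrite (@integral_Ck0Z _ _ l l0 nu Hnu _ _ (smoothS_Ck0 syv)).
rewrite (@eq_integral_sphere (ext _) (fun q => dot (X q - hopf_unit mu q) (hopf q))); last first.
  by move=> p Sp; rewrite ext_sphere.
by rewrite natrM; ring.
Qed.

End LinearTerm.

(** * Second variation of a density with this linear term *)

Section Variation.
Context {R : realType} {m : nat}.
Local Notation n := (m.+1 + m.+1)%N.
Local Notation E := 'rV[R]_n.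
Local Notation S := (sphere : set (borel R n)).
Local Notation dt := ((1, 0) : R^o * E).
Variables (mu l : R) (mu0 : mu != 0) (l0 : l != 0).
Variables (nu : {measure set (borel R n) -> \bar R}).
Hypothesis Hnu : volume_measure (berger l) nu.
Variables (Xt : R -> E -> E) (A : E -> E) (d : R).
Hypothesis d0 : 0 < d.
Local Notation F := (fun tx : R^o * E => ext (Xt tx.1) tx.2).
Local Notation U := [set tx : R^o * E | `|tx.1| < d /\ tx.2 != 0].
Hypothesis X0 : forall p, sphere p -> Xt 0 p = hopf_unit mu p.
Hypothesis Xsm : smooth_on U F.
Hypothesis Xunit : forall t, `|t| < d -> unit_vfield mu (Xt t).
Hypothesis XA : forall p, sphere p -> velocity Xt p = A p.
Implicit Types (p x : E).
Local Notation M := (nabla_deviation mu F).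
Local Notation Y := (unit_deviation mu F).

Lemma open_variation_dom : open U.
Proof.
have o1 : open [set t : R^o | `|t| < d].
  rewrite (_ : [set _ | _] = ball (0 : R^o) d); first exact: ball_open.
  by apply/funext => t; rewrite /ball/= sub0r normrN.
rewrite (_ : U = fst @^-1` [set t : R^o | `|t| < d] `&` snd @^-1` [set x | x != 0])//.
apply: openI; apply: open_comp => //.
- by move=> z _; exact: cvg_fst.
- by move=> z _; exact: cvg_snd.
- exact: open_neq0.
Qed.
Local Notation oU := open_variation_dom.

Lemma variation_dom t p : `|t| < d -> sphere p -> U (t, p).
Proof. by move=> td Sp; split=> //; exact: sphere_neq0. Qed.

Lemma ext_velocity x : x != 0 -> 'D_dt F (0, x) = ext A x.
Proof.
move=> x0; rewrite derive_fst /ext -XA//; exact: sphere_normalize.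
Qed.

Lemma smoothS_velocity : smoothS A.
Proof.
move=> k; have C := Ck_slice 0 (Ck_derive dt (Xsm k.+1)).
apply: (eq_Ck open_neq0 (f := fun x => 'D_dt F (0, x))) => [x x0|].
  exact: ext_velocity.
by apply: Ck_subset C => x x0 /=; rewrite normr0.
Qed.

Lemma nabla_deviation_variation t p : `|t| < d -> sphere p ->
  M (t, p) = nabla_mx mu p (Xt t p) (grad_mx (Xt t) p) - hopf_nabla mu p.
Proof. by move=> td Sp; exact: nabla_deviation_slice. Qed.

Lemma unit_deviation_variation t p : sphere p ->
  Y (t, p) = Xt t p - hopf_unit mu p.
Proof. by move=> Sp; rewrite /unit_deviation /= ext_sphere. Qed.

Lemma unit_deviation0 p : sphere p -> Y (0, p) = 0.
Proof. by move=> Sp; rewrite unit_deviation_variation// X0// subrr. Qed.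

Lemma nabla_deviation0 p : sphere p -> M (0, p) = 0.
Proof.
move=> Sp; have p0 := sphere_neq0 Sp; have z : `|0 : R| < d by rewrite normr0.
rewrite nabla_deviation_variation// X0//.
have -> : grad_mx (Xt 0) p = grad_mx (hopf_unit mu) p.
  apply/row_matrixP => i; rewrite !grad_mx_row; apply: near_eq_derive.
  exact: near_ext X0.
by rewrite grad_mx_hopf_unit// nabla_mx_hopf_unit// subrr.
Qed.

(** It depends on the acceleration of the variation and is never computed: it cancels in
    [functional_variation]. *)
Definition second_jet p := 'D_dt (fun z => 'D_dt M z) (0, p).

Lemma jet2_nabla_deviation p : sphere p ->
  jet2 d (fun t => M (t, p)) (nabla_mx mu p (A p) (grad_mx A p)) (second_jet p).
Proof.
move=> Sp; rewrite -(derive_nabla_deviation mu oU (Xsm 2) _ Sp smoothS_velocity ext_velocity).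
  apply: (jet2_slice d0 _ (Ck_nabla_deviation mu oU (Xsm 3))) => t td.
  exact: variation_dom.
by move=> x x0; split=> //=; rewrite normr0.
Qed.

Lemma jet2_unit_deviation p : sphere p ->
  exists b, jet2 d (fun t => Y (t, p)) (A p) b.
Proof.
move=> Sp; exists ('D_dt (fun z => 'D_dt Y z) (0, p)).
rewrite -[A p](ext_sphere A Sp) -ext_velocity; last exact: sphere_neq0.
have -> : 'D_dt F (0, p) = 'D_dt Y (0, p).
  rewrite [RHS]derive_fst.
  have df := is_derive_fst ((Xsm 1).1 _ (variation_dom (t := 0) _ Sp)).
  rewrite normr0 in df.
  have [_ ->] := is_deriveB (df d0) (is_derive_cst ((Num.sqrt `|mu|)^-1 *: hopf p : E) (0 : R^o) (1 : R^o)).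
  by rewrite subr0.
apply: (jet2_slice d0 _ (Ck_unit_deviation mu oU (Xsm 2))) => t td.
exact: variation_dom.
Qed.

(** Its integral vanishes for each t by [integral_deviation_hopf]. The trace of a 1 x 1 matrix with
    a factor [1%:M] is g_mu(Y, Y), put in the form to which [jet2_quad] applies. *)
Definition correction (z : R^o * E) : R :=
  \tr (M z *m (hopf_nabla mu z.2)^T) +
  m%:R * mu * \tr (Y z *m berger_mx mu z.2 *m (Y z)^T *m 1%:M).

Lemma Ck_correction k : Ck k U correction.
Proof.
have CM := Ck_nabla_deviation mu oU (Xsm k.+1).
have CY := Ck_unit_deviation mu oU (Xsm k).
apply: (Ck_add oU).
  exact: (Ck_trace oU (Ck_mulmx oU CM (Ck_trmx oU (Ck_hopf_nabla_snd mu k oU)))).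
apply: (Ck_mul oU (Ck_cst k (m%:R * mu : R) oU)); apply: (Ck_trace oU).
apply: (Ck_mulmx oU _ (Ck_cst k 1%:M oU)); apply: (Ck_mulmx oU _ (Ck_trmx oU CY)).
exact: (Ck_mulmx oU CY (Ck_berger_snd k mu oU)).
Qed.

Lemma Ck0_variation (f : R^o * E -> R) t : `|t| < d -> Ck 0 U f ->
  Ck 0 [set x : E | x != 0] (fun x => f (t, x)).
Proof. by move=> td Cf; apply: Ck_subset (Ck_slice t Cf) => x x0; split. Qed.

Lemma trace_berger (w : E) p : sphere p ->
  \tr (w *m berger_mx mu p *m w^T *m 1%:M) = berger mu p w w.
Proof. by move=> Sp; rewrite mulmx1 berger_mxE// trace_mx11. Qed.

Lemma integral_correction t : `|t| < d -> \int[nu]_(p in S) correction (t, p) = 0.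
Proof.
move=> td; have CM := Ck_nabla_deviation mu oU (Xsm 1).
have CY := Ck_unit_deviation mu oU (Xsm 0).
pose a z : R := \tr (M z *m (hopf_nabla mu z.2)^T).
pose b z : R := \tr (Y z *m berger_mx mu z.2 *m (Y z)^T *m 1%:M).
have Ca : Ck 0 U a.
  exact: (Ck_trace oU (Ck_mulmx oU CM (Ck_trmx oU (Ck_hopf_nabla_snd mu 0 oU)))).
have Cb : Ck 0 U b.
  apply: (Ck_trace oU).
  apply: (Ck_mulmx oU _ (Ck_cst 0 1%:M oU)); apply: (Ck_mulmx oU _ (Ck_trmx oU CY)).
  exact: (Ck_mulmx oU CY (Ck_berger_snd 0 mu oU)).
have Cat := Ck0_variation td Ca; have Cbt := Ck0_variation td Cb.
rewrite /correction -/(a _) -/(b _).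
rewrite (@integral_Ck0D _ _ l l0 nu Hnu _ _ Cat
  (Ck_mul open_neq0 (Ck_cst 0 (m%:R * mu : R) open_neq0) Cbt)).
rewrite (@integral_Ck0Z _ _ l l0 nu Hnu _ _ Cbt).
have := integral_deviation_hopf mu0 l0 Hnu (Xunit td).
rewrite (@eq_integral_sphere _ _ _ _ (fun p => a (t, p))); last first.
  by move=> p Sp; rewrite /a nabla_deviation_variation.
rewrite [in X in _ = X -> _](@eq_integral_sphere _ _ _ _ (fun p => b (t, p))).
  by move=> ->; rewrite mulNr addNr.
by move=> p Sp; rewrite /b unit_deviation_variation// trace_berger.
Qed.

Lemma jet2_correction p : sphere p -> jet2 d (fun t => correction (t, p))
  (\tr (nabla_mx mu p (A p) (grad_mx A p) *m (hopf_nabla mu p)^T))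
  (\tr (second_jet p *m (hopf_nabla mu p)^T) + 2 * (m%:R * mu) * berger mu p (A p) (A p)).
Proof.
move=> Sp; have [b jY] := jet2_unit_deviation Sp.
have j1 := jet2_mxtrace (jet2_mulmxr (hopf_nabla mu p)^T d0 (jet2_nabla_deviation Sp)).
have j2 := jet2_mxtrace (jet2_quad (berger_mx mu p) 1%:M d0 jY (unit_deviation0 Sp)).
have := jet2_add j1 (jet2_scale (m%:R * mu) j2).
rewrite mxtrace0 mulr0 addr0 mxtraceD trace_berger//.
by rewrite (_ : 2 * (m%:R * mu) * berger mu p (A p) (A p) =
  m%:R * mu * (berger mu p (A p) (A p) + berger mu p (A p) (A p)))//; ring.
Qed.

(** A density with linear term k tr (N N0^T), minus k times [correction], has zero first jet and a
    second jet free of [second_jet]; its integral is unchanged. The energy has k = 1, the volume k =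
    b / (1 + |mu|). *)
Theorem functional_variation (Phi : R^o -> R^o) (f : R^o * E -> R) (W : set (R^o * E))
    (k : R) (q : E -> R) :
  open W -> W `<=` U -> (forall t p, `|t| < d -> sphere p -> W (t, p)) -> Ck 2 W f ->
  (forall t, `|t| < d -> Ck 0 [set x | x != 0] (fun x => f (t, x))) ->
  (forall t, `|t| < d -> Phi t = \int[nu]_(p in S) f (t, p)) ->
  (forall p, sphere p -> jet2 d (fun t => f (t, p))
    (k * \tr (nabla_mx mu p (A p) (grad_mx A p) *m (hopf_nabla mu p)^T))
    (k * \tr (second_jet p *m (hopf_nabla mu p)^T) + q p)) ->
  [/\ is_derive (0 : R^o) 1 Phi 0, \forall t \near (0 : R^o), derivable Phi t 1 &
      is_derive (0 : R^o) 1 (fun t => 'D_1 Phi t)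
        (\int[nu]_(p in S) (q p - 2 * k * (m%:R * mu) * berger mu p (A p) (A p)))].
Proof.
move=> oW WU dW Cf Cft Phif jf.
have CC := Ck_subset WU (Ck_correction 2).
have C0 t (td : `|t| < d) := Ck0_variation td (Ck_correction 0).
have nuS := volume_sphere_fin l0 Hnu.
apply: (second_variation nuS d0 dW
  (Ck_add oW Cf (Ck_mul oW (Ck_cst 2 (- k : R) oW) CC))) => [p Sp|t td].
  have := jet2_add (jf p Sp) (jet2_scale (- k) (jet2_correction Sp)).
  set w := \tr (nabla_mx _ _ _ _ *m _).
  rewrite (_ : k * w + - k * w = 0); last by ring.
  set x := \tr (second_jet p *m _); set y := berger _ _ _ _.
  by rewrite (_ : k * x + q p + _ = q p - 2 * k * (m%:R * mu) * y)//; ring.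
rewrite (@integral_Ck0D _ _ l l0 nu Hnu _ _ (Cft t td)
  (Ck_mul open_neq0 (Ck_cst 0 (- k : R) open_neq0) (C0 t td))).
by rewrite (@integral_Ck0Z _ _ l l0 nu Hnu _ _ (C0 t td)) integral_correction// mulr0 addr0 Phif.
Qed.

End Variation.

Lemma eq_jet2 (R : realType) (W : normedModType R) d (f : R -> W) a b a' b' :
  jet2 d f a b -> a = a' -> b = b' -> jet2 d f a' b'.
Proof. by move=> + <- <-. Qed.

(** * Second variation of the energy and of the volume *)

Section Functionals.
Context {R : realType} {m : nat}.
Local Notation n := (m.+1 + m.+1)%N.
Local Notation E := 'rV[R]_n.
Local Notation S := (sphere : set (borel R n)).
Variables (mu l : R) (mu0 : mu != 0) (l0 : l != 0).
Variable nabla : (E -> E) -> E -> E -> E.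
Hypothesis LC : levi_civita (berger mu) nabla.
Implicit Types (p x : E) (X : E -> E).
Local Notation N X p := (nabla_mx mu p (X p) (grad_mx X p)).
Local Notation al := (1 + `|mu|).

Lemma pullback_sasakiE X p y z : vfield X -> sphere p -> tangent p y -> tangent p z ->
  pullback_sasaki (berger mu) nabla X p y z =
  dot (y *m (berger_mx mu p + N X p *m berger_mx mu p *m (N X p)^T)) z.
Proof.
move=> vX Sp ty tz; rewrite /pullback_sasaki !(levi_civitaE mu0 LC)// !berger_mxE//.
move: (berger_mx mu p) (N X p) => G D; rewrite mulmxDr dotDl; congr (_ + _).
by rewrite dotC dot_mulmxl dotC !mulmxA.
Qed.

Lemma gen_energy_densityE X p : vfield X -> sphere p ->
  \tr (endo_mx (berger l p) (pullback_sasaki (berger mu) nabla X p) p) =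
  (\tr (berger_mx mu p *m inv_berger l p) + `|mu| * (2 * m)%:R) +
  (2 * \tr ((N X p - hopf_nabla mu p) *m (hopf_nabla mu p)^T) +
   \tr ((N X p - hopf_nabla mu p) *m berger_mx mu p *m
     (N X p - hopf_nabla mu p)^T *m inv_berger l p)).
Proof.
move=> vX Sp; rewrite -energy_density// [hopf_nabla mu p + _]addrC subrK.
by apply: trace_endo => // y z ty tz; exact: pullback_sasakiE.
Qed.

Lemma volume_densityE X p : vfield X -> sphere p ->
  \det (endo_mx (berger mu p) (pullback_sasaki (berger mu) nabla X p) p) =
  al ^+ n * al ^- 2 * \det (1%:M + hopf_perturbation mu p (N X p - hopf_nabla mu p)).
Proof.
move=> vX Sp; rewrite -volume_density// [hopf_nabla mu p + _]addrC subrK.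
by apply: det_endo => // y z ty tz; exact: pullback_sasakiE.
Qed.

Variables (nu : {measure set (borel R n) -> \bar R}).
Hypothesis Hnu : volume_measure (berger l) nu.
Variables (Xt : R -> E -> E) (A : E -> E) (d : R).
Hypothesis d0 : 0 < d.
Local Notation F := (fun tx : R^o * E => ext (Xt tx.1) tx.2).
Local Notation U := [set tx : R^o * E | `|tx.1| < d /\ tx.2 != 0].
Hypothesis X0 : forall p, sphere p -> Xt 0 p = hopf_unit mu p.
Hypothesis Xsm : smooth_on U F.
Hypothesis Xunit : forall t, `|t| < d -> unit_vfield mu (Xt t).
Hypothesis XA : forall p, sphere p -> velocity Xt p = A p.
Local Notation M := (nabla_deviation mu F).
Local Notation oU := (@open_variation_dom R m d).

Lemma energy_variation (Phi : R^o -> R^o) :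
  Phi = (fun t => gen_energy (berger mu) nabla (berger l) nu (Xt t)) ->
  [/\ is_derive (0 : R^o) 1 Phi 0, \forall t \near (0 : R^o), derivable Phi t 1 &
      is_derive (0 : R^o) 1 (fun t => 'D_1 Phi t)
        (\int[nu]_(p in S) (\tr (N A p *m berger_mx mu p *m (N A p)^T *m inv_berger l p)
           - 2 * 1 * (m%:R * mu) * berger mu p (A p) (A p)))].
Proof.
move=> Phidef.
pose g (z : R^o * E) : R :=
  (\tr (berger_mx mu z.2 *m inv_berger l z.2) + `|mu| * (2 * m)%:R) +
  (2 * \tr (M z *m (hopf_nabla mu z.2)^T) +
   \tr (M z *m berger_mx mu z.2 *m (M z)^T *m inv_berger l z.2)).
have Cg k : Ck k U g.
  have CM := Ck_nabla_deviation mu oU (Xsm k.+1).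
  have CQ := Ck_inv_berger_snd k l oU; have CG := Ck_berger_snd k mu oU.
  apply: (Ck_add oU).
    exact: (Ck_add oU (Ck_trace oU (Ck_mulmx oU CG CQ)) (Ck_cst k (`|mu| * (2 * m)%:R : R) oU)).
  apply: (Ck_add oU).
    apply: (Ck_mul oU (Ck_cst k (2 : R) oU)).
    exact: (Ck_trace oU (Ck_mulmx oU CM (Ck_trmx oU (Ck_hopf_nabla_snd mu k oU)))).
  apply: (Ck_trace oU (Ck_mulmx oU _ CQ)).
  exact: (Ck_mulmx oU (Ck_mulmx oU CM CG) (Ck_trmx oU CM)).
have Cf k := Ck_mul oU (Ck_cst k (2^-1 : R) oU) (Cg k).
have C0 t (td : `|t| < d) := Ck0_variation td (Cf 0%N).
rewrite (_ : (fun p => _) = (fun p => \tr (N A p *m berger_mx mu p *m (N A p)^T *m inv_berger l p)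
  - 2 * 1 * (m%:R * mu) * berger mu p (A p) (A p)))//.
apply: (functional_variation mu0 l0 Hnu d0 X0 Xsm Xunit XA oU
  (fun _ => id) (@variation_dom _ _ d) (Cf 2) C0) => [t td|p Sp].
  rewrite Phidef /gen_energy (integral_Ck0Z l0 Hnu _ (Ck0_variation td (Cg 0%N))).
  congr (_ * _); apply: eq_integral_sphere => p Sp; have vX := (Xunit td).1.
  by rewrite /g (nabla_deviation_variation mu Xt td Sp) gen_energy_densityE.
have jM := jet2_nabla_deviation mu d0 Xsm XA Sp.
have M0 := nabla_deviation0 d0 X0 Sp.
have j1 := jet2_mxtrace (jet2_mulmxr (hopf_nabla mu p)^T d0 jM).
have j2 := jet2_mxtrace (jet2_quad (berger_mx mu p) (inv_berger l p) d0 jM M0).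
have j0 := jet2_cst d (\tr (berger_mx mu p *m inv_berger l p) + `|mu| * (2 * m)%:R : R).
apply: eq_jet2 (jet2_scale 2^-1 (jet2_add j0 (jet2_add (jet2_scale 2 j1) j2))) _ _.
  by rewrite mxtrace0; field.
by rewrite [\tr (_ + _)]mxtraceD; field.
Qed.

(** [b] is the volume density of the Hopf field itself, and [K p] is the first-order part of
    [hopf_perturbation] in direction A. *)
Lemma volume_variation (Phi : R^o -> R^o) : mu = l ->
  (forall t p, `|t| < d -> sphere p ->
    0 < \det (endo_mx (berger mu p) (pullback_sasaki (berger mu) nabla (Xt t) p) p)) ->
  Phi = (fun t => volume (berger mu) nabla nu (Xt t)) ->
  let b := Num.sqrt (al ^+ n * al ^- 2) in
  let K p := hopf_resolvent mu p *m ((hopf_nabla mu p *m (N A p)^T +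
    N A p *m (hopf_nabla mu p)^T) *m inv_berger mu p) in
  [/\ is_derive (0 : R^o) 1 Phi 0, \forall t \near (0 : R^o), derivable Phi t 1 &
      is_derive (0 : R^o) 1 (fun t => 'D_1 Phi t)
        (\int[nu]_(p in S) (b * (\tr (N A p *m berger_mx mu p *m (N A p)^T *m
              (inv_berger mu p *m hopf_resolvent mu p)) +
            4^-1 * \tr (K p) ^+ 2 - 2^-1 * \tr (K p *m K p))
           - 2 * (b * al^-1) * (m%:R * mu) * berger mu p (A p) (A p)))].
Proof.
move=> mul dpos Phidef b K.
pose KM (z : R^o * E) := hopf_perturbation mu z.2 (M z).
have CK k : Ck k U KM.
  have CM := Ck_nabla_deviation mu oU (Xsm k.+1); have CMT := Ck_trmx oU CM.
  have CQ := Ck_inv_berger_snd k mu oU; have CG := Ck_berger_snd k mu oU.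
  have CN := Ck_hopf_nabla_snd mu k oU; have CR := Ck_hopf_resolvent_snd mu k oU.
  apply: (Ck_mulmx oU CR (Ck_mulmx oU _ CQ)); apply: (Ck_add oU).
    exact: (Ck_add oU (Ck_mulmx oU CN CMT) (Ck_mulmx oU CM (Ck_trmx oU CN))).
  exact: (Ck_mulmx oU (Ck_mulmx oU CM CG) CMT).
pose D (z : R^o * E) : R := \det (1%:M + KM z).
have CD k : Ck k U D by exact: (Ck_det oU (Ck_add oU (Ck_cst k 1%:M oU) (CK k))).
(* [D] is known to be positive on the sphere only, so the domain of smoothness of its square root is
   cut down to an open neighbourhood; continuity in x holds on all nonzero vectors. *)
pose W := [set z | U z /\ 0 < D z].
have oW : open W.
  rewrite openE => z [Uz Dz]; have nU : \forall w \near z, U w by exact: (open_nbhs_nbhs (conj oU Uz)).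
  have nD : \forall w \near z, 0 < D w.
    exact: (cvgr_gt _ (CD 0%N z Uz)).
  by apply: filterS2 nU nD => w.
have WU : W `<=` U by move=> z [].
have al0 : 0 < al by rewrite ltr_pwDl.
have b20 : 0 < al ^+ n * al ^- 2 by rewrite mulr_gt0 ?invr_gt0 ?exprn_gt0.
have Dpos t p : `|t| < d -> sphere p -> 0 < D (t, p).
  move=> td Sp; have := dpos t p td Sp; rewrite volume_densityE//; last exact: (Xunit td).1.
  by rewrite pmulr_rgt0// /D /KM (nabla_deviation_variation mu Xt td Sp).
have dW t p (td : `|t| < d) (Sp : sphere p) : W (t, p).
  by split; [exact: variation_dom|exact: Dpos].
have CsD : Ck 2 W (fun z => Num.sqrt (D z)).
  by apply: (Ck_sqrt oW) => [z []//|]; exact: Ck_subset WU (CD 2).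
have CsD0 t : `|t| < d -> Ck 0 [set x : E | x != 0] (fun x => Num.sqrt (D (t, x))).
  move=> td x x0; apply: (@continuous_comp _ _ _ (fun x => D (t, x)) Num.sqrt).
    exact: (Ck0_variation td (CD 0%N) x0).
  exact: sqrt_continuous.
have C0 t (td : `|t| < d) := Ck_mul open_neq0 (Ck_cst 0 (b : R) open_neq0) (CsD0 t td).
apply: (functional_variation mu0 l0 Hnu d0 X0 Xsm Xunit XA oW WU dW
  (Ck_mul oW (Ck_cst 2 (b : R) oW) CsD) C0) => [t td|p Sp].
  rewrite Phidef /volume; apply: eq_integral_sphere => p Sp; have vX := (Xunit td).1.
  rewrite volume_densityE// sqrtrM; last exact: ltW.
  by rewrite /D /KM (nabla_deviation_variation mu Xt td Sp).
have jM := jet2_nabla_deviation mu d0 Xsm XA Sp.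
have M0 := nabla_deviation0 d0 X0 Sp.
have jMT := jet2_trmx jM.
have j1 := jet2_mulmxl (hopf_nabla mu p) d0 jMT.
have j2 := jet2_mulmxr (hopf_nabla mu p)^T d0 jM.
have := jet2_quad (berger_mx mu p) 1%:M d0 jM M0.
rewrite !mulmx1 (_ : (fun t => _ *m 1%:M) = (fun t => M (t, p) *m berger_mx mu p *m (M (t, p))^T)); last first.
  by apply/funext => t; rewrite mulmx1.
move=> j3; have jK := jet2_mulmxl (hopf_resolvent mu p) d0
  (jet2_mulmxr (inv_berger mu p) d0 (jet2_add (jet2_add j1 j2) j3)).
have K0 : KM (0, p) = 0.
  rewrite /KM /hopf_perturbation M0 trmx0 !mulmx0 !mul0mx.
  by rewrite !addr0 mul0mx mulmx0.
have trK (C Z : 'M[R]_n) : \tr (hopf_resolvent mu p *m ((hopf_nabla mu p *m C^T + C *m (hopf_nabla mu p)^T + Z)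
    *m inv_berger mu p)) = 2 * al^-1 * \tr (C *m (hopf_nabla mu p)^T) +
    \tr (Z *m (inv_berger mu p *m hopf_resolvent mu p)).
  exact: trace_hopf_perturbation.
apply: eq_jet2 (jet2_scale b (jet2_sqrt_det d0 jK K0 (fun t td => Dpos t p td Sp))) _ _.
  by rewrite trK mul0mx mxtrace0; field; exact: lt0r_neq0.
rewrite [hopf_nabla mu p *m (N A p)^T + _ + 0]addr0 -/(K p) trK.
move: (\tr (K p)) (\tr (K p *m K p)) => u1 u2.
move: (inv_berger mu p *m hopf_resolvent mu p) (N A p *m berger_mx mu p *m (N A p)^T) => QR Z.
rewrite mulmxDl mxtraceD; move: (\tr (Z *m QR)) (\tr (second_jet _ _ _ *m _)) => u3 u4.
by field; exact: lt0r_neq0.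
Qed.

End Functionals.

(** * Test fields *)

Section TestField.
Context {R : realType} {m : nat}.
Local Notation n := (m.+1 + m.+1)%N.
Local Notation E := 'rV[R]_n.
Local Notation J := (Jmx m).
Implicit Types (a b p u w : E) (k : nat).

(** Multiplication of a by conj(z), where z is the complex coordinate of u along the unit vector w;
    [crad w u] is |z|^2. *)
Definition cmul w u a : E := dot u w *: a - dot u (Jc w) *: Jc a.
Definition crad w u : R := dot u w ^+ 2 + dot u (Jc w) ^+ 2.

Lemma cmul_mulmx w u a : cmul w u a = u *m w^T *m a - u *m (Jc w)^T *m (a *m J).
Proof. by rewrite -!mulmxA -!/(outer _ _) !mulmx_outer -JcE. Qed.

Lemma cmulDr w u a b : cmul w u (a + b) = cmul w u a + cmul w u b.
Proof. by rewrite !cmul_mulmx mulmxDl !mulmxDr opprD addrACA. Qed.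

Lemma cmulZr w u c a : cmul w u (c *: a) = c *: cmul w u a.
Proof. by rewrite !cmul_mulmx -scalemxAl -!scalemxAr scalerBr. Qed.

Lemma cmul_Jr w u a : cmul w u (Jc a) = Jc (cmul w u a).
Proof. by rewrite /cmul JcB !JcZ. Qed.

Lemma cmul_Jl w u a : cmul w (Jc u) a = - Jc (cmul w u a).
Proof. by rewrite /cmul dot_Jcl dot_JcJ JcB !JcZ JcJ scalerN scaleNr opprK opprD addrC. Qed.

Lemma cmulC w w' u p a : cmul w u (cmul w' p a) = cmul w' p (cmul w u a).
Proof.
rewrite /cmul !JcB !JcZ !JcJ.
by apply/rowP => j; rewrite !mxE; ring.
Qed.

Lemma dot_cmul w u a : dot (cmul w u a) (cmul w u a) = crad w u * dot a a.
Proof.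
rewrite /cmul /crad !dotBl !dotBr !dotZl !dotZr dot_JcJ [dot (Jc a) a]dotC dot_Jc_self.
by ring.
Qed.

Lemma cmul_horizontal w u a p : dot a p = 0 -> dot a (hopf p) = 0 ->
  dot (cmul w u a) p = 0 /\ dot (cmul w u a) (hopf p) = 0.
Proof.
rewrite /cmul /hopf => ap aJ.
by rewrite !dotBl !dotZl dot_JcJ ap aJ dot_Jcl aJ oppr0 !mulr0 subrr.
Qed.

Variables (w w2 : E).
Hypotheses (ww : dot w w = 1) (w22 : dot w2 w2 = 1).
Hypotheses (ww2 : dot w w2 = 0) (wJw2 : dot w (Jc w2) = 0).

(** With z and z2 the complex coordinates along w and w2, this is conj(z) w2 - conj(z2) w. It is
    orthogonal to u for the Hermitian product, hence horizontal, and antilinear in u. *)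
Definition base_field u : E := cmul w u w2 - cmul w2 u w.
Definition test_field k p : E := iter k (cmul w p) (base_field p).

Lemma dot_base_field u : dot (base_field u) (base_field u) = crad w u + crad w2 u.
Proof.
have w2w : dot w2 w = 0 by rewrite dotC.
have Jw2w : dot (Jc w2) w = 0 by rewrite dotC.
have Jww2 : dot (Jc w) w2 = 0 by rewrite dot_Jcl wJw2 oppr0.
have w2Jw : dot w2 (Jc w) = 0 by rewrite dotC.
have dotBB (a b : E) : dot (a - b) (a - b) = dot a a + dot b b - 2 * dot a b.
  by rewrite dotBl !dotBr [dot b a]dotC; ring.
have c0 : dot (cmul w u w2) (cmul w2 u w) = 0.
  rewrite /cmul !dotBl !dotBr !dotZl !dotZr dot_JcJ w2w w2Jw Jw2w.
  by rewrite !mulr0 !subr0.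
by rewrite dotBB c0 !dot_cmul ww w22 !mulr1 mulr0 subr0.
Qed.

Lemma base_field_hopf p : base_field (hopf p) = - Jc (base_field p).
Proof. by rewrite /base_field /hopf !cmul_Jl JcB opprB addrC opprK. Qed.

Lemma base_field_horizontal p :
  dot (base_field p) p = 0 /\ dot (base_field p) (hopf p) = 0.
Proof.
rewrite /base_field /cmul /hopf !dotBl !dotZl !dot_JcJ.
rewrite !dot_Jcl ![dot _ p]dotC ![dot w2 _]dotC ![dot w _]dotC !dot_Jcl.
by split; ring.
Qed.

Lemma test_field_horizontal k p :
  dot (test_field k p) p = 0 /\ dot (test_field k p) (hopf p) = 0.
Proof.
elim: k => [|k [h1 h2]]; first exact: base_field_horizontal.
exact: cmul_horizontal.
Qed.

Lemma dot_iter_cmul k p a :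
  dot (iter k (cmul w p) a) (iter k (cmul w p) a) = crad w p ^+ k * dot a a.
Proof.
by elim: k => [|k IH]; rewrite ?mul1r//= dot_cmul IH exprS mulrA.
Qed.

Lemma is_derive_cmul w' (f : E -> E) p u df : is_derive p u f df ->
  is_derive p u (fun q => cmul w' q (f q)) (cmul w' u (f p) + cmul w' p df).
Proof.
move=> Df.
have D1 : is_derive p u (fun q : E => q *m w'^T *m f q)
    (u *m w'^T *m f p + p *m w'^T *m df).
  have := is_derive_mulmx (is_derive_mulmx (is_derive_id p u) (is_derive_cst (w'^T) p u)) Df.
  by rewrite mulmx0 addr0.
have D2 : is_derive p u (fun q : E => q *m (Jc w')^T *m (f q *m J))
    (u *m (Jc w')^T *m (f p *m J) + p *m (Jc w')^T *m (df *m J)).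
  have := is_derive_mulmx (is_derive_mulmx (is_derive_id p u) (is_derive_cst ((Jc w')^T) p u))
    (is_derive_mulmx Df (is_derive_cst J p u)).
  by rewrite !mulmx0 !addr0.
have := is_deriveB D1 D2; rewrite !cmul_mulmx opprD addrACA.
rewrite (_ : _ - _ = (fun q => cmul w' q (f q)))//.
by apply/funext => q; rewrite cmul_mulmx.
Qed.

Lemma is_derive_base_field p u : is_derive p u base_field (base_field u).
Proof.
have h w' a : is_derive p u (fun q => cmul w' q a) (cmul w' u a).
  have := is_derive_cmul w' (is_derive_cst a p u).
  by rewrite [cmul w' p 0](_ : _ = 0) ?addr0// cmul_mulmx mul0mx !mulmx0 subrr.
exact: is_deriveB (h w w2) (h w2 w).
Qed.

Lemma is_derive_test_field k p u : is_derive p u (test_field k.+1)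
  (k.+1%:R *: cmul w u (test_field k p) + iter k.+1 (cmul w p) (base_field u)).
Proof.
elim: k => [|k IH].
  by rewrite scale1r; exact: is_derive_cmul (is_derive_base_field p u).
suff : cmul w u (test_field k.+1 p) + cmul w p (k.+1%:R *: cmul w u (test_field k p) +
    iter k.+1 (cmul w p) (base_field u)) =
  k.+2%:R *: cmul w u (test_field k.+1 p) + iter k.+2 (cmul w p) (base_field u).
  by move=> <-; have H := is_derive_cmul w IH; exact: H.
rewrite (cmulDr w p (_ *: _)) cmulZr (cmulC w w p u) addrA -[k.+2%:R]natr1 scalerDl scale1r.
by congr (_ + _); rewrite addrC.
Qed.

Lemma test_field_derive_hopf k p :
  k.+1%:R *: cmul w (hopf p) (test_field k p) + iter k.+1 (cmul w p) (base_field (hopf p)) =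
  - (k.+2%:R *: Jc (test_field k.+1 p)).
Proof.
rewrite base_field_hopf -scaleN1r cmul_Jl.
have -> : iter k.+1 (cmul w p) (-1 *: Jc (base_field p)) = - Jc (test_field k.+1 p).
  rewrite /test_field; elim: k.+1 => [|j IH]; first by rewrite scaleN1r.
  by rewrite !iterS IH -scaleN1r cmulZr cmul_Jr scaleN1r.
rewrite -[cmul w p (test_field k p)]/(test_field k.+1 p) scalerN -opprD; congr (- _).
by rewrite -[k.+2%:R]natr1 scalerDl scale1r.
Qed.

End TestField.

(** * Pointwise size of the test fields and of their gradients *)

Section TestFieldBounds.
Context {R : realType} {m : nat}.
Local Notation n := (m.+1 + m.+1)%N.
Local Notation E := 'rV[R]_n.
Local Notation J := (Jmx m).
Local Notation U0 := [set x : E | x != 0].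
Implicit Types (a b p u w : E) (k : nat).

Lemma derive_ext_tangent (V : normedModType R) (f : E -> V) p u df : sphere p ->
  tangent p u -> differentiable f p -> is_derive p u f df -> 'D_u (ext f) p = df.
Proof. by move=> Sp tu dp [_ <-]; rewrite derive_ext// tu scale0r subr0. Qed.

Lemma Ck_cmul k (U : set E) w (f : E -> E) : open U -> Ck k U f ->
  Ck k U (fun q => cmul w q (f q)).
Proof.
move=> oU Cf; have C1 b : Ck k U (fun q : E => q *m b^T) by exact: (Ck_mulmx oU (Ck_id k oU) (Ck_cst k _ oU)).
apply: (eq_Ck oU (f := fun q => q *m w^T *m f q - q *m (Jc w)^T *m (f q *m J))).
  by move=> q _; rewrite cmul_mulmx.
exact: (Ck_subv oU (Ck_mulmx oU (C1 _) Cf) (Ck_mulmx oU (C1 _) (Ck_mulmx oU Cf (Ck_cst k J oU)))).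
Qed.

Lemma smoothS_cmul w (f : E -> E) : smoothS f -> smoothS (fun q => cmul w q (f q)).
Proof.
move=> sf; have sd b : smoothS (fun q : E => dot q b : R^o).
  exact: (smoothS_dot smoothS_id (smoothS_cst b)).
apply: smoothS_subv; first exact: (smoothS_scale (sd w) sf).
apply: (smoothS_scale (sd (Jc w))).
rewrite (_ : (fun q => Jc (f q)) = (fun q => f q *m J)); first exact: (smoothS_mulmxr J sf).
by apply/funext => q; rewrite JcE.
Qed.

Lemma Ck_test_field w w2 j k (U : set E) : open U -> Ck k U (test_field w w2 j).
Proof.
move=> oU; elim: j => [|j IH]; last exact: (Ck_cmul w oU IH).
exact: (Ck_subv oU (Ck_cmul w oU (Ck_cst k w2 oU)) (Ck_cmul w2 oU (Ck_cst k w oU))).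
Qed.

Lemma smoothS_test_field w w2 j : smoothS (test_field w w2 j).
Proof.
elim: j => [|j IH]; last exact: (smoothS_cmul w IH).
exact: (smoothS_subv (smoothS_cmul w (smoothS_cst w2)) (smoothS_cmul w2 (smoothS_cst w))).
Qed.

Lemma tangent_hproj p b : sphere p ->
  tangent p (hproj p b) /\ dot (hproj p b) (hopf p) = 0.
Proof.
move=> Sp; rewrite -mulmx_horizontal /tangent; split.
  by rewrite dotC dot_mulmxl tr_horizontal_mx// normal_horizontal// dot0r.
by rewrite dot_mulmxl tr_horizontal_mx// hopf_horizontal// dot0r.
Qed.

(** The horizontal projections of the standard basis form a Parseval frame of the horizontal space.
    Traces over that space are thus sums over all n basis vectors, without a choice of orthonormal
    frame. *)
Lemma sum_hproj_dot p a :
  \sum_(i < n) dot (hproj p (delta_mx 0 i)) a ^+ 2 =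
  dot (a *m horizontal_mx p) (a *m horizontal_mx p).
Proof.
rewrite [RHS]dotE; apply: eq_bigr => i _.
rewrite -mulmx_horizontal dot_mulmxl tr_horizontal_mx// dotC dot_delta.
by rewrite expr2.
Qed.

Lemma dot_horizontal p a : sphere p ->
  dot (a *m horizontal_mx p) (a *m horizontal_mx p) =
  dot a a - dot a p ^+ 2 - dot a (hopf p) ^+ 2.
Proof.
move=> Sp; rewrite dot_mulmxl tr_horizontal_mx// -mulmxA horizontal_idem// mulmx_horizontal.
by rewrite /hproj !dotBr !dotZr -!expr2.
Qed.

(** The squared horizontal gradient of z: w and [Jc w] each have a horizontal part of squared length
    1 - |z|^2. *)
Lemma sum_hproj_crad p w : sphere p -> dot w w = 1 ->
  \sum_(i < n) crad w (hproj p (delta_mx 0 i)) = 2 * (1 - crad w p).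
Proof.
move=> Sp ww; rewrite big_split/= !sum_hproj_dot !dot_horizontal// dot_JcJ ww /crad.
rewrite /hopf dot_JcJ -[dot w (Jc p)]opprK -dot_Jcl ![dot _ p]dotC.
by ring.
Qed.

Lemma crad_ge0 w u : 0 <= crad w u.
Proof. by rewrite addr_ge0 ?sqr_ge0. Qed.

Lemma crad_le1 p w : sphere p -> dot w w = 1 -> crad w p <= 1.
Proof.
move=> Sp ww; have := sum_hproj_crad Sp ww.
have : 0 <= \sum_(i < n) crad w (hproj p (delta_mx 0 i)).
  by apply: sumr_ge0 => i _; exact: crad_ge0.
by move=> + e; rewrite e pmulr_rge0// subr_ge0.
Qed.

Lemma dot_sqrD a b : dot (a + b) (a + b) <= 2 * dot a a + 2 * dot b b.
Proof.
have := dot_ge0 (a - b); rewrite dotBl !dotBr dotDl !dotDr [dot b a]dotC.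
by move=> h; lra.
Qed.

Variables (w w2 : E).
Hypotheses (ww : dot w w = 1) (w22 : dot w2 w2 = 1).
Hypotheses (ww2 : dot w w2 = 0) (wJw2 : dot w (Jc w2) = 0).
Local Notation A k := (test_field w w2 k).

Lemma derive_ext_test_field k p u : sphere p -> tangent p u ->
  'D_u (ext (A k.+1)) p =
  k.+1%:R *: cmul w u (A k p) + iter k.+1 (cmul w p) (base_field w w2 u).
Proof.
move=> Sp tu; apply: (derive_ext_tangent Sp tu _ (is_derive_test_field w w2 k p u)).
have C : Ck 1 setT (A k.+1) by exact: (Ck_test_field w w2 k.+1 1 openT).
exact: C.1.
Qed.

(** The exact value is |z|^(2k) (|z|^2 + |z2|^2). *)
Lemma test_field_norm k p : sphere p ->
  crad w p ^+ k.+1 <= dot (A k p) (A k p) <= 2 * crad w p ^+ k.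
Proof.
move=> Sp; rewrite dot_iter_cmul dot_base_field//.
have r1 := crad_le1 Sp ww; have r21 := crad_le1 Sp w22.
have := crad_ge0 w2 p; have := exprn_ge0 k (crad_ge0 w p).
rewrite exprSr; move: (crad w p ^+ k) (crad w p) (crad w2 p) r1 r21 => x y z.
by move=> ? ? ? ?; apply/andP; split; nra.
Qed.

(** Differentiating conj(z)^(k+1) gives the term in (k+1)^2, with the factor 1 - |z|^2 from
    [sum_hproj_crad]; differentiating the base field gives the other. That factor is decisive: after
    integration, [moment_rec] trades it for a factor k+1. *)
Lemma test_field_gradient k p : sphere p ->
  \sum_(i < n) dot ('D_(hproj p (delta_mx 0 i)) (ext (A k.+1)) p)
                   ('D_(hproj p (delta_mx 0 i)) (ext (A k.+1)) p) <=
  8 * k.+1%:R ^+ 2 * (crad w p ^+ k * (1 - crad w p)) + 8 * crad w p ^+ k.+1.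
Proof.
move=> Sp; have /andP[_ hA] := test_field_norm k Sp.
have r0 := crad_ge0 w p; have r1 := crad_le1 Sp ww.
have r20 := crad_ge0 w2 p.
apply: (@le_trans _ _ (\sum_(i < n)
    ((2 * k.+1%:R ^+ 2 * dot (A k p) (A k p)) * crad w (hproj p (delta_mx 0 i)) +
     2 * crad w p ^+ k.+1 *
       (crad w (hproj p (delta_mx 0 i)) + crad w2 (hproj p (delta_mx 0 i)))))).
  apply: ler_sum => i _; rewrite derive_ext_test_field//; last by have [] := tangent_hproj (delta_mx 0 i) Sp.
  apply: le_trans (dot_sqrD _ _) _.
  rewrite dot_iter_cmul dot_base_field// dotZl dotZr dot_cmul expr2.
  by rewrite le_eqVlt; apply/predU1P; left; ring.
have sumE (c1 c2 : 'I_n -> R) (x y : R) : \sum_i (x * c1 i + y * (c1 i + c2 i)) =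
    x * \sum_i c1 i + y * (\sum_i c1 i + \sum_i c2 i).
  by rewrite big_split/= -!mulr_sumr big_split.
rewrite (sumE (fun i => crad w _) (fun i => crad w2 _)) !sum_hproj_crad//.
have K0 : 0 <= k.+1%:R ^+ 2 :> R by exact: sqr_ge0.
have e0 := exprn_ge0 k.+1 r0.
move: (crad w p ^+ k.+1) e0 hA => e e0.
move: (crad w p ^+ k) (crad w p) (crad w2 p) (dot (A k p) (A k p)) (k.+1%:R ^+ 2) r0 r1 r20 K0.
move=> x y z a K y0 y1 z0 K0 hA.
have K1 : 0 <= K * (1 - y) by rewrite mulr_ge0// subr_ge0.
have h1 := ler_wpM2l K1 hA.
have h2 : 0 <= e * (y + z) by rewrite mulr_ge0// addr_ge0.
by lra.
Qed.

End TestFieldBounds.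

(** * Moments of |z|^2 *)

Section Moments.
Context {R : realType} {m : nat}.
Local Notation n := (m.+1 + m.+1)%N.
Local Notation E := 'rV[R]_n.
Local Notation S := (sphere : set (borel R n)).
Local Notation U0 := [set x : E | x != 0].
Variables (l : R) (l0 : l != 0) (nu : {measure set (borel R n) -> \bar R}).
Hypothesis Hnu : volume_measure (berger l) nu.
Variables (w : E) (ww : dot w w = 1).
Implicit Types (p u : E).

Lemma is_derive_dotl p u (a : E) : is_derive p u (fun q => dot q a : R^o) (dot u a).
Proof.
have := is_derive_dot (is_derive_id p u) (is_derive_cst a p u).
by rewrite dot0r addr0.
Qed.

Lemma is_derive_crad p u : is_derive p u (fun q => crad w q : R^o)
  (2 * (dot p w * dot u w + dot p (Jc w) * dot u (Jc w))).
Proof.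
have D a : is_derive p u (fun q => dot q a ^+ 2 : R^o) (2 * (dot p a * dot u a)).
  have [d1 d2] := is_deriveM (is_derive_dotl p u a) (is_derive_dotl p u a).
  apply: DeriveDef; first exact: d1.
  by apply: etrans d2 _; rewrite /GRing.scale/=; ring.
have [d1 d2] := is_deriveD (D w) (D (Jc w)).
apply: DeriveDef; first exact: d1.
by apply: etrans d2 _; rewrite mulrDr.
Qed.

Lemma is_derive_crad_exp p u j : is_derive p u (fun q => crad w q ^+ j : R^o)
  (j%:R * crad w p ^+ j.-1 * (2 * (dot p w * dot u w + dot p (Jc w) * dot u (Jc w)))).
Proof.
set c' := 2 * _; elim: j => [|j IH].
  by rewrite mul0r mul0r; exact: (is_derive_cst (1 : R^o) p u).
have [d1 d2] := is_deriveM (is_derive_crad p u) IH.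
have e : (fun q => crad w q : R^o) * (fun q => crad w q ^+ j : R^o) = fun q => crad w q ^+ j.+1.
  by apply/funext => q; rewrite exprS.
rewrite e in d1 d2; apply: DeriveDef; first exact: d1.
apply: etrans d2 _; rewrite -/c' /GRing.scale/=.
case: j {IH d1 e} => [|j]/=; first by rewrite !expr0; ring.
by rewrite exprS -[j.+2%:R]natr1; ring.
Qed.

Definition moment (j : nat) : R := \int[nu]_(p in S) (crad w p ^+ j).

Lemma Ck_dotl k (a : E) : Ck k U0 (fun q => dot q a).
Proof. exact: (Ck_dot open_neq0 (Ck_id k open_neq0) (Ck_cst k a open_neq0)). Qed.

Lemma Ck_crad_exp k j : Ck k U0 (fun q => crad w q ^+ j).
Proof.
have o := @open_neq0 R n.
exact: (Ck_exp j o (Ck_add o (Ck_exp 2 o (Ck_dotl k w)) (Ck_exp 2 o (Ck_dotl k (Jc w))))).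
Qed.

Lemma smoothS_dotl (a : E) : smoothS (fun q => dot q a : R^o).
Proof. exact: (smoothS_dot smoothS_id (smoothS_cst a)). Qed.

Lemma smoothS_crad_exp j : smoothS (fun q => crad w q ^+ j : R^o).
Proof.
have sc : smoothS (fun q => crad w q : R^o).
  apply: (smoothS_add (smoothS_mul (smoothS_dotl w) (smoothS_dotl w))
                      (smoothS_mul (smoothS_dotl (Jc w)) (smoothS_dotl (Jc w)))).
elim: j => [|j IH]; first exact: (smoothS_cst (1 : R^o)).
rewrite (_ : (fun q => _) = (fun q => crad w q * crad w q ^+ j)); first exact: (smoothS_mul sc IH).
by apply/funext => q; rewrite exprS.
Qed.

Lemma derive_crad_dot j (a : E) p u : sphere p -> tangent p u ->
  'D_u (ext (fun q => crad w q ^+ j * dot q a : R^o)) p =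
  crad w p ^+ j * dot u a + dot p a *
  (j%:R * crad w p ^+ j.-1 * (2 * (dot p w * dot u w + dot p (Jc w) * dot u (Jc w)))).
Proof.
move=> Sp tu; have D := is_deriveM (is_derive_crad_exp p u j) (is_derive_dotl p u a).
have C : Ck 1 U0 (fun q => crad w q ^+ j * dot q a).
  exact: (Ck_mul open_neq0 (Ck_crad_exp 1 j) (Ck_dotl 1 a)).
exact: (derive_ext_tangent Sp tu (C.1 _ (sphere_neq0 Sp)) D).
Qed.

(** [horizontal_ibp] for b = w and b = [Jc w], applied to |z|^(2j) <p, b> and added up. The ratio of
    consecutive moments is 1 + m / (j + 1), which quantifies the concentration near |z| = 1. *)
Lemma moment_rec j : j.+1%:R * (moment j - moment j.+1) = m%:R * moment j.+1.
Proof.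
pose psi a (q : E) : R^o := crad w q ^+ j * dot q a.
have spsi a : smoothS (psi a) by exact: (smoothS_mul (smoothS_crad_exp j) (smoothS_dotl a)).
have Cd a := Ck_dirderiv (spsi a) (Ck_hproj 0 a).
have Cp a : Ck 0 U0 (fun p => dot p a * psi a p).
  exact: (Ck_mul open_neq0 (Ck_dotl 0 a) (Ck_mul open_neq0 (Ck_crad_exp 0 j) (Ck_dotl 0 a))).
have ibp a := horizontal_ibp l0 Hnu a (spsi a).
have eR : \int[nu]_(p in S) (dot p w * psi w p + dot p (Jc w) * psi (Jc w) p) = moment j.+1.
  by apply: eq_integral_sphere => p Sp; rewrite /psi exprS {3}/crad; ring.
have := congr2 +%R (ibp w) (ibp (Jc w)).
rewrite -mulrDr -(integral_Ck0D l0 Hnu (Cd w) (Cd (Jc w))) -(integral_Ck0D l0 Hnu (Cp w) (Cp (Jc w))) eR.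
rewrite (@eq_integral_sphere _ _ _ _
  (fun p => 2 * j.+1%:R * (crad w p ^+ j + -1 * crad w p ^+ j.+1))); last first.
  move=> p Sp; have [t1 _] := tangent_hproj w Sp; have [t2 _] := tangent_hproj (Jc w) Sp.
  have e1 : dot w (Jc p) = - dot p (Jc w) by rewrite dotC dot_Jcl.
  have e2 : dot (Jc p) w = - dot p (Jc w) by rewrite dot_Jcl.
  have e3 : dot (Jc w) (Jc p) = dot p w by rewrite dot_JcJ dotC.
  have e4 : dot (Jc w) w = 0 by rewrite dotC dot_Jc_self.
  have e5 : dot (Jc w) p = dot p (Jc w) by rewrite dotC.
  rewrite !derive_crad_dot// /hproj /hopf !dotBl !dotZl e1 e2 e3 e4 e5 !dot_JcJ ww dot_Jc_self.
  rewrite [dot w p]dotC.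
  rewrite exprS -[j.+1%:R]natr1.
  case: j {psi spsi Cd Cp ibp eR} => [|j]; rewrite /= ?expr0 /crad.
    by ring.
  by rewrite exprS; move: ((_ + _) ^+ j) => X; ring.
have C1 := Ck_mul open_neq0 (Ck_cst 0 (-1 : R) open_neq0) (Ck_crad_exp 0 j.+1).
rewrite (integral_Ck0Z l0 Hnu _ (Ck_add open_neq0 (Ck_crad_exp 0 j) C1)).
rewrite (integral_Ck0D l0 Hnu (Ck_crad_exp 0 j) C1) (integral_Ck0Z l0 Hnu _ (Ck_crad_exp 0 j.+1)).
rewrite -/(moment j) -/(moment j.+1) natrM => e.
have : 2 * (j.+1%:R * (moment j - moment j.+1)) = 2 * (m%:R * moment j.+1).
  by rewrite mulrA [RHS]mulrA -e; ring.
by apply: mulfI; rewrite pnatr_eq0.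
Qed.

(** The moment of order 0 is the volume of the sphere, and the recursion propagates positivity. *)
Lemma moment_gt0 j : 0 < moment j.
Proof.
elim: j => [|j IH].
  rewrite /moment (@eq_integral_sphere _ _ _ _ (fun=> 1)); last by move=> p _; rewrite expr0.
  rewrite Rintegral_cst ?mul1r; last exact: borel_sphere.
  by apply: fine_gt0; rewrite (volume_sphere_gt0 l0 Hnu) (volume_sphere_fin l0 Hnu).
have := moment_rec j; rewrite mulrBr => /eqP; rewrite subr_eq -mulrDl => /eqP e.
have : 0 < (m%:R + j.+1%:R) * moment j.+1 by rewrite -e mulr_gt0 ?ltr0Sn.
by rewrite pmulr_rgt0// -natrD ltr0n addnS.
Qed.

End Moments.

(** * Pointwise bounds on the Hessian integrands *)

Section PointwiseBounds.
Context {R : realType} {m : nat}.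
Local Notation n := (m.+1 + m.+1)%N.
Local Notation E := 'rV[R]_n.
Local Notation J := (Jmx m).
Variables (mu : R) (mu0 : mu != 0) (p : E) (Sp : sphere p).
Local Notation v := (hopf p).
Local Notation P := (horizontal_mx p).
Local Notation G := (berger_mx mu p).
Local Notation N0 := (hopf_nabla mu p).
Local Notation Q := (inv_berger mu p).
Local Notation Rv := (hopf_resolvent mu p).
Local Notation al := (1 + `|mu|).
Local Notation eb i := (delta_mx 0 i : E).

(** Separates the horizontal derivatives, with weight a, from the derivative along V, with weight b;
    negativity will come from b. *)
Lemma mxtrace_horizontal_outer (Z : 'M[R]_n) a b :
  \tr (Z *m G *m Z^T *m (a *: P + b *: outer v v)) =
  a * (\sum_i dot (hproj p (eb i) *m Z *m G) (hproj p (eb i) *m Z)) +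
  b * dot (v *m Z *m G) (v *m Z).
Proof.
have PT := tr_horizontal_mx p; have PP := horizontal_idem Sp.
have e1 : \tr (Z *m G *m Z^T *m P) =
    \sum_i dot (hproj p (eb i) *m Z *m G) (hproj p (eb i) *m Z).
  rewrite -PP mulmxA mxtrace_mulC !mulmxA -[_ *m Z^T *m P]mulmxA -{2}PT -trmx_mul mxtrace_mulmx_tr.
  by apply: eq_bigr => i _; rewrite !row_mul rowE mulmx_horizontal.
have e2 : \tr (Z *m G *m Z^T *m outer v v) = dot (v *m Z *m G) (v *m Z).
  rewrite /outer mulmxA mxtrace_mulC !mulmxA -[_ *m Z^T *m _]mulmxA -trmx_mul.
  by rewrite trace_mx11.
by rewrite mulmxDr mxtraceD -!scalemxAr !mxtraceZ e1 e2.
Qed.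

Lemma berger_mx_le (x : E) : dot (x *m G) x <= (1 + `|mu - 1|) * dot x x.
Proof.
rewrite -berger_mxE// bergerE// [(1 + `|_|) * _]mulrDl mul1r lerD2l -expr2.
have h : dot x v ^+ 2 <= dot x x by have := dot_cauchy x v; rewrite sphere_hopf// mulr1.
apply: le_trans (ler_wpM2l (normr_ge0 (mu - 1)) h).
by rewrite ler_wpM2r ?sqr_ge0// ler_norm.
Qed.

Variables (A : E -> E) (d : R).
Hypotheses (sA : smoothS A) (Ap : dot (A p) p = 0) (Av : dot (A p) v = 0).
Hypothesis DvA : 'D_v (ext A) p = - (d *: Jc (A p)).
Local Notation NA := (nabla_mx mu p (A p) (grad_mx A p)).
Local Notation T := (\sum_(i < n) dot ('D_(hproj p (eb i)) (ext A) p)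
                                      ('D_(hproj p (eb i)) (ext A) p)).
Local Notation a := (dot (A p) (A p)).
Local Notation TN := (\sum_i dot (hproj p (eb i) *m NA) (hproj p (eb i) *m NA)).

Let p0 := sphere_neq0 Sp.
Let tA : tangent p (A p). Proof. by rewrite /tangent dotC. Qed.

(** D_V A = - d J A is the hypothesis on the test field; the connection adds (mu - 1) J A because A
    is horizontal. *)
Lemma hopf_nabla_mx : v *m NA = (mu - 1 - d) *: Jc (A p).
Proof.
rewrite nabla_mxE//; last exact: tangent_hopf.
rewrite grad_mxE// DvA [dot v (A p)]dotC Av sphere_hopf// !scale0r !addr0 add0r scale1r.
by rewrite -scaleNr -scalerDl addrC.
Qed.

Lemma horizontal_nabla_mx i : hproj p (eb i) *m NA =
  'D_(hproj p (eb i)) (ext A) p + dot (hproj p (eb i)) (A p) *: p.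
Proof.
have [t1 t2] := tangent_hproj (eb i) Sp.
by rewrite nabla_mxE// grad_mxE// Av t2 !scale0r !addr0 scaler0 addr0.
Qed.

Lemma sum_nabla_mx : TN <= 2 * T + 2 * a.
Proof.
apply: (@le_trans _ _ (\sum_(i < n) (2 * dot ('D_(hproj p (eb i)) (ext A) p)
                                      ('D_(hproj p (eb i)) (ext A) p) +
   2 * dot (hproj p (eb i)) (A p) ^+ 2))).
  apply: ler_sum => i _; rewrite horizontal_nabla_mx; apply: le_trans (dot_sqrD _ _) _.
  by rewrite [X in _ + 2 * X]dotZl dotZr Sp mulr1 expr2.
rewrite big_split/= -!mulr_sumr sum_hproj_dot dot_horizontal// Ap Av expr0n/= !subr0.
by [].
Qed.

Lemma dot_hopf_nabla_mx : dot (v *m NA *m G) (v *m NA) = (mu - 1 - d) ^+ 2 * a /\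
  dot (v *m NA *m P) (v *m NA *m P) = (mu - 1 - d) ^+ 2 * a.
Proof.
have JAp : dot (Jc (A p)) p = 0 by rewrite dot_Jcl Av oppr0.
have JAv : dot (Jc (A p)) v = 0 by rewrite /hopf dot_JcJ.
rewrite hopf_nabla_mx mulmx_horizontal; split.
  by rewrite -berger_mxE// bergerE// !dotZl !dotZr JAv dot_JcJ; ring.
have -> : hproj p ((mu - 1 - d) *: Jc (A p)) = (mu - 1 - d) *: Jc (A p).
  by rewrite /hproj [dot _ p]dotZl [dot _ v]dotZl JAp JAv !mulr0 !scale0r !subr0.
by rewrite dotZl dotZr dot_JcJ; ring.
Qed.

(** Only the horizontal part is estimated, whence 0 <= x; the vertical part is computed exactly, so
    b may be negative, as it is in both applications. *)
Lemma trace_nabla_mx_le x b : 0 <= x ->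
  \tr (NA *m G *m NA^T *m (x *: P + b *: outer v v)) <=
  x * (1 + `|mu - 1|) * (2 * T + 2 * a) + b * ((mu - 1 - d) ^+ 2 * a).
Proof.
move=> x0; rewrite mxtrace_horizontal_outer dot_hopf_nabla_mx.1 lerD2r -mulrA.
apply: ler_wpM2l => //.
apply: le_trans (ler_wpM2l _ sum_nabla_mx); last by rewrite addr_ge0.
by rewrite mulr_sumr; apply: ler_sum => i _; exact: berger_mx_le.
Qed.

(** Cauchy-Schwarz against [hopf_nabla], of squared norm 2 m |mu|. Being horizontal, it pairs only
    with the horizontal rows, so no factor d appears. *)
Lemma sqr_trace_nabla_hopf_le :
  \tr (NA *m N0^T) ^+ 2 <= (2 * T + 2 * a) * (`|mu| * (2 * m)%:R).
Proof.
have PT := tr_horizontal_mx p; have [N0P PN0] := hopf_nabla_P mu Sp.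
have -> : \tr (NA *m N0^T) = \sum_i dot (hproj p (eb i) *m NA) (row i N0).
  rewrite -{1}PN0 trmx_mul PT mulmxA mxtrace_mulC mulmxA mxtrace_mulmx_tr.
  by apply: eq_bigr => i _; rewrite row_mul rowE mulmx_horizontal.
have eN : \sum_i dot (row i N0) (row i N0) = `|mu| * (2 * m)%:R.
  by rewrite -mxtrace_mulmx_tr hopf_nabla_sqr// mxtraceZ mxtrace_horizontal.
apply: le_trans (dot_sum_cauchy _ _) _; rewrite eN.
by apply: ler_wpM2r sum_nabla_mx; rewrite mulr_ge0.
Qed.

(** Under the trace K is S *m W, with S symmetric and W = P / (1 + |mu|) + V V^T / mu. The two
    diagonal contributions are squares; the mixed one is exact, with coefficient 2 |mu| / (mu (1 +
    |mu|)) = - 2 / (1 + |mu|) for mu < 0. *)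
Lemma trace_sqr_perturbation_ge K : mu < 0 ->
  K = Rv *m ((N0 *m NA^T + NA *m N0^T) *m Q) ->
  - 2 * al^-1 * ((mu - 1 - d) ^+ 2 * a) <= \tr (K *m K).
Proof.
move=> mun KE; have PT := tr_horizontal_mx p; have PP := horizontal_idem Sp.
pose S := N0 *m NA^T + NA *m N0^T.
have ST : S^T = S by rewrite /S linearD/= !trmx_mul !trmxK addrC.
have vSP : v *m S *m P = v *m NA *m N0^T.
  have [N0P _] := hopf_nabla_P mu Sp.
  rewrite /S; move: (NA) (hopf_nabla_kill mu Sp) (tr_hopf_nabla mu p) N0P.
  move: N0 => N X h1 h2 h3.
  by rewrite mulmxDr !mulmxA h1 !mul0mx add0r -mulmxA h2 mulNmx h3.
have dvSP : dot (v *m S *m P) (v *m S *m P) = `|mu| * ((mu - 1 - d) ^+ 2 * a).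
  rewrite vSP dot_mulmxl trmxK -mulmxA.
  have -> : N0^T *m N0 = `|mu| *: P.
    by rewrite -(hopf_nabla_sqr mu0 Sp) tr_hopf_nabla// mulNmx mulmxN.
  rewrite -scalemxAr dotZr; congr (_ * _).
  by rewrite -dot_hopf_nabla_mx.2 [RHS]dot_mulmxl PT -mulmxA PP.
have -> : \tr (K *m K) = \tr (S *m (Q *m Rv) *m (S *m (Q *m Rv))).
  by rewrite KE -/S -mulmxA mxtrace_mulC !mulmxA.
rewrite inv_resolvent//.
have sq X : X^T = X -> X *m X = X -> 0 <= \tr (S *m X *m (S *m X)).
  move=> XT XX.
  have -> : \tr (S *m X *m (S *m X)) = \tr (X *m S *m X *m (X *m S *m X)^T).
    rewrite !trmx_mul XT ST -{2}XX [S *m (X *m X)]mulmxA [in LHS]mulmxA mxtrace_mulC !mulmxA.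
    by rewrite -[_ *m X *m X]mulmxA XX.
  by rewrite mxtrace_mulmx_tr; apply: sumr_ge0 => i _; exact: dot_ge0.
have e1 := sq _ PT PP.
have OO : outer v v *m outer v v = outer v v by rewrite outer_outer sphere_hopf// scale1r.
have e3 := sq _ (tr_outer v v) OO.
have e2 : \tr (S *m P *m (S *m outer v v)) = `|mu| * ((mu - 1 - d) ^+ 2 * a).
  rewrite -dvSP dot_mulmxl PT -[_ *m P *m P]mulmxA PP.
  rewrite /outer !mulmxA mxtrace_mulC !mulmxA trace_mx11.
  by rewrite /dot !trmx_mul PT ST !mulmxA.
move: (outer v v) e2 e3 => O e2 e3.
have -> : \tr (S *m (al^-1 *: P + mu^-1 *: O) *m (S *m (al^-1 *: P + mu^-1 *: O))) =
    al^-1 ^+ 2 * \tr (S *m P *m (S *m P)) + 2 * al^-1 * mu^-1 * \tr (S *m P *m (S *m O)) +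
    mu^-1 ^+ 2 * \tr (S *m O *m (S *m O)).
  move: (P) => P'; rewrite mulmxDr -!scalemxAr.
  have -> : (al^-1 *: (S *m P') + mu^-1 *: (S *m O)) *m (al^-1 *: (S *m P') + mu^-1 *: (S *m O)) =
    (al^-1 ^+ 2 *: (S *m P' *m (S *m P')) + (al^-1 * mu^-1) *: (S *m P' *m (S *m O))) +
    ((al^-1 * mu^-1) *: (S *m O *m (S *m P')) + mu^-1 ^+ 2 *: (S *m O *m (S *m O))).
    rewrite mulmxDl !mulmxDr -!scalemxAl -!scalemxAr !scalerA -!expr2.
    by rewrite [mu^-1 * al^-1]mulrC.
  rewrite !mxtraceD !mxtraceZ [\tr (S *m O *m (S *m P'))]mxtrace_mulC; ring.
rewrite e2 (ltr0_norm mun).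
move: e1 e3; move: (\tr _) (\tr _) => x y x0 y0.
have h1 : 0 <= al^-1 ^+ 2 * y by rewrite mulr_ge0 ?sqr_ge0.
have h2 : 0 <= mu^-1 ^+ 2 * x by rewrite mulr_ge0 ?sqr_ge0.
rewrite (ltr0_norm mun) in h1.
have -> : 2 * (1 - mu)^-1 * mu^-1 * (- mu * ((mu - 1 - d) ^+ 2 * a)) =
    - 2 * (1 - mu)^-1 * ((mu - 1 - d) ^+ 2 * a) by field; rewrite mu0 subr_eq0 gt_eqF// (lt_trans mun).
by lra.
Qed.

End PointwiseBounds.

(** * Negativity of the Hessians on test fields *)

Section Negativity.
Context {R : realType} {m : nat}.
Local Notation n := (m.+1 + m.+1)%N.
Local Notation E := 'rV[R]_n.
Local Notation S := (sphere : set (borel R n)).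
Local Notation U0 := [set x : E | x != 0].
Variables (mu l : R) (mu0 : mu != 0) (l0 : l != 0) (hm : (1 <= m)%N).
Variable (nu : {measure set (borel R n) -> \bar R}).
Hypothesis Hnu : volume_measure (berger l) nu.
Implicit Types (A : E -> E) (p : E).
Local Notation N A p := (nabla_mx mu p (A p) (grad_mx A p)).
Local Notation al := (1 + `|mu|).

(** Two real basis vectors from the first half of the coordinates; their indices 0 and m differ
    because 1 <= m. *)
Lemma orthonormal_pair : exists w w2 : E, [/\ dot w w = 1, dot w2 w2 = 1,
  dot w w2 = 0 & dot w (Jc w2) = 0].
Proof.
pose e i : E := row_mx (delta_mx 0 i) (0 : 'rV[R]_m.+1).
have dote i j : dot (e i) (e j) = (i == j)%:R.
  rewrite /dot tr_row_mx mul_row_col mul0mx addr0 trmx_delta mul_delta_mx_cond.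
  by rewrite mulmxnE mxE !eqxx.
have dotJ i j : dot (e i) (Jc (e j)) = 0.
  rewrite /Jc row_mxKl row_mxKr oppr0 /dot tr_row_mx mul_row_col trmx0 mulmx0 mul0mx.
  by rewrite addr0 mxE.
exists (e ord0), (e ord_max); rewrite !dote !eqxx dotJ; split=> //.
suff -> : (ord0 == ord_max :> 'I_m.+1) = false by [].
by rewrite -val_eqE /=; case: (m) hm.
Qed.

Lemma Ck_nabla_mx k A : smoothS A -> Ck k U0 A -> Ck k U0 (fun p => N A p).
Proof.
move=> sA CA; have o := @open_neq0 R n.
have Cp := Ck_id k o; have Cv := Ck_mulmx o Cp (Ck_cst k (Jmx m) o).
have {}Cv : Ck k U0 (fun p : E => hopf p) by apply: (eq_Ck o _ Cv) => x _; rewrite -JcE.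
have CJ := Ck_cst k (Jmx m) o.
have CP : Ck k U0 (fun p : E => horizontal_mx p).
  exact: (Ck_subv o (Ck_subv o (Ck_cst k 1%:M o) (Ck_outer o Cp Cp)) (Ck_outer o Cv Cv)).
apply: (Ck_add o).
  apply: (Ck_add o); last exact: (Ck_outer o CA Cp).
  apply: (Ck_mx o) => i j.
  have := Ck_entry 0 j o (Ck_derive (delta_mx 0 i) (sA k.+1)).
  by apply: (eq_Ck o) => z _; rewrite mxE.
apply: (Ck_scalemx o (Ck_cst k (mu - 1) o)); apply: (Ck_add o).
  exact: (Ck_scalemx o (Ck_dot o CA Cv) (Ck_mulmx o CP CJ)).
exact: (Ck_outer o Cv (Ck_mulmx o (Ck_mulmx o CA CP) CJ)).
Qed.

Lemma le_integral_Ck0 (f g : E -> R) : Ck 0 U0 f -> Ck 0 U0 g ->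
  (forall p, sphere p -> f p <= g p) ->
  \int[nu]_(p in S) f p <= \int[nu]_(p in S) g p.
Proof.
move=> Cf Cg fg; apply: le_Rintegral => //; first exact: borel_sphere.
- exact: (integrable_Ck0 l0 Hnu Cf).
- exact: (integrable_Ck0 l0 Hnu Cg).
Qed.

(** Common to both functionals. For the test field of exponent k + 1 one has d = k + 2, so the
    negative term grows like k^2 while the gradient term, by the moment recursion, grows like k. *)
Lemma negative_test_field (q : (E -> E) -> E -> R) (C c0 : R) : 0 <= C -> 0 < c0 ->
  (forall A, smoothS A -> Ck 0 U0 A -> Ck 0 U0 (q A)) ->
  (forall A d p, smoothS A -> sphere p -> dot (A p) p = 0 -> dot (A p) (hopf p) = 0 ->
     'D_(hopf p) (ext A) p = - (d *: Jc (A p)) ->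
     q A p <= C * (\sum_(i < n) dot ('D_(hproj p (delta_mx 0 i)) (ext A) p)
         ('D_(hproj p (delta_mx 0 i)) (ext A) p) + dot (A p) (A p)) -
       c0 * ((mu - 1 - d) ^+ 2 * dot (A p) (A p))) ->
  exists A, [/\ forall k, Ck k [set: E] A, smoothS A,
    forall p, sphere p -> dot (A p) p = 0 /\ dot (A p) (hopf p) = 0 &
    \int[nu]_(p in S) q A p < 0].
Proof.
move=> C0 c00 Cq Hq; have [w [w2 [ww w22 ww2 wJw2]]] := orthonormal_pair.
(* The sum of two thresholds: beyond the first, the quadratic term in k dominates the linear one;
   beyond the second, 2 |mu|, the square (mu - 1 - (k + 2))^2 is at least (k + 1)^2 / 4. *)
pose y := 4 * C * (1 + m%:R) * (8 * m%:R + 10) / c0 + 2 * `|mu|.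
have y0 : 0 <= y.
  by rewrite addr_ge0 ?mulr_ge0// ?invr_ge0 ?(ltW c00)// addr_ge0// mulr_ge0.
pose k := Num.bound y; have yk : y < k%:R by exact: archi_boundP.
exists (test_field w w2 k.+1).
have sA := smoothS_test_field w w2 k.+1.
have hA p := test_field_horizontal w w2 k.+1 p.
have CA j U (oU : open U) := Ck_test_field w w2 k.+1 j oU.
split; [move=> j; exact: (CA j _ openT)|exact: sA|by move=> p _; exact: hA|].
pose c1 := C * 8 * k.+1%:R ^+ 2; pose D := (mu - 1 - k.+2%:R) ^+ 2.
(* Upper bound in powers of |z|^2: 8 C from the gradient bound and 2 C from the norm bound make 10
   C, and the negative term uses the lower norm bound. *)
pose g p := c1 * crad w p ^+ k + ((10 * C - c1) * crad w p ^+ k.+1 +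
  - (c0 * D) * crad w p ^+ k.+2).
have o := @open_neq0 R n.
have Cz c j := Ck_mul o (Ck_cst 0 (c : R) o) (Ck_crad_exp w 0 j).
have Cg : Ck 0 U0 g by exact: (Ck_add o (Cz _ _) (Ck_add o (Cz _ _) (Cz _ _))).
apply: (@le_lt_trans _ _ (\int[nu]_(p in S) g p)).
  apply: le_integral_Ck0 Cg _; first exact: (Cq _ sA (CA 0%N _ o)).
  move=> p Sp; have [h1 h2] := hA p.
  have DvA : 'D_(hopf p) (ext (test_field w w2 k.+1)) p = - (k.+2%:R *: Jc (test_field w w2 k.+1 p)).
    by rewrite derive_ext_test_field//; [exact: test_field_derive_hopf|exact: tangent_hopf].
  apply: le_trans (Hq _ _ p sA Sp h1 h2 DvA) _.
  have hT := test_field_gradient ww w22 ww2 wJw2 k Sp.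
  have /andP[a1 a2] := test_field_norm ww w22 ww2 wJw2 k.+1 Sp.
  move: hT a1 a2; rewrite /g /c1 -/D.
  set T := \sum_(i < n) _; set a := dot _ _; rewrite [crad w p ^+ k.+1]exprS => hT a1 a2.
  have D0 : 0 <= D by exact: sqr_ge0.
  have b1 := ler_wpM2l C0 (lerD hT a2).
  have b2 := ler_wpM2l (mulr_ge0 (ltW c00) D0) a1.
  by move: b1 b2; move: (crad w p) (crad w p ^+ k) (crad w p ^+ k.+2) => r x z; lra.
rewrite (integral_Ck0D l0 Hnu (Cz c1 k) (Ck_add o (Cz _ k.+1) (Cz _ k.+2))).
rewrite (integral_Ck0D l0 Hnu (Cz _ k.+1) (Cz _ k.+2)).
rewrite !(integral_Ck0Z l0 Hnu _ (Ck_crad_exp w 0 _)).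
rewrite -/(moment nu w k) -/(moment nu w k.+1) -/(moment nu w k.+2).
have r1 := moment_rec l0 Hnu ww k; have r2 := moment_rec l0 Hnu ww k.+1.
have p2 := moment_gt0 l0 Hnu ww k.+2.
move: r1 r2 p2; move: (moment nu w k) (moment nu w k.+1) (moment nu w k.+2) => I0 I1 I2.
move=> r1 r2 p2; rewrite /c1.
have m0 : 0 <= m%:R :> R by [].
have K1 : 1 <= k.+1%:R :> R by rewrite ler1n.
(* Everything is compared with the last moment, which carries the negative term. *)
have I1le : I1 <= (1 + m%:R) * I2.
  have : 0 <= m%:R * I2 by rewrite mulr_ge0// ltW.
  move: r2; rewrite -[k.+2%:R]natr1 => r2 h; nra.
have Ige : 0 <= I1 by nra.
(* (k + 1)(I0 - I1) = m I1 lowers the power of k + 1 from two to one. *)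
have e1 : C * 8 * k.+1%:R ^+ 2 * I0 + ((10 * C - C * 8 * k.+1%:R ^+ 2) * I1 + - (c0 * D) * I2) =
    C * (8 * k.+1%:R * m%:R + 10) * I1 - c0 * D * I2.
  have -> : C * (8 * k.+1%:R * m%:R + 10) * I1 = C * 8 * k.+1%:R * (m%:R * I1) + 10 * C * I1.
    by ring.
  by rewrite -r1; ring.
rewrite e1.
have b1 : C * (8 * k.+1%:R * m%:R + 10) * I1 <= C * (8 * k.+1%:R * m%:R + 10) * ((1 + m%:R) * I2).
  by apply: ler_wpM2l I1le; rewrite mulr_ge0// addr_ge0// !mulr_ge0.
apply: le_lt_trans (lerB b1 (lexx _)) _.
rewrite mulrA -mulrBl pmulr_llt0// subr_lt0.
have yK : y < k.+1%:R by rewrite (lt_trans yk)// ltr_nat.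
have y1 : 4 * C * (1 + m%:R) * (8 * m%:R + 10) < c0 * k.+1%:R.
  rewrite [c0 * _]mulrC -ltr_pdivrMr//; apply: le_lt_trans yK; rewrite /y lerDl mulr_ge0//.
have y2 : 2 * `|mu| < k.+1%:R.
  by apply: le_lt_trans yK; rewrite /y lerDr mulr_ge0// ?invr_ge0 ?(ltW c00)// !mulr_ge0// addr_ge0// mulr_ge0.
have D1 : k.+1%:R ^+ 2 / 4 <= D.
  rewrite /D -[k.+2%:R]natr1; have := ler_norm mu; move: (k.+1%:R) K1 y2 => K K1 y2 h.
  nra.
apply: lt_le_trans (ler_wpM2l (ltW c00) D1).
move: (k.+1%:R) K1 y1 => K K1 y1.
apply: (@le_lt_trans _ _ (C * (1 + m%:R) * (8 * m%:R + 10) * K)).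
  rewrite -subr_ge0 (_ : _ - _ = 10 * (C * (1 + m%:R) * (K - 1))); last by ring.
  apply: mulr_ge0 => //; apply: mulr_ge0; last by rewrite subr_ge0.
  by rewrite mulr_ge0// addr_ge0.
have := mulr_gt0 (lt_le_trans ltr01 K1) (etrans (subr_gt0 _ _) y1).
by lra.
Qed.

Lemma Ck_inv_berger k x : Ck k U0 (fun p : E => inv_berger x p).
Proof. exact: Ck_subset (fun _ _ => Logic.I) (Ck_slice 0 (Ck_inv_berger_snd k x openT)). Qed.

Lemma Ck_berger k x : Ck k U0 (fun p : E => berger_mx x p).
Proof. exact: Ck_subset (fun _ _ => Logic.I) (Ck_slice 0 (Ck_berger_snd k x openT)). Qed.

Lemma Ck_hopf_nabla k : Ck k U0 (fun p : E => hopf_nabla mu p).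
Proof. exact: Ck_subset (fun _ _ => Logic.I) (Ck_slice 0 (Ck_hopf_nabla_snd mu k openT)). Qed.

Lemma Ck_hopf_resolvent k : Ck k U0 (fun p : E => hopf_resolvent mu p).
Proof. exact: Ck_subset (fun _ _ => Logic.I) (Ck_slice 0 (Ck_hopf_resolvent_snd mu k openT)). Qed.

Lemma Ck_berger_norm k A : Ck k U0 A -> Ck k U0 (fun p => berger mu p (A p) (A p)).
Proof.
move=> CA; have o := @open_neq0 R n.
have Cv : Ck k U0 (fun p : E => hopf p).
  exact: Ck_subset (fun _ _ => Logic.I) (Ck_slice 0 (Ck_hopf_snd k openT)).
have Cd := Ck_dot o CA Cv.
have Ch := Ck_subv o CA (Ck_scalemx o Cd Cv).
exact: (Ck_add o (Ck_dot o Ch Ch) (Ck_mul o (Ck_cst k (mu : R) o) (Ck_mul o Cd Cd))).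
Qed.

(** The vertical term has the weight 1 / l of [inv_berger l p], so c0 = - 1 / l. In C, the first
    summand bounds the horizontal part of the trace and the second the zeroth-order term. *)
Lemma energy_hessian_negative : l < 0 ->
  exists A, [/\ forall k, Ck k [set: E] A, smoothS A,
    forall p, sphere p -> dot (A p) p = 0 /\ dot (A p) (hopf p) = 0 &
    \int[nu]_(p in S) (\tr (N A p *m berger_mx mu p *m (N A p)^T *m inv_berger l p)
           - 2 * 1 * (m%:R * mu) * berger mu p (A p) (A p)) < 0].
Proof.
move=> l_lt0; have o := @open_neq0 R n.
apply: (negative_test_field (q := fun A p =>
  \tr (N A p *m berger_mx mu p *m (N A p)^T *m inv_berger l p)
     - 2 * 1 * (m%:R * mu) * berger mu p (A p) (A p))
  (C := 2 * (1 + `|mu - 1|) + 2 * (m%:R * `|mu|)) (c0 := - l^-1)).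
- by rewrite addr_ge0// !mulr_ge0// addr_ge0.
- by rewrite oppr_gt0 invr_lt0.
- move=> A sA CA; have CN := Ck_nabla_mx sA CA.
  apply: (Ck_sub o); last exact: (Ck_mul o (Ck_cst 0 (2 * 1 * (m%:R * mu) : R) o) (Ck_berger_norm CA)).
  apply: (Ck_trace o (Ck_mulmx o _ (Ck_inv_berger 0 l))).
  exact: (Ck_mulmx o (Ck_mulmx o CN (Ck_berger 0 mu)) (Ck_trmx o CN)).
move=> A d p sA Sp Ap Av DvA.
have := trace_nabla_mx_le mu Sp sA Ap Av DvA l^-1 (ler01 : 0 <= 1 :> R).
rewrite scale1r -inv_bergerE// bergerE// Av.
set T := \sum_(i < n) _; set a := dot (A p) (A p); move: (\tr _) => t.
have T0 : 0 <= T by apply: sumr_ge0 => i _; exact: dot_ge0.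
have a0 : 0 <= a by exact: dot_ge0.
have h1 : - (m%:R * mu * a) <= m%:R * `|mu| * a.
  rewrite (_ : - _ = m%:R * (- mu) * a); last by ring.
  by rewrite ler_wpM2r// ler_wpM2l// -normrN ler_norm.
have h2 : 0 <= m%:R * `|mu| * T by rewrite !mulr_ge0.
by move=> h; lra.
Qed.

(** In c0, the summand 1 / mu is the vertical weight of the quadratic term and 1 / (1 + |mu|) comes
    from - tr (K^2) / 2; their sum is 1 / (mu (1 - mu)) < 0. The three summands of C bound the
    horizontal part of that quadratic term, (tr K)^2 / 4, and the zeroth-order term. *)
Lemma volume_hessian_negative : mu < 0 ->
  let b := Num.sqrt (al ^+ n * al ^- 2) in
  let K A p := hopf_resolvent mu p *m ((hopf_nabla mu p *m (N A p)^T +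
    N A p *m (hopf_nabla mu p)^T) *m inv_berger mu p) in
  exists A, [/\ forall k, Ck k [set: E] A, smoothS A,
    forall p, sphere p -> dot (A p) p = 0 /\ dot (A p) (hopf p) = 0 &
    \int[nu]_(p in S) (b * (\tr (N A p *m berger_mx mu p *m (N A p)^T *m
              (inv_berger mu p *m hopf_resolvent mu p)) +
            4^-1 * \tr (K A p) ^+ 2 - 2^-1 * \tr (K A p *m K A p))
           - 2 * (b * al^-1) * (m%:R * mu) * berger mu p (A p) (A p)) < 0].
Proof.
move=> mun b K; have o := @open_neq0 R n.
have al0 : 0 < al by rewrite ltr_pwDl.
have b0 : 0 < b by rewrite sqrtr_gt0 mulr_gt0 ?invr_gt0 ?exprn_gt0.
apply: (negative_test_field (q := fun A p =>
  b * (\tr (N A p *m berger_mx mu p *m (N A p)^T *m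
              (inv_berger mu p *m hopf_resolvent mu p)) +
            4^-1 * \tr (K A p) ^+ 2 - 2^-1 * \tr (K A p *m K A p))
           - 2 * (b * al^-1) * (m%:R * mu) * berger mu p (A p) (A p))
  (C := b * (2 * al^-1 * (1 + `|mu - 1|) + 4 * m%:R * al^-1 ^+ 2 * `|mu| + 2 * m%:R * al^-1 * `|mu|))
  (c0 := - (b * (mu^-1 + al^-1)))).
- by rewrite mulr_ge0 ?(ltW b0)// !addr_ge0// !mulr_ge0 ?invr_ge0 ?(ltW al0) ?addr_ge0 ?sqr_ge0.
- rewrite -mulrN mulr_gt0// oppr_gt0 (ltr0_norm mun).
  rewrite (_ : _ + _ = (mu * (1 - mu))^-1); last first.
    by field; rewrite mu0 subr_eq0 gt_eqF// (lt_trans mun).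
  by rewrite invr_lt0 nmulr_rlt0// subr_gt0 (lt_trans mun).
- move=> A sA CA; have CN := Ck_nabla_mx sA CA.
  have CQ := Ck_inv_berger 0 mu; have CR := Ck_hopf_resolvent 0; have CH := Ck_hopf_nabla 0.
  have CK : Ck 0 U0 (K A).
    apply: (Ck_mulmx o CR (Ck_mulmx o _ CQ)).
    exact: (Ck_add o (Ck_mulmx o CH (Ck_trmx o CN)) (Ck_mulmx o CN (Ck_trmx o CH))).
  apply: (Ck_sub o); last first.
    exact: (Ck_mul o (Ck_cst 0 (2 * (b * al^-1) * (m%:R * mu) : R) o) (Ck_berger_norm CA)).
  apply: (Ck_mul o (Ck_cst 0 (b : R) o)); apply: (Ck_sub o).
    apply: (Ck_add o); last exact: (Ck_mul o (Ck_cst 0 (4^-1 : R) o) (Ck_exp 2 o (Ck_trace o CK))).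
    apply: (Ck_trace o (Ck_mulmx o _ (Ck_mulmx o CQ CR))).
    exact: (Ck_mulmx o (Ck_mulmx o CN (Ck_berger 0 mu)) (Ck_trmx o CN)).
  exact: (Ck_mul o (Ck_cst 0 (2^-1 : R) o) (Ck_trace o (Ck_mulmx o CK CK))).
move=> A d p sA Sp Ap Av DvA.
have al1 : 0 <= al^-1 by rewrite invr_ge0 ltW.
have := trace_nabla_mx_le mu Sp sA Ap Av DvA mu^-1 al1.
have := sqr_trace_nabla_hopf_le mu0 Sp sA Ap Av.
have := trace_sqr_perturbation_ge mu0 Sp sA Ap Av DvA mun (erefl (K A p)).
have -> : \tr (K A p) = 2 * al^-1 * \tr (N A p *m (hopf_nabla mu p)^T).
  have := trace_hopf_perturbation mu Sp (N A p) 0.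
  by rewrite addr0 mul0mx mxtrace0 addr0.
rewrite -inv_resolvent// bergerE// Av.
set T := \sum_(i < n) _; set a := dot (A p) (A p).
set t1 := \tr (K A p *m K A p); set t2 := \tr (N A p *m (hopf_nabla mu p)^T).
set t3 := \tr (_ *m (inv_berger mu p *m hopf_resolvent mu p)).
have T0 : 0 <= T by apply: sumr_ge0 => i _; exact: dot_ge0.
have a0 : 0 <= a by exact: dot_ge0.
move=> h1 h2 h3.
have h4 : - (al^-1 * m%:R * mu * a) <= al^-1 * m%:R * `|mu| * a.
  rewrite (_ : - _ = al^-1 * m%:R * (- mu) * a); last by ring.
  by rewrite ler_wpM2r// ler_wpM2l ?mulr_ge0// -normrN ler_norm.
have h5 : 0 <= al^-1 * m%:R * `|mu| * T by rewrite !mulr_ge0.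
have h6 := ler_wpM2l (sqr_ge0 al^-1) h2.
rewrite natrM in h6.
move: h1 h3 h4 h5 h6; move: (al^-1) => x; move: ((mu - 1 - d) ^+ 2 * a) => D h1 h3 h4 h5 h6.
set L := (X in X <= _); suff : 0 <= b * ((2 * x * (1 + `|mu - 1|) + 4 * m%:R * x ^+ 2 * `|mu| +
    2 * m%:R * x * `|mu|) * (T + a) + (mu^-1 + x) * D -
    (t3 + 4^-1 * (2 * x * t2) ^+ 2 - 2^-1 * t1 - 2 * x * (m%:R * mu) * a)).
  by rewrite /L; lra.
apply: mulr_ge0; first exact: ltW.
by lra.
Qed.

End Negativity.

(** * Lorentzian signature by congruence *)

Section Sylvester.
Context {R : realType}.

Lemma schur_complement k (S : 'M[R]_(1 + k)) : S^T = S -> ulsubmx S 0 0 != 0 ->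
  let P1 := block_mx 1%:M 0 (- (ulsubmx S 0 0)^-1 *: (ursubmx S)^T) 1%:M in
  P1 \in unitmx /\ P1 *m S *m P1^T =
  block_mx (ulsubmx S) 0 0 (drsubmx S - (ulsubmx S 0 0)^-1 *: ((ursubmx S)^T *m ursubmx S)).
Proof.
move=> ST; set a := ulsubmx S 0 0 => a0 P1; split.
  by rewrite unitmxE det_lblock !det1 mulr1 unitr1.
have ulE : ulsubmx S = a%:M by exact: mx11_scalar.
have dlE : dlsubmx S = (ursubmx S)^T by rewrite -[in RHS]ST trmx_ursub trmxK.
rewrite -[in LHS](submxK S) /P1 ulE dlE tr_block_mx !trmx1 trmx0 linearZ/= trmxK.
move: (ursubmx S) (drsubmx S) => b D.
rewrite !mulmx_block !mul1mx !mul0mx !mulmx1 !mulmx0 !addr0.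
have e1 : (- a^-1 *: b^T) *m a%:M = - b^T.
  by rewrite mul_mx_scalar scalerA mulrN divff// scaleN1r.
have e2 : a%:M *m (- a^-1 *: b) = - b.
  by rewrite mul_scalar_mx scalerA mulrN divff// scaleN1r.
rewrite e1 e2 !addNr mul0mx add0r -scalemxAl scaleNr addrC.
by congr block_mx; rewrite addr0.
Qed.

(** The Schur complement splits off the first pivot, which is then rescaled to its sign; P2 takes
    care of the rest. *)
Lemma sylvester_step k (S : 'M[R]_(1 + k)) (P2 : 'M[R]_k) : S^T = S ->
  ulsubmx S 0 0 != 0 -> P2 \in unitmx ->
  P2 *m (drsubmx S - (ulsubmx S 0 0)^-1 *: ((ursubmx S)^T *m ursubmx S)) *m P2^T = 1%:M ->
  exists2 P, P \in unitmx & P *m S *m P^T =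
    block_mx (ulsubmx S 0 0 / `|ulsubmx S 0 0|)%:M 0 0 1%:M.
Proof.
move=> ST a0 uP2 hP2; have [uP1 e1] := schur_complement ST a0.
set P1 := block_mx _ _ _ _ in uP1 e1; set a := ulsubmx S 0 0 in a0 e1 hP2 *.
pose P3 : 'M[R]_(1 + k) := block_mx (Num.sqrt `|a|)^-1%:M 0 0 P2.
have s0 : Num.sqrt `|a| != 0 by rewrite sqrtr_eq0 -ltNge normr_gt0.
exists (P3 *m P1).
  rewrite unitmx_mul uP1 andbT unitmxE det_ublock det_scalar expr1.
  by rewrite unitrM -unitmxE uP2 andbT unitfE invr_eq0.
have -> : P3 *m P1 *m S *m (P3 *m P1)^T = P3 *m (P1 *m S *m P1^T) *m P3^T.
  by rewrite trmx_mul !mulmxA.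
rewrite e1.
rewrite /P3 tr_block_mx tr_scalar_mx !trmx0 !mulmx_block !mul0mx !mulmx0 !add0r !addr0 hP2.
rewrite !mul0mx (mx11_scalar (ulsubmx S)) -/a -!scalar_mxM; congr block_mx; congr (_%:M).
rewrite -[in RHS](sqr_sqrtr (normr_ge0 a)) expr2 invfM mulrA [_ * a]mulrC.
by [].
Qed.

(** A vector on which S takes the value of the Schur complement at z, and which is S-orthogonal to
    the first basis vector. Positivity on that orthogonal complement thus passes to the Schur
    complement. *)
Lemma schur_form k (S : 'M[R]_(1 + k)) (z : 'rV[R]_k) : S^T = S ->
  ulsubmx S 0 0 != 0 -> exists y : 'rV[R]_(1 + k), [/\ (y = 0 -> z = 0),
    y *m S *m (row_mx 1%:M 0)^T = 0 &
    y *m S *m y^T = z *m (drsubmx S - (ulsubmx S 0 0)^-1 *: ((ursubmx S)^T *m ursubmx S)) *m z^T].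
Proof.
move=> ST a0; have [uP1 e1] := schur_complement ST a0.
set P1 := block_mx _ _ _ _ in uP1 e1.
exists (row_mx 0 z *m P1); split.
- move=> h; have : row_mx 0 z = 0 :> 'rV[R]_(1 + k) by rewrite -(mulmxK uP1 (row_mx 0 z)) h mul0mx.
  by move=> /(congr1 rsubmx); rewrite row_mxKr => ->; apply/rowP => i; rewrite !mxE.
- have -> : (row_mx 1%:M 0)^T = P1^T *m (row_mx 1%:M 0)^T :> 'cV[R]_(1 + k).
    rewrite -trmx_mul; congr trmx; rewrite /P1 mul_row_block.
    by rewrite mul1mx mul0mx addr0 mulmx0 mul0mx addr0.
  rewrite -!mulmxA [P1 *m _]mulmxA [P1 *m S *m _]mulmxA e1.
  by rewrite tr_row_mx mul_block_col mul_row_col !(trmx0, mul0mx, mulmx0, addr0).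
rewrite trmx_mul -!mulmxA [P1 *m _]mulmxA [P1 *m S *m _]mulmxA e1.
by rewrite tr_row_mx mul_block_col mul_row_col !(trmx0, mul0mx, mulmx0, add0r) !mulmxA.
Qed.

Lemma form_ulsubmx k (S : 'M[R]_(1 + k)) :
  ulsubmx S 0 0 = (row_mx 1%:M 0 *m S *m (row_mx 1%:M 0)^T) 0 0.
Proof.
rewrite -{2}(submxK S) mul_row_block !mul1mx !mul0mx !addr0 tr_row_mx mul_row_col.
by rewrite trmx1 mulmx1 trmx0 mulmx0 addr0.
Qed.

Lemma schur_sym k (S : 'M[R]_(1 + k)) : S^T = S ->
  let D := drsubmx S - (ulsubmx S 0 0)^-1 *: ((ursubmx S)^T *m ursubmx S) in D^T = D.
Proof.
move=> ST /=; rewrite linearB/= linearZ/= trmx_mul trmxK; congr (_ - _).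
by rewrite -{2}ST trmx_drsub.
Qed.

Lemma posdef_congruence k (S : 'M[R]_k) : S^T = S ->
  (forall x : 'rV[R]_k, x != 0 -> 0 < (x *m S *m x^T) 0 0) ->
  exists2 P, P \in unitmx & P *m S *m P^T = 1%:M.
Proof.
elim: k S => [|k IH] S ST pS.
  by exists 1%:M; [exact: unitmx1|apply/matrixP => -[]].
have aE := form_ulsubmx (S : 'M[R]_(1 + k)).
have a0 : 0 < ulsubmx (S : 'M[R]_(1 + k)) 0 0.
  rewrite aE; apply: pS; apply/eqP => /(congr1 (fun x : 'rV[R]_(1 + k) => lsubmx x 0 0)).
  by rewrite row_mxKl !mxE => /eqP; rewrite oner_eq0.
have an0 := lt0r_neq0 a0.
have [|P2 uP2 e2] := IH _ (schur_sym ST).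
  move=> z z0; have [y [y0 _ <-]] := schur_form z ST an0.
  by apply: pS; apply: contra_neq z0.
have [P uP eP] := sylvester_step ST an0 uP2 e2; exists P => //; apply: etrans eP _.
by rewrite gtr0_norm// divff// -scalar_mx_block.
Qed.

(** [row_ebase] completes e to a basis in which e is proportional to the first vector; the first
    pivot is then negative and its Schur complement positive definite. *)
Lemma lorentz_congruence k (S : 'M[R]_k) (e : 'rV[R]_k) : S^T = S ->
  (e *m S *m e^T) 0 0 < 0 ->
  (forall y : 'rV[R]_k, y != 0 -> y *m S *m e^T = 0 -> 0 < (y *m S *m y^T) 0 0) ->
  exists2 P, P \in unitmx & P *m S *m P^T =
    diag_mx (\row_i (if (i == 0 :> nat)%N then -1 else 1)).
Proof.
case: k S e => [|k] S e ST eS pS; first by rewrite mxE big_ord0 ltxx in eS.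
pose P0 : 'M[R]_(1 + k) := row_ebase e; have uP0 : P0 \in unitmx by exact: row_ebase_unit.
have e0 : e != 0 by apply: contraTneq eS => ->; rewrite mul0mx mul0mx mxE ltxx.
pose f : 'rV[R]_(1 + k) := row_mx 1%:M 0.
pose c := col_ebase e 0 0.
have eE : e = c *: (f *m P0).
  rewrite -{1}(mulmx_ebase e) rank_rV e0 [col_ebase e]mx11_scalar -mulmxA mul_scalar_mx.
  by rewrite /f -pid_mx_row.
pose S1 : 'M[R]_(1 + k) := P0 *m S *m P0^T.
have S1T : S1^T = S1 by rewrite /S1 !trmx_mul trmxK ST mulmxA.
have aE := form_ulsubmx S1.
have eSE : (e *m S *m e^T) 0 0 = c ^+ 2 * ulsubmx S1 0 0.
  rewrite aE -/f eE linearZ/= -!scalemxAl -!scalemxAr scalerA -expr2 mxE /S1 trmx_mul.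
  by rewrite !mulmxA.
have a0 : ulsubmx S1 0 0 < 0.
  by move: eS; rewrite eSE; apply: contraTlt => h; rewrite -leNgt mulr_ge0 ?sqr_ge0.
have an0 : ulsubmx S1 0 0 != 0 by rewrite lt_eqF.
have [|P2 uP2 e2] := posdef_congruence (schur_sym S1T).
  move=> z z0; have [y [y0 y1 <-]] := schur_form z S1T an0.
  have -> : y *m S1 *m y^T = y *m P0 *m S *m (y *m P0)^T.
    by rewrite /S1 trmx_mul !mulmxA.
  apply: pS.
    apply: contra_neq z0 => h; apply: y0.
    by rewrite -(mulmxK uP0 y) h mul0mx.
  rewrite eE linearZ/= -scalemxAr trmx_mul; move: y1; rewrite -/f /S1 !mulmxA => ->.
  by rewrite scaler0.
have [P uP eP] := sylvester_step S1T an0 uP2 e2; exists (P *m P0).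
  by rewrite unitmx_mul uP uP0.
apply: (@etrans _ _ (P *m S1 *m P^T)); first by rewrite /S1 trmx_mul !mulmxA.
apply: etrans eP _; rewrite ltr0_norm// invrN mulrN divff//.
apply/matrixP => i j; rewrite -(fintype.splitK i) -(fintype.splitK j).
case: (fintype.split i) (fintype.split j) => [i'|i'] [j'|j'] /=.
- by rewrite block_mxEul !mxE !ord1 /=.
- rewrite block_mxEur !mxE [X in _ *+ nat_of_bool X](_ : _ = false)//.
  exact: eq_lrshift.
- rewrite block_mxEdl !mxE [X in _ *+ nat_of_bool X](_ : _ = false) ?mulr0n//.
  by apply/negP => /eqP e1; have := congr1 (@nat_of_ord _) e1; rewrite /= ord1.
rewrite block_mxEdr !mxE [X in _ = _ *+ nat_of_bool X](_ : _ = (i' == j'))//.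
Qed.

End Sylvester.

Section LorentzCriterion.
Context {R : realType} {m : nat}.
Local Notation n := (m.+1 + m.+1)%N.
Local Notation E := 'rV[R]_n.
Variables (p : E) (Sp : sphere p) (h : E -> E -> R) (H : 'M[R]_n).
Hypothesis hE : forall y z, tangent p y -> tangent p z -> h y z = dot (y *m H) z.
Local Notation v := (hopf p).

Lemma gram_mul_tbasis (k : nat) (P : 'M[R]_(k, _)) :
  gram h (P *m tbasis p) = P *m (tbasis p *m H *m (tbasis p)^T) *m P^T.
Proof.
have t i : tangent p (row i (P *m tbasis p)).
  have e : P *m tbasis p *m p^T = 0 by rewrite -mulmxA tbasis_tangent mulmx0.
  by rewrite /tangent dotC /dot -row_mul e row0 mxE.
by rewrite (gram_mxE (fun i j => hE (t i) (t j))) trmx_mul !mulmxA.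
Qed.

(** Positivity is assumed on the Euclidean complement of V but used on its H-orthogonal complement.
    For x in the latter and z = x - <x, V> V, one has H(x, x) = H(z, z) - <x, V>^2 H(V, V), where
    both terms are nonnegative and one is positive. *)
Lemma lorentzian_criterion : H^T = H -> dot (v *m H) v < 0 ->
  (forall x, tangent p x -> dot x v = 0 -> x != 0 -> 0 < dot (x *m H) x) ->
  lorentzian_at h p.
Proof.
move=> HT hv hx; rewrite /lorentzian_at.
have Bg (P : 'M[R]_(\rank (kermx p^T))) := gram_mul_tbasis P.
move: (tbasis p) Bg (tbasis_tangent p) (tbasis_full p) (tbasis_free p) => B Bg Bt Bfull Bfree.
have /submxP [e eE] : (v <= B)%MS.
  apply: submx_trans Bfull; apply/sub_kermxP.
  by rewrite [LHS]mx11_scalar -/(dot v p) dotC (tangent_hopf p) -scalemx1 scale0r.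
have ST : (B *m H *m B^T)^T = B *m H *m B^T.
  by rewrite trmx_mul trmxK trmx_mul HT mulmxA.
have formE (y z : 'rV[R]_ _) : (y *m (B *m H *m B^T) *m z^T) = (dot (y *m B *m H) (z *m B))%:M.
  by rewrite [LHS]mx11_scalar /dot trmx_mul !mulmxA.
have [||P uP eP] := lorentz_congruence ST (e := e).
- by rewrite formE -eE mxE eqxx.
- move=> y y0; rewrite !formE -eE => xv; set x := y *m B in xv *.
  have x0 : x != 0.
    apply: contra_neq y0 => x0; move/row_free_inj: Bfree; apply.
    by rewrite mul0mx.
  have {}xv : dot (x *m H) v = 0 by move/matrixP/(_ 0 0): xv; rewrite !mxE eqxx.
  have tx : tangent p x by rewrite /tangent dotC /dot /x -mulmxA Bt mulmx0 mxE.
  rewrite mxE eqxx mulr1n; pose z := x - dot x v *: v.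
  have tz : tangent p z by rewrite /tangent dotBr dotZr tx (tangent_hopf p) mulr0 subrr.
  have zv : dot z v = 0 by rewrite dotBl dotZl sphere_hopf// mulr1 subrr.
  have vx : dot (v *m H) x = 0 by rewrite dot_mulmxl HT dotC.
  have qE : dot (x *m H) x = dot (z *m H) z - dot x v ^+ 2 * dot (v *m H) v.
    have -> : dot (z *m H) z = dot (x *m H) x - dot x v * dot (x *m H) v
        - dot x v * (dot (v *m H) x - dot x v * dot (v *m H) v).
      rewrite /z; move: (dot x v) => c.
      by rewrite mulmxBl -scalemxAl dotBl dotZl !dotBr !dotZr.
    by rewrite xv vx; ring.
  have [z0|z0] := eqVneq z 0.
    have xE : x = dot x v *: v by apply/eqP; rewrite -subr_eq0 -/z z0.
    rewrite qE z0 mul0mx dot0l sub0r -mulrN mulr_gt0 ?oppr_gt0// exprn_even_gt0//=.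
    by apply: contra_neq x0 => c0; rewrite xE c0 scale0r.
  by rewrite qE ltr_wpDr ?hx// -mulrN mulr_ge0 ?sqr_ge0// oppr_ge0 ltW.
by exists P => //; rewrite Bg.
Qed.

Lemma lorentzian_det : lorentzian_at h p -> exists2 x : R, x != 0 &
  x ^+ 2 * \det (gram h (tbasis p)) =
  \det (diag_mx (\row_(i < \rank (kermx p^T)) (if (i == 0 :> nat)%N then -1 else 1 : R))).
Proof.
move=> [P uP eP]; exists (\det P); first by rewrite -unitfE -unitmxE.
rewrite -eP gram_mul_tbasis !det_mulmx det_tr.
have -> : gram h (tbasis p) = tbasis p *m H *m (tbasis p)^T.
  by have := gram_mul_tbasis 1%:M; rewrite trmx1 !mul1mx mulmx1.
by ring.
Qed.

End LorentzCriterion.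

(** Two Lorentzian forms have Gram determinants of the same sign in a common basis, each being a
    positive multiple of the determinant of the same diagonal matrix. *)
Lemma lorentzian_endo_gt0 (R : realType) (m : nat) (mu : R)
    (p : 'rV[R]_(m.+1 + m.+1)) h H : mu != 0 -> sphere p ->
  (forall y z, tangent p y -> tangent p z -> h y z = dot (y *m H) z) ->
  lorentzian_at h p -> lorentzian_at (berger mu p) p ->
  0 < \det (endo_mx (berger mu p) h p).
Proof.
move=> mu0 Sp hE Lh Lg; have [x x0 ex] := lorentzian_det hE Lh.
have gE y z : tangent p y -> tangent p z -> berger mu p y z = dot (y *m berger_mx mu p) z.
  by move=> _ _; exact: berger_mxE.
have [y y0 ey] := lorentzian_det gE Lg.
have ug : gram (berger mu p) (tbasis p) \in unitmx.
  rewrite gram_bergerE//.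
  by have [] := gram_berger_inv Sp (tbasis_tangent p) (tbasis_free p) (tbasis_full p) mu0.
have d0 : \det (gram (berger mu p) (tbasis p)) != 0 by rewrite -unitfE -unitmxE.
rewrite /endo_mx det_mulmx det_inv.
have -> : \det (gram h (tbasis p)) = y ^+ 2 * \det (gram (berger mu p) (tbasis p)) / x ^+ 2.
  by rewrite ey -ex mulrC mulKf// expf_neq0.
rewrite mulrAC mulfK// divr_gt0// exprn_even_gt0//.
Qed.

Lemma Ck_fst (R : realType) (V : normedModType R) k (U : set (R^o * V)) :
  open U -> Ck k U (fun z => z.1 : R).
Proof.
move=> oU; have ls : linear (fun z : R^o * V => z.1 : R^o) by move=> a u v.
pose L := HB.pack (fun z : R^o * V => z.1 : R^o) (GRing.isLinear.Build _ _ _ _ _ ls) :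
  {linear (R^o * V)%type -> R^o}.
have cL : continuous L by move=> z; exact: cvg_fst.
exact: (Ck_linear k oU cL).
Qed.

Lemma Ck_comp_snd (R : realType) (V W : normedModType R) k (U : set V) (f : V -> W) :
  Ck k U f -> Ck k [set z : R^o * V | U z.2] (fun z => f z.2).
Proof.
elim: k f => [|k IH] f.
  move=> cf z Uz; apply: (@continuous_comp _ _ _ snd f); first exact: cvg_snd.
  exact: cf.
move=> [df Df]; split=> [z Uz|v].
  apply: (@differentiable_comp _ _ _ _ (fun z : R^o * V => z.2) f); last exact: df.
  have ls : linear (fun z : R^o * V => z.2) by move=> a u w.
  pose L := HB.pack (fun z : R^o * V => z.2) (GRing.isLinear.Build _ _ _ _ _ ls) :
    {linear (R^o * V)%type -> V}.
  have cL : continuous L by move=> y; exact: cvg_snd.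
  exact: (linear_differentiable z cL).
rewrite [X in Ck _ _ X](_ : _ = (fun z : R^o * V => 'D_(v.2) f z.2)); first exact: (IH _ (Df v.2)).
by apply/funext => z; apply: (derive_quotient _).1 => h.
Qed.

(** * A variation of the Hopf field with prescribed velocity *)

Section HopfVariation.
Context {R : realType} {m : nat}.
Local Notation n := (m.+1 + m.+1)%N.
Local Notation E := 'rV[R]_n.
Variables (mu : R) (mu0 : mu != 0).
Variable A : E -> E.
Hypotheses (sA : smoothS A) (CA : forall k, Ck k [set: E] A).
Hypothesis hA : forall p, sphere p -> dot (A p) p = 0 /\ dot (A p) (hopf p) = 0.
Implicit Types (p x : E) (t : R).
Local Notation ep := (mu / `|mu|).

(* The rational parametrization of the conic through the Hopf field with
   initial velocity A keeps g_mu(X, X) = mu / |mu| for both signs of mu. *)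
Definition hopf_variation t p : E :=
  (1 + ep * (t / 2) ^+ 2 * dot (A p) (A p))^-1 *:
    ((1 - ep * (t / 2) ^+ 2 * dot (A p) (A p)) *: hopf_unit mu p + t *: A p).

Let ep2 : ep ^+ 2 = 1.
Proof. by rewrite expr_div_n real_normK ?num_real// divff// expf_neq0. Qed.

Lemma hopf_variation0 : hopf_variation 0 = hopf_unit mu.
Proof.
apply/funext => p; rewrite /hopf_variation mul0r expr0n/= mulr0 mul0r addr0 subr0.
by rewrite invr1 !scale1r scale0r addr0.
Qed.

(** Keeps the denominator of [hopf_variation] positive uniformly on the sphere, for both signs of
    mu. *)
Lemma sphere_field_bound : exists2 d : R, 0 < d &
  forall t p, `|t| < d -> sphere p -> `|ep * (t / 2) ^+ 2 * dot (A p) (A p)| < 1.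
Proof.
have Ca : Ck 0 [set: E] (fun p => dot (A p) (A p)) by exact: (Ck_dot openT (CA 0%N) (CA 0%N)).
have [M M0 HM] := compact_bounded_continuous (@compact_sphere R n) (fun p _ => Ca p Logic.I).
have M1 : 0 < 1 + M by rewrite ltr_pwDl.
exists (1 + M)^-1; first by rewrite invr_gt0.
move=> t p td Sp; have HMp := HM p Sp; have ne : `|ep| = 1.
  by rewrite normrM normfV normr_id divff ?normr_eq0.
rewrite (normrM (ep * _)) (normrM ep) ne mul1r normrX (normrM t) normfV (@ger0_norm _ 2)//.
have t0 := normr_ge0 t; have td' : `|t| * (1 + M) < 1 by rewrite -ltr_pdivlMr// div1r.
move: (normr_ge0 (dot (A p) (A p))) HMp; move: (`|dot _ _|) (`|t|) t0 td' => a u u0 ud a0 aM.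
have h1 : u <= 1 by nra.
have h2 : u * a <= u * M by rewrite ler_wpM2l.
have h3 : u * (u * a) <= 1 * (u * M) by rewrite ler_pM// mulr_ge0.
by rewrite expr2; nra.
Qed.

Lemma hopf_variation_unit t p : sphere p -> `|ep * (t / 2) ^+ 2 * dot (A p) (A p)| < 1 ->
  tangent p (hopf_variation t p) /\
  berger mu p (hopf_variation t p) (hopf_variation t p) = ep.
Proof.
move=> Sp; have [Ap Av] := hA Sp; rewrite ltr_norml => /andP[h1 h2].
have dn : 1 + ep * (t / 2) ^+ 2 * dot (A p) (A p) != 0.
  by rewrite gt_eqF// -ltrBlDl sub0r.
rewrite /hopf_variation /hopf_unit /tangent; split.
  by rewrite dotZr dotDr !dotZr (tangent_hopf p) [dot p (A p)]dotC Ap !mulr0 addr0 mulr0.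
have r0 : Num.sqrt `|mu| != 0 by rewrite sqrtr_eq0 -ltNge normr_gt0.
have r2 : Num.sqrt `|mu| ^+ 2 = `|mu| by rewrite sqr_sqrtr.
have e1 : mu / Num.sqrt `|mu| ^+ 2 = ep by rewrite r2.
rewrite bergerE// !dotZl !dotZr !dotDl !dotDr !dotZl !dotZr sphere_hopf// Av.
rewrite [dot (hopf p) (A p)]dotC Av.
set a := dot (A p) (A p) in dn *; set r := Num.sqrt `|mu| in r0 e1 *.
set u := ep * (t / 2) ^+ 2 * a in dn *.
(* As ep^2 = 1, the numerator of the norm becomes ep (1 - u)^2 + 4 ep u = ep (1 + u)^2. *)
have tE : t * (t * a) = 4 * ep * u.
  rewrite /u; have -> : 4 * ep * (ep * (t / 2) ^+ 2 * a) = ep ^+ 2 * (4 * (t / 2) ^+ 2 * a) by ring.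
  by rewrite ep2 mul1r; field.
transitivity ((1 + u) ^- 2 * ((1 - u) ^+ 2 * (mu / r ^+ 2) + t * (t * a))).
  by field; rewrite r0 dn.
by rewrite e1 tE; move: dn; move: (ep) => e dn; field.
Qed.

Lemma hopf_variation_smooth (d : R) : 0 < d ->
  (forall t p, `|t| < d -> sphere p -> `|ep * (t / 2) ^+ 2 * dot (A p) (A p)| < 1) ->
  smooth_on [set tx : R^o * E | `|tx.1| < d /\ tx.2 != 0]
    (fun tx => ext (hopf_variation tx.1) tx.2).
Proof.
move=> d0 Hd k; have oU := @open_variation_dom R m d; set U := [set tx | _] in oU *.
have Cs (W : normedModType R) (f : E -> W) : smoothS f -> Ck k U (fun z => ext f z.2).
  move=> sf; have : Ck k [set z : R^o * E | z.2 != 0] (fun z => ext f z.2).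
    exact: Ck_comp_snd (sf k).
  by apply: Ck_subset => z [].
have C1 : Ck k U (fun z => z.1 : R) by exact: Ck_fst.
have Ca : Ck k U (fun z => ext (fun p => dot (A p) (A p) : R^o) z.2 : R).
  exact: (Cs _ _ (smoothS_dot sA sA)).
have Cu : Ck k U (fun z => ep * (z.1 / 2) ^+ 2 * ext (fun p => dot (A p) (A p) : R^o) z.2).
  apply: (Ck_mul oU _ Ca); apply: (Ck_mul oU (Ck_cst k (ep : R) oU)).
  exact: (Ck_exp 2 oU (Ck_mul oU C1 (Ck_cst k (2^-1 : R) oU))).
have C11 := Ck_cst k (1 : R) oU.
apply: (Ck_scalemx oU).
  apply: (Ck_inv oU) => [z [z1 z2]|]; last exact: (Ck_add oU C11 Cu).
  have := Hd _ _ z1 (sphere_normalize z2); rewrite ltr_norml => /andP[h _].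
  by rewrite gt_eqF// -ltrBlDl sub0r.
apply: (Ck_add oU (Ck_scalemx oU (Ck_sub oU C11 Cu) (Cs _ _ (smoothS_hopf_unit mu)))).
exact: (Ck_scalemx oU C1 (Cs _ _ sA)).
Qed.

Lemma velocity_hopf_variation p : velocity hopf_variation p = A p.
Proof.
rewrite /velocity; set a := dot (A p) (A p).
suff D : is_derive (0 : R) 1 (hopf_variation ^~ p) (A p) by have [_ ->] := D.
apply: is_derive_mx => i j.
pose q (t : R) : R := ep * (t / 2) ^+ 2 * a.
have Dq : is_derive (0 : R) (1 : R) q 0.
  have [h1 h2] := is_deriveM (is_derive_id (0 : R) (1 : R))
    (is_deriveZ (ep / 4 * a) (is_derive_id (0 : R) (1 : R))).
  have qE : (id : R -> R) * ((ep / 4 * a) \*: id) = q.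
    apply/funext => t; change (t * (ep / 4 * a * t) = ep * (t / 2) ^+ 2 * a).
    by move: ep => e; field.
  apply: DeriveDef; first by rewrite -qE.
  rewrite -qE; apply: etrans h2 _; change (0 * (ep / 4 * a * 1) + ep / 4 * a * 0 * 1 = 0).
  by rewrite mul0r mulr0 mul0r addr0.
have q0 : q 0 = 0 by rewrite /q mul0r expr0n/= mulr0 mul0r.
pose g (t : R) : R := 1 + q t.
have D1 : is_derive (0 : R) (1 : R) g 0.
  by have := is_deriveD (is_derive_cst (1 : R) (0 : R) (1 : R)) Dq; rewrite addr0.
have D2 : is_derive (0 : R) (1 : R) (fun t : R => (1 - q t) * hopf_unit mu p i j + t * A p i j) (A p i j).
  have D3 := is_deriveM (is_deriveB (is_derive_cst (1 : R) (0 : R) (1 : R)) Dq)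
    (is_derive_cst (hopf_unit mu p i j) (0 : R) (1 : R)).
  have D4 := is_deriveM (is_derive_id (0 : R) (1 : R)) (is_derive_cst (A p i j) (0 : R) (1 : R)).
  have [h1 h2] := is_deriveD D3 D4; apply: DeriveDef; first exact: h1.
  apply: etrans h2 _.
  change ((1 - q 0) * 0 + hopf_unit mu p i j * (0 - 0) + (0 * 0 + A p i j * 1) = A p i j).
  by rewrite subr0 !mulr0 !add0r mulr1.
have n0 : g 0 != 0 by rewrite /g q0 addr0 oner_neq0.
have [h1 h2] := is_deriveM (is_deriveV n0 D1) D2.
have fE : (fun t => hopf_variation t p i j) =
    (fun t => (g t)^-1) * (fun t : R => (1 - q t) * hopf_unit mu p i j + t * A p i j).
  by apply/funext => t; rewrite /hopf_variation !mxE.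
apply: DeriveDef; first by rewrite fE.
rewrite fE; apply: etrans h2 _.
change ((1 + q 0)^-1 * A p i j +
  ((1 - q 0) * hopf_unit mu p i j + 0 * A p i j) * (- (1 + q 0) ^- 2 * 0) = A p i j).
by rewrite !mulr0 addr0 q0 addr0 invr1 mul1r.
Qed.

Lemma hopf_variation_vfield (d : R) : 0 < d ->
  (forall t p, `|t| < d -> sphere p -> `|ep * (t / 2) ^+ 2 * dot (A p) (A p)| < 1) ->
  forall t, `|t| < d -> unit_vfield mu (hopf_variation t).
Proof.
move=> d0 Hd t td; split; last by move=> p Sp; have [] := hopf_variation_unit Sp (Hd t p td Sp).
split; last by move=> p Sp; have [] := hopf_variation_unit Sp (Hd t p td Sp).
by move=> k; apply: Ck_subset (Ck_slice t (hopf_variation_smooth d0 Hd k)) => x x0; split.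
Qed.

End HopfVariation.

(** * Instability of the Hopf field *)

Section Instability.
Context {R : realType} {m : nat}.
Local Notation n := (m.+1 + m.+1)%N.
Local Notation E := 'rV[R]_n.
Local Notation S := (sphere : set (borel R n)).
Variables (mu : R) (mu0 : mu != 0).
Variable nabla : (E -> E) -> E -> E -> E.
Hypothesis LC : levi_civita (berger mu) nabla.
Implicit Types (A X : E -> E) (p x : E) (Xt : R -> E -> E).

Lemma berger_lorentzian p : mu < 0 -> sphere p -> lorentzian_at (berger mu p) p.
Proof.
move=> mun Sp.
apply: (lorentzian_criterion Sp (H := berger_mx mu p)) => [y z _ _|||x tx xv x0].
- exact: berger_mxE.
- exact: tr_berger_mx.
- by rewrite -berger_mxE// bergerE// sphere_hopf//; lra.
by rewrite -berger_mxE// bergerE// xv mulr0 mulr0 addr0 dot_gt0.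
Qed.

(** [hopf_nabla] kills V and has horizontal image. Hence V sees only M, and the first bound keeps
    the form negative there. For horizontal x the only negative contribution is (mu - 1) <x, V
    M^T>^2, which the second bound makes smaller than |x|^2. *)
Lemma pullback_lorentzian X p : mu < 0 -> vfield X -> sphere p ->
  let M := nabla_mx mu p (X p) (grad_mx X p) - hopf_nabla mu p in
  (1 + `|mu - 1|) * dot (hopf p *m M) (hopf p *m M) < - mu ->
  (1 - mu) * dot (hopf p *m M^T) (hopf p *m M^T) < 1 ->
  lorentzian_at (pullback_sasaki (berger mu) nabla X p) p.
Proof.
move=> mun vX Sp M; set N := nabla_mx _ _ _ _ in M * => h1 h2.
have NE : N = hopf_nabla mu p + M by rewrite /M [hopf_nabla mu p + _]addrC subrK.
have GT := tr_berger_mx mu p.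
have qE x : dot (x *m (berger_mx mu p + N *m berger_mx mu p *m N^T)) x =
    berger mu p x x + dot (x *m N *m berger_mx mu p) (x *m N).
  rewrite berger_mxE//; move: (berger_mx mu p) (N) => G N'.
  by rewrite mulmxDr dotDl; congr (_ + _); rewrite [RHS]dotC [RHS]dot_mulmxl [RHS]dotC !mulmxA.
apply: (lorentzian_criterion Sp (H := berger_mx mu p + N *m berger_mx mu p *m N^T)).
- by move=> y z ty tz; exact: (pullback_sasakiE mu0 LC vX Sp ty tz).
- move: GT; move: (berger_mx mu p) (N) => G N' GT.
  by rewrite linearD/= !trmx_mul trmxK GT mulmxA.
- rewrite qE bergerE// sphere_hopf//.
  have -> : hopf p *m N = hopf p *m M.
    have := hopf_nabla_kill mu Sp; rewrite NE; move: (hopf_nabla mu p) (M) => N0 M' e.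
    by rewrite mulmxDr e add0r.
  have := berger_mx_le mu Sp (hopf p *m M); move=> h; lra.
move=> x tx xv x0; rewrite qE bergerE// xv -berger_mxE// bergerE//.
have yv : dot (x *m N) (hopf p) = dot x (hopf p *m M^T).
  have h := hopf_nabla_kill mu Sp; have hT := tr_hopf_nabla mu p.
  rewrite dot_mulmxl NE; move: (hopf_nabla mu p) (M) h hT => N0 M' h hT.
  by rewrite linearD/= hT mulmxDr mulmxN h oppr0 add0r.
rewrite yv; have c := dot_cauchy x (hopf p *m M^T).
have xx : 0 < dot x x by rewrite dot_gt0.
have y0 := dot_ge0 (x *m N); have w0 := dot_ge0 (hopf p *m M^T).
move: c xx y0 w0 h2; move: (dot x x) (dot (x *m N) (x *m N)) (dot x (hopf p *m M^T)).
move: (dot (hopf p *m M^T) (hopf p *m M^T)) => w a b y c xx y0 w0 h2.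
have m1 : 0 <= 1 - mu by lra.
have h3 := ler_wpM2l m1 c.
have h4 : a * ((1 - mu) * w) < a * 1 by rewrite ltr_pM2l.
by rewrite mulr0 mulr0 addr0; nra.
Qed.

(** The deviation M vanishes at t = 0, so the two smallness conditions of [pullback_lorentzian] hold
    near t = 0 at each point; compactness of the sphere makes the time uniform. *)
Lemma hopf_variation_lorentzian A : mu < 0 -> smoothS A -> (forall k, Ck k [set: E] A) ->
  (forall p, sphere p -> dot (A p) p = 0 /\ dot (A p) (hopf p) = 0) ->
  exists2 d : R, 0 < d & forall t, `|t| < d -> forall p, sphere p ->
    lorentzian_at (pullback_sasaki (berger mu) nabla (hopf_variation mu A t) p) p.
Proof.
move=> mun sA CA hA; have [d d0 Hd] := sphere_field_bound mu0 CA.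
have oU := @open_variation_dom R m d.
have Xsm := hopf_variation_smooth sA d0 Hd.
have Xun := hopf_variation_vfield mu0 sA hA d0 Hd.
pose F (tx : R^o * E) := ext (hopf_variation mu A tx.1) tx.2.
have CM : Ck 0 _ (nabla_deviation mu F) := Ck_nabla_deviation mu oU (Xsm 1%N).
have Cv := Ck_hopf_snd 0 oU.
pose f (z : R^o * E) := dot (hopf z.2 *m nabla_deviation mu F z) (hopf z.2 *m nabla_deviation mu F z) +
  dot (hopf z.2 *m (nabla_deviation mu F z)^T) (hopf z.2 *m (nabla_deviation mu F z)^T).
have CvM := Ck_mulmx oU Cv CM; have CvMT := Ck_mulmx oU Cv (Ck_trmx oU CM).
have Cf := Ck_add oU (Ck_dot oU CvM CvM) (Ck_dot oU CvMT CvMT).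
have X0 p : sphere p -> hopf_variation mu A 0 p = hopf_unit mu p by move=> _; rewrite hopf_variation0.
pose e := Num.min (- mu / (1 + `|mu - 1|)) (1 - mu)^-1.
have c1 : 0 < 1 + `|mu - 1| by rewrite ltr_pwDl.
have c2 : 0 < 1 - mu by lra.
have e0 : 0 < e by rewrite lt_min divr_gt0// ?oppr_gt0// invr_gt0.
have near0 : \forall t \near (0 : R^o), (sphere : set E) `<=` (fun p => f (t, p) < e).
  have /compact_near_coveringP cov := @compact_sphere R n.
  apply: (cov _ (nbhs (0 : R^o)) (fun t p => f (t, p) < e)) => p Sp.
  have U0 : [set tx : R^o * E | `|tx.1| < d /\ tx.2 != 0] (0, p).
    by split; rewrite /= ?normr0//; exact: sphere_neq0.
  have f0 : f (0, p) < e.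
    by rewrite /f /F /= (nabla_deviation0 d0 X0 Sp) trmx0 !mulmx0 dot0l addr0.
  have [[B C] [/= nB nC] BC] : \forall z \near ((0 : R^o), p), f z < e by exact: (cvgr_lt _ (Cf (0, p) U0)).
  exists (C, B); first exact: (conj nC nB).
  by move=> [p' t] [Cp' Bt]; exact: (BC (t, p') (conj Bt Cp')).
have /nbhs_ballP [d1 d10 Hd1] := near0.
exists (Num.min d d1); first by rewrite lt_min d0.
move=> t; rewrite lt_min => /andP[td td1] p Sp.
have fe : f (t, p) < e.
  have bt : ball (0 : R^o) d1 t by rewrite /ball/= sub0r normrN.
  exact: (Hd1 t bt p Sp).
have [vX _] := Xun t td.
move: fe; rewrite /f /F /= (nabla_deviation_variation mu _ td Sp) lt_min => /andP[fe1 fe2].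
set M := _ - _ in fe1 fe2.
have q1 := dot_ge0 (hopf p *m M); have q2 := dot_ge0 (hopf p *m M^T).
apply: (pullback_lorentzian mun vX Sp); rewrite -/M.
  rewrite mulrC -ltr_pdivlMr//; apply: le_lt_trans fe1; by rewrite lerDl.
rewrite mulrC -ltr_pdivlMr// div1r; apply: le_lt_trans fe2; by rewrite lerDr.
Qed.

(** The second hypothesis covers all variations: with A the velocity of [Xt] itself it gives
    criticality, and with A fixed it gives the Hessian. *)
Lemma unstable_criticalI (Phi : (E -> E) -> R) (D : set (E -> E)) (hess : (E -> E) -> R) :
  D (hopf_unit mu) ->
  (forall Xt A, smooth_variation D (hopf_unit mu) Xt ->
    (forall p, sphere p -> velocity Xt p = A p) ->
    let f := (fun t => Phi (Xt t)) : R^o -> R^o in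
    [/\ is_derive (0 : R^o) 1 f 0, \forall t \near (0 : R^o), derivable f t 1 &
        is_derive (0 : R^o) 1 (fun t => 'D_1 f t) (hess A)]) ->
  (exists A, [/\ smoothS A, forall p, sphere p -> dot (A p) p = 0 /\ dot (A p) (hopf p) = 0,
    smooth_variation D (hopf_unit mu) (hopf_variation mu A) & hess A < 0]) ->
  unstable_critical (berger mu) Phi D (hopf_unit mu).
Proof.
move=> DX var [A [sA hA vA nA]]; split.
  by split=> // Xt vX; have [] := var Xt (velocity Xt) vX (fun _ _ => erefl).
exists A, (hess A); split=> //.
- by split=> // p Sp; rewrite /tangent dotC; have [] := hA p Sp.
- move=> p Sp; have [_ Av] := hA p Sp.
  by rewrite bergerE// /hopf_unit dotZr Av mulr0 mul0r mulr0 addr0.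
split; first by exists (hopf_variation mu A) => // p _; exact: velocity_hopf_variation.
by move=> Xt vX vel f; have [_ h1 h2] := var Xt A vX vel.
Qed.

(** The Hopf field is the variation with A = 0 taken at t = 0, so smoothness and normalization are
    already available. *)
Lemma unit_vfield_hopf : unit_vfield mu (hopf_unit mu : E -> E).
Proof.
have [d d0 Hd] := @sphere_field_bound R m mu mu0 (fun=> 0) (fun k => Ck_cst k 0 openT).
rewrite -(hopf_variation0 mu (fun=> 0)).
apply: (hopf_variation_vfield mu0 (smoothS_cst (0 : E)) _ d0 Hd); last by rewrite normr0.
by move=> p _; rewrite !dot0l.
Qed.

Lemma smooth_hopf_variation A : smoothS A -> (forall k, Ck k [set: E] A) ->
  (forall p, sphere p -> dot (A p) p = 0 /\ dot (A p) (hopf p) = 0) ->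
  smooth_variation (unit_vfield mu) (hopf_unit mu) (hopf_variation mu A).
Proof.
move=> sA CA hA; have [d d0 Hd] := sphere_field_bound mu0 CA.
split; first by move=> p _; rewrite hopf_variation0.
exists d => //; split; first exact: hopf_variation_smooth.
exact: hopf_variation_vfield.
Qed.

Lemma gen_energy_unstable l (nu : {measure set (borel R n) -> \bar R}) :
  (1 <= m)%N -> l < 0 -> volume_measure (berger l) nu ->
  unstable_critical (berger mu) (gen_energy (berger mu) nabla (berger l) nu)
    (unit_vfield mu) (hopf_unit mu).
Proof.
move=> hm ln Hnu; have l0 : l != 0 by rewrite lt_eqF.
have [A [CA sA hA nA]] := energy_hessian_negative mu l0 hm Hnu ln.
apply: (unstable_criticalI unit_vfield_hopf (hess := fun A => \int[nu]_(p in S)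
  (\tr (nabla_mx mu p (A p) (grad_mx A p) *m berger_mx mu p *m
     (nabla_mx mu p (A p) (grad_mx A p))^T *m inv_berger l p)
   - 2 * 1 * (m%:R * mu) * berger mu p (A p) (A p)))).
  move=> Xt B [X0 [d d0 [Xsm Xun]]] vel f.
  exact: (energy_variation mu0 l0 LC Hnu d0 X0 Xsm Xun vel (Phi := f) erefl).
by exists A; split=> //; exact: smooth_hopf_variation.
Qed.

Lemma volume_unstable (nu : {measure set (borel R n) -> \bar R}) :
  (1 <= m)%N -> mu < 0 -> volume_measure (berger mu) nu ->
  unstable_critical (berger mu) (volume (berger mu) nabla nu)
    (volume_dom mu nabla) (hopf_unit mu).
Proof.
move=> hm mun Hnu.
have [A [CA sA hA nA]] := volume_hessian_negative mu0 mu0 hm Hnu mun.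
have [d1 d10 L] := hopf_variation_lorentzian mun sA CA hA.
have DX : volume_dom mu nabla (hopf_unit mu).
  split; first exact: unit_vfield_hopf.
  move=> _ p Sp; rewrite -(hopf_variation0 mu A).
  by apply: L => //; rewrite normr0.
pose b := Num.sqrt ((1 + `|mu|) ^+ n * (1 + `|mu|) ^- 2).
pose N B p := nabla_mx mu p (B p) (grad_mx B p).
pose K B p := hopf_resolvent mu p *m ((hopf_nabla mu p *m (N B p)^T +
  N B p *m (hopf_nabla mu p)^T) *m inv_berger mu p).
apply: (unstable_criticalI DX (hess := fun B => \int[nu]_(p in S)
  (b * (\tr (N B p *m berger_mx mu p *m (N B p)^T *m (inv_berger mu p *m hopf_resolvent mu p)) +
     4^-1 * \tr (K B p) ^+ 2 - 2^-1 * \tr (K B p *m K B p))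
   - 2 * (b * (1 + `|mu|)^-1) * (m%:R * mu) * berger mu p (B p) (B p)))); last first.
  exists A; split=> //.
  have [X0 [d d0 [Xsm Xun]]] := smooth_hopf_variation sA CA hA.
  (* The variation is defined and normalized for |t| < d, and stays in the Lorentzian domain for |t|
     < d1. *)
  split=> //; exists (Num.min d d1); first by rewrite lt_min d0.
  split=> [k|t].
    by apply: Ck_subset (Xsm k) => z []; rewrite lt_min => /andP[].
  rewrite lt_min => /andP[td td1]; split; first exact: Xun.
  by move=> _ p Sp; exact: L.
move=> Xt B [X0 [d d0 [Xsm Xdom]]] vel f.
have Xun t : `|t| < d -> unit_vfield mu (Xt t) by move=> td; exact: (Xdom t td).1.
apply: (volume_variation mu0 mu0 LC Hnu d0 X0 Xsm Xun vel (Phi := f) erefl _ erefl) => t p td Sp.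
have vX := (Xun t td).1.
apply: (lorentzian_endo_gt0 mu0 Sp (H := _)); last exact: berger_lorentzian.
  by move=> y z ty tz; exact: (pullback_sasakiE mu0 LC vX Sp ty tz).
exact: ((Xdom t td).2 mun p Sp).
Qed.

End Instability.

Theorem theorem3p6 (R : realType) (m : nat) (hm : (1 <= m)%N) :
  (forall mu : R, mu < 0 ->
     forall nabla : ('rV[R]_(m.+1 + m.+1) -> 'rV[R]_(m.+1 + m.+1)) ->
         'rV[R]_(m.+1 + m.+1) -> 'rV[R]_(m.+1 + m.+1) -> 'rV[R]_(m.+1 + m.+1),
     levi_civita (berger mu) nabla ->
     forall dv : {measure set (borel R (m.+1 + m.+1)) -> \bar R},
     volume_measure (berger mu) dv ->
     unstable_critical (berger mu) (energy (berger mu) nabla dv)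
       (unit_vfield mu) (hopf_unit mu)
     /\
     unstable_critical (berger mu) (volume (berger mu) nabla dv)
       (volume_dom mu nabla) (hopf_unit mu))
  /\
  (forall lambda mu : R, lambda < 0 -> mu != 0 ->
     forall nabla : ('rV[R]_(m.+1 + m.+1) -> 'rV[R]_(m.+1 + m.+1)) ->
         'rV[R]_(m.+1 + m.+1) -> 'rV[R]_(m.+1 + m.+1) -> 'rV[R]_(m.+1 + m.+1),
     levi_civita (berger mu) nabla ->
     forall dv : {measure set (borel R (m.+1 + m.+1)) -> \bar R},
     volume_measure (berger lambda) dv ->
     unstable_critical (berger mu)
       (gen_energy (berger mu) nabla (berger lambda) dv)
       (unit_vfield mu) (hopf_unit mu)).
Proof.
split=> [mu mun nabla LC dv Hdv|l mu ln mu0 nabla LC dv Hdv]; last first.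
  exact: gen_energy_unstable.
have mu0 : mu != 0 by rewrite lt_eqF.
by split; [exact: gen_energy_unstable|exact: volume_unstable].
Qed.
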